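(* Let $f:\mathbb{D}\to\mathbb{C}$ be either a univalent sense-preserving harmonic mapping with $f_{\overline z}(0)=0$, or a constant function. Let $\alpha\in\mathbb{C}$, let $\{r_j\}\subset(0,1)$ and $\{M_j\}\subset(0,\infty)$ be sequences with $\lim_{j\to\infty}r_j=1$ and $\lim_{j\to\infty}M_j=0$, and let $\{C_j\}$ be a sequence of nondegenerate continua such that $C_j\subseteq\mathbb{D}(r_j)$, $C_j\to\partial\mathbb{D}$ as $j\to\infty$, and $|f(z)-\alpha|<M_j$ for all $z\in C_j$. (i) If $$\limsup_{j\to\infty}\ \tau_2\!\left(\frac{1}{d(C_j)}\right)\left(\log\frac{1}{M_j}\right)\frac{1-r_j}{1+r_j}=\infty,$$ where $\tau_2$ is the Teichmüller capacity function, then $f\equiv\alpha$ in $\mathbb{D}$. (ii) In particular, if $$\limsup_{j\to\infty}\ \left(\log\frac{1}{d(C_j)}\right)^{-1}\left(\log\frac{1}{M_j}\right)\frac{1-r_j}{1+r_j}=\infty,$$ then $f\equiv\alpha$.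
   Context: $\mathbb{D}$ is the open unit disk in $\mathbb{C}$, $\partial\mathbb{D}$ is the unit circle, and $\mathbb{D}(r)=\{z\in\mathbb{C}:|z|<r\}$. A harmonic mapping is a complex-valued continuous function $f=u+iv$ with $u,v$ real harmonic; univalent means injective. On $\mathbb{D}$ it can be written $f=h+\overline g$ with $h,g$ analytic, and a univalent harmonic mapping is sense-preserving if $|h'(z)|>|g'(z)|$ for all $z$, i.e. $|f_z|>|f_{\overline z}|$ everywhere, where $f_z$ and $f_{\overline z}$ are the complex partial derivatives $\partial f/\partial z$ and $\partial f/\partial\overline z$. A continuum is a compact connected set; it is nondegenerate if it contains more than one point. $d(A)=\sup\{|z-w|:z,w\in A\}$ denotes the Euclidean diameter of $A$. $C_j\to\partial\mathbb{D}$ means that $\inf\{|z|:z\in C_j\}\to1$ as $j\to\infty$. For a family $\Gamma$ of paths in $\mathbb{C}$, its conformal modulus is $$\mathcal{M}(\Gamma)=\inf_{\rho}\iint_{\mathbb{C}}\rho^2\,dx\,dy,$$ where the infimum is over all Borel functions $\rho:\mathbb{C}\to[0,\infty]$ with $\int_\gamma\rho\,|dz|\ge1$ for every locally rectifiable $\gamma\in\Gamma$. For sets $A,B$, $\Delta(A,B)$ is the family of all curves in the plane connecting $A$ and $B$. The Teichmüller capacity function is $\tau_2(s)=\mathcal{M}\big(\Delta([-1,0],[s,\infty])\big)$ for $s>0$ (with $[-1,0]$ and $[s,\infty]$ on the real axis); $\tau_2:(0,\infty)\to(0,\infty)$ is a decreasing homeomorphism.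
   Formalization: Part (ii) is proved under the added assumption that the diameters d(C_j) do not accumulate at 1 from below (for some q<1, eventually not q<d(C_j)<1); without it (ii) is false, since (log 1/d(C_j))^{-1} blows up as d(C_j) tends to 1 from below. *)

(* Defs.v *)
From HB Require Import structures.
From mathcomp Require Import all_boot all_order all_algebra.
From mathcomp Require Export complex.
From mathcomp Require Import all_classical all_reals all_analysis.
From mathcomp Require Import measurable_realfun.

Set Implicit Arguments.
Unset Strict Implicit.
Unset Printing Implicit Defensive.
Import Order.TTheory GRing.Theory Num.Theory.
Import numFieldNormedType.Exports.

Local Open Scope classical_set_scope.
Local Open Scope ring_scope.
Local Open Scope complex_scope.

(* The usual topology of the complex plane, given by the modulus. *)
HB.instance Definition _ (R : realType) := NormedModule.copy R[i] R[i]^o.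

Section plane.
Context {R : realType}.
Implicit Types (z w : R[i]) (A B : set R[i]) (f : R[i] -> R[i]).

(* The real-valued modulus; the norm `|z| of R[i] is itself R[i]-valued. *)
Definition cabs z : R := ComplexField.Normc.normc z.

Definition disk (r : R) : set R[i] := [set z | cabs z < r].

Definition diam A : R := sup [set cabs (zw.1 - zw.2) | zw in A `*` A].

Definition nondegenerate_continuum A :=
  [/\ compact A, connected A & exists z w, [/\ A z, A w & z <> w]].

(* Derivatives and area are taken in the coordinates (x, y) of x + iy. *)
Definition of_xy (p : R * R) : R[i] := p.1 +i* p.2.
Definition to_xy z : R * R := (complex.Re z, complex.Im z).

End plane.

Section harmonic.
Context {R : realType}.
Implicit Types (f : R[i] -> R[i]) (u : R * R -> R) (z : R[i]).

Definition ex : R * R := (1, 0).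
Definition ey : R * R := (0, 1).

Definition C2_on (U : set (R * R)) u :=
  forall p, U p ->
    {for p, continuous u} /\
    forall v, v \in [:: ex; ey] ->
      [/\ derivable u p v, {for p, continuous ('D_v u)} &
        forall w, w \in [:: ex; ey] ->
          derivable ('D_v u) p w /\ {for p, continuous ('D_w ('D_v u))}].

Definition real_harmonic_on (U : set (R * R)) u :=
  C2_on U u /\
  forall p, U p -> 'D_ex ('D_ex u) p + 'D_ey ('D_ey u) p = 0.

Definition re_part f : R * R -> R := fun p => complex.Re (f (of_xy p)).
Definition im_part f : R * R -> R := fun p => complex.Im (f (of_xy p)).

Definition harmonic_mapping (U : set R[i]) f :=
  [/\ {within U, continuous f},
      real_harmonic_on (of_xy @^-1` U) (re_part f) &
      real_harmonic_on (of_xy @^-1` U) (im_part f)].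

Definition partial (v : R * R) f z : R[i] :=
  'D_v (re_part f) (to_xy z) +i* 'D_v (im_part f) (to_xy z).

Definition dz f z : R[i] := (partial ex f z - 'i%C * partial ey f z) / 2.
Definition dzbar f z : R[i] := (partial ex f z + 'i%C * partial ey f z) / 2.

Definition sense_preserving (U : set R[i]) f :=
  forall z, U z -> cabs (dzbar f z) < cabs (dz f z).

Definition univalent_sense_preserving_harmonic (U : set R[i]) f :=
  [/\ harmonic_mapping U f, set_inj U f & sense_preserving U f].

End harmonic.

Section modulus.
Context {R : realType}.

(* Only the values of the map on the parameter interval are relevant. *)
Record plane_path := PlanePath {
  path_dom : interval R;
  path_map :> R -> R[i];
  path_dom_neq0 : [set` path_dom] !=set0;
  path_continuous : {within [set` path_dom], continuous path_map} }.

Definition arc_length (g : R -> R[i]) (a b : R) : \bar R :=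
  ereal_sup [set (\sum_(0 <= k < size s)
                    cabs (g (nth b (a :: s) k.+1) - g (nth b (a :: s) k)))%:E
            | s in itv_partition a b].

(* Compact parameter intervals [a, b] contained in that of g. *)
Definition subarcs (g : plane_path) : set (R * R) :=
  [set ab | [/\ ab.1 \in path_dom g, ab.2 \in path_dom g & ab.1 <= ab.2]].

Definition locally_rectifiable (g : plane_path) :=
  forall ab, subarcs g ab -> (arc_length g ab.1 ab.2 < +oo)%E.

(* Parametrization of g restricted to [a, b] by arc length: the point reached
   at the first time t at which g has travelled a distance s from g a. *)
Definition arc_length_param (g : R -> R[i]) (a b s : R) : R[i] :=
  g (inf [set t | a <= t <= b /\ (s%:E <= arc_length g a t)%E]).

Definition line_integral (rho : R[i] -> \bar R) (g : plane_path) : \bar R :=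
  ereal_sup
    [set (\int[@lebesgue_measure R]_(s in
            [set` `[0%R, fine (arc_length g ab.1 ab.2)]])
            rho (arc_length_param g ab.1 ab.2 s))%E
    | ab in subarcs g].

(* Borel sets of the plane are those of R * R under (x, y) |-> x + iy. *)
Definition borel_plane (rho : R[i] -> \bar R) :=
  measurable_fun [set: measurableTypeR R * measurableTypeR R]
    (fun p => rho (of_xy p)).

Definition admissible (Gamma : set plane_path) : set (R[i] -> \bar R) :=
  [set rho | [/\ borel_plane rho, forall z, (0 <= rho z)%E &
     forall g, Gamma g -> locally_rectifiable g ->
       (1 <= line_integral rho g)%E]].

Definition conformal_modulus (Gamma : set plane_path) : \bar R :=
  ereal_inf
    [set (\int[@lebesgue_measure R \x @lebesgue_measure R]_p
            (rho (of_xy p) ^+ 2))%E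
    | rho in admissible Gamma].

Definition connecting (A B : set R[i]) : set plane_path :=
  [set g | exists a b, [/\ a <= b, path_dom g = `[a, b], A (g a) & B (g b)]].

(* The end point oo of [s, oo] is omitted: no closed path in the plane ends
   there. *)
Definition tau2 (s : R) : \bar R :=
  conformal_modulus
    (connecting [set x%:C | x in [set` `[(-1 : R), 0]]]
                [set x%:C | x in [set` `[s, +oo[]]).

End modulus.

(* Main.v *)
(* Let f be univalent and alpha = 0.  The dilatation omega = conj(f_zbar)/f_z is
   holomorphic and bounded by 1, and a Hopf-type argument (the maximum principle
   for omega^n / z on an annulus) gives 1 - |omega| >= c (1 - |z|), so that f is
   K-quasiconformal on D(r) with K = O(1/(1 - r)).
   If C is a continuum of diameter d in D(r) on which |f| < M, let
   Lam = log(del/M), where |f| >= del on a circle |z| = rho1.  Fix p in C.  Every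
   circle |z - p| = t, t < d/2, meets C, and a fan of segments joins these
   circles to the circle |z| = rho1 inside D(r).  The function log|f|, clamped
   between log M and log del, varies by at least Lam along each path made of a
   segment of the fan and an arc of a circle.  The Cauchy-Schwarz inequality and
   the area distortion of f bound the square of the average variation by
   C K log(1 + 1/d) times the integral of 1/|w|^2 over M < |w| < del, which is
   O(Lam); hence Lam = O(K log(1 + 1/d)).  Since tau2(1/d) = O(1/log(1 + 1/d)),
   neither upper limit is infinite.
   The length-area argument is carried out on a fine polar grid centred at p.  A
   grid cell contributes the area of a set contained in the image of a small
   disc; these sets are disjoint since f is injective. *)

From HB Require Import structures.
Require Import Defs.
From mathcomp Require Import all_boot all_order all_algebra.
From mathcomp Require Import all_classical all_reals all_analysis.
From mathcomp Require Import measurable_realfun.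
From mathcomp Require Import ring lra.
Import Order.TTheory GRing.Theory Num.Theory.
Import numFieldNormedType.Exports.
Set Implicit Arguments.
Unset Strict Implicit.
Unset Printing Implicit Defensive.
Local Open Scope classical_set_scope.
Local Open Scope ring_scope.
Local Open Scope complex_scope.

(** * The plane *)

(** The proof uses neither a change of variables nor a Cauchy formula. Regularity enters as strict
    differentiability, where both points of a difference quotient vary, so that error bounds hold
    near a point with one radius and, by compactness, on a closed disc. Holomorphy is the case of
    zero antiholomorphic part; an approximate mean value property on regular polygons is enough for
    the maximum principle. The mesh of the polar grid depends on [f], [r] and [M] without any
    control. This is harmless because the final inequality does not contain it: the number of cells
    on a path cancels against the number of rays or circles averaged over. The integral of 1/|w|^2
    becomes a count of dyadic squares, N + 1 = O(Lam) of them, each contributing a constant. The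
    estimate then reads Lam^2 = O(K Lam log(1 + 1/d)), and one factor Lam cancels. The factor 1 - r
    in the hypotheses offsets K. Additive constants are absorbed because d <= 2 keeps log(1 + 1/d)
    above log(3/2). *)

Section cabs_theory.
Context {R : realType}.
Implicit Types (z w : R[i]) (e : R).

Lemma cabs_ge0 z : 0 <= cabs z.
Proof. by case: z => a b; exact: sqrtr_ge0. Qed.

Lemma cabs0 : cabs (0 : R[i]) = 0.
Proof. exact: ComplexField.Normc.normc0. Qed.

Lemma cabs1 : cabs (1 : R[i]) = 1.
Proof. exact: ComplexField.Normc.normc1. Qed.

Lemma cabs_eq0 z : (cabs z == 0) = (z == 0).
Proof.
apply/eqP/eqP => [|->]; first exact: ComplexField.Normc.eq0_normc.
exact: cabs0.
Qed.

Lemma cabs_gt0 z : (0 < cabs z) = (z != 0).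
Proof. by rewrite lt_def cabs_ge0 andbT cabs_eq0. Qed.

Lemma cabsM z w : cabs (z * w) = cabs z * cabs w.
Proof. exact: ComplexField.Normc.normcM. Qed.

Lemma cabsV z : cabs z^-1 = (cabs z)^-1.
Proof. exact: ComplexField.Normc.normcV. Qed.

Lemma cabsX z n : cabs (z ^+ n) = cabs z ^+ n.
Proof. by elim: n => [|n IH]; rewrite ?expr0 ?cabs1// !exprS cabsM IH. Qed.

Lemma cabsN z : cabs (- z) = cabs z.
Proof. by rewrite /cabs normcN. Qed.

Lemma cabsBC z w : cabs (z - w) = cabs (w - z).
Proof. by rewrite -cabsN opprB. Qed.

Lemma le_cabsD z w : cabs (z + w) <= cabs z + cabs w.
Proof. exact: le_normcD. Qed.

Lemma le_cabsB z w : cabs (z - w) <= cabs z + cabs w.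
Proof. by rewrite -[cabs w]cabsN; exact: le_cabsD. Qed.

Lemma le_cabs_add z w e : cabs (z - w) <= e -> cabs z <= cabs w + e.
Proof.
move=> h; rewrite -{1}(subrK w z) addrC; apply: le_trans (le_cabsD _ _) _.
by rewrite lerD2l.
Qed.

Lemma cabs_dist z w : `|cabs z - cabs w| <= cabs (z - w).
Proof.
have h1 := le_cabs_add (lexx (cabs (z - w))).
have := le_cabs_add (lexx (cabs (w - z))); rewrite (cabsBC w z) => h2.
by rewrite ler_norml; apply/andP; split; lra.
Qed.

Lemma cabs_triangle z w (v : R[i]) : cabs (z - w) <= cabs (z - v) + cabs (v - w).
Proof. by rewrite -{1}(subrK v z) -addrA le_cabsD. Qed.

Lemma le_cabs_sum n (F : 'I_n -> R[i]) :
  cabs (\sum_i F i) <= \sum_i cabs (F i).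
Proof.
elim/big_ind2: _ => [|z1 x1 z2 x2 h1 h2|//]; first by rewrite cabs0.
by apply: le_trans (le_cabsD _ _) _; rewrite lerD.
Qed.

Lemma cabsE z : cabs z ^+ 2 = complex.Re z ^+ 2 + complex.Im z ^+ 2.
Proof. by case: z => a b; rewrite sqr_sqrtr// addr_ge0// sqr_ge0. Qed.

Lemma cabs_real (x : R) : cabs x%:C = `|x|.
Proof. by rewrite /cabs /ComplexField.Normc.normc /= expr0n /= addr0 sqrtr_sqr. Qed.

Lemma cabs_nat n : cabs (n%:R : R[i]) = n%:R.
Proof. by rewrite -(rmorph_nat (real_complex R)) cabs_real ger0_norm. Qed.

Lemma cabsJ z : cabs (z^*%C) = cabs z.
Proof. by case: z => a b; rewrite /cabs /ComplexField.Normc.normc /= sqrrN. Qed.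

Lemma Re_le_cabs z : `|complex.Re z| <= cabs z.
Proof.
rewrite -(@ler_pXn2r _ 2)// ?nnegrE ?cabs_ge0// cabsE real_normK ?num_real//.
by rewrite lerDl sqr_ge0.
Qed.

Lemma Im_le_cabs z : `|complex.Im z| <= cabs z.
Proof.
rewrite -(@ler_pXn2r _ 2)// ?nnegrE ?cabs_ge0// cabsE real_normK ?num_real//.
by rewrite lerDr sqr_ge0.
Qed.

Lemma cabs_le_ReIm z : cabs z <= `|complex.Re z| + `|complex.Im z|.
Proof.
rewrite -(@ler_pXn2r _ 2)// ?nnegrE ?cabs_ge0 ?addr_ge0// cabsE.
rewrite sqrrD !real_normK ?num_real// -addrA lerD2l lerDr.
by rewrite mulrn_wge0// mulr_ge0.
Qed.

Lemma ReB z w : complex.Re (z - w) = complex.Re z - complex.Re w.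
Proof. by case: z; case: w. Qed.

Lemma ImB z w : complex.Im (z - w) = complex.Im z - complex.Im w.
Proof. by case: z; case: w. Qed.

Lemma complexRI z : z = (complex.Re z)%:C + 'i%C * (complex.Im z)%:C.
Proof. by case: z => a b; apply/eqP; rewrite eq_complex /= !(mul0r, mul1r, subr0, sub0r, add0r, addr0, mulr0, oppr0) !eqxx. Qed.

(** Radii of balls in [R[i]] are themselves elements of [R[i]]; positivity in that order forces the
    imaginary part to vanish, which supplies the real radius. *)
Lemma nbhs_cabsP z (A : set R[i]) :
  nbhs z A <-> exists2 e, 0 < e & forall w, cabs (w - z) < e -> A w.
Proof.
split.
  move=> /nbhs_ballP[[e y]]; rewrite /= => e0 h.
  have /andP[/eqP y0 e'0] : (y == 0) && (0 < e).
    by move: e0; rewrite ltcE /= eq_sym.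
  subst y; exists e => // w wz; apply: h.
  by rewrite -ball_normE /= distrC /= normc_def -/(cabs _) ltcR; case: (w - z) wz.
move=> [e e0 h]; apply/nbhs_ballP; exists e%:C; first by rewrite /= ltcR.
move=> w; rewrite -ball_normE /= => wz; apply: h.
by move: wz; rewrite distrC normc_def ltcR; case: (w - z).
Qed.

Lemma to_xyK : cancel (@to_xy R) of_xy.
Proof. by case. Qed.

Lemma nbhs_xyP (p : R * R) (A : set (R * R)) :
  nbhs p A <-> exists2 e, 0 < e & forall q, cabs (of_xy q - of_xy p) < e -> A q.
Proof.
split.
  move=> /nbhs_ballP[e e0 h]; exists e => // q qp; apply: h.
  split; rewrite -ball_normE /= distrC; apply: le_lt_trans qp.
    exact: Re_le_cabs (of_xy q - of_xy p).
  exact: Im_le_cabs (of_xy q - of_xy p).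
move=> [e e0 h]; apply/nbhs_ballP; exists (e / 2); first by rewrite /= divr_gt0.
move=> q []; rewrite -!ball_normE /= => h1 h2; apply: h.
apply: le_lt_trans (cabs_le_ReIm _) _ => /=.
by rewrite (splitr e) ltrD// distrC.
Qed.

Lemma continuous_of_xy : continuous (@of_xy R).
Proof.
move=> p A /nbhs_cabsP[e e0 h]; apply/nbhs_xyP; exists e => // q qp.
exact: h.
Qed.

Lemma cabs_lipschitz_continuous (phi : R[i] -> R) :
  (forall z w, `|phi z - phi w| <= cabs (z - w)) -> continuous phi.
Proof.
move=> hphi z A /nbhs_ballP[e e0 h]; apply/nbhs_cabsP; exists e => // w wz.
by apply: h; rewrite -ball_normE /= distrC; exact: le_lt_trans wz.
Qed.

Lemma cabsB_continuous (c : R[i]) : continuous (fun z => cabs (z - c)).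
Proof.
apply: cabs_lipschitz_continuous => z w.
have -> : z - w = (z - c) - (w - c) by ring.
exact: cabs_dist.
Qed.

Definition cdisk (c : R[i]) (r : R) : set R[i] := [set z | cabs (z - c) <= r].

Lemma cdisk_compact c r : compact (cdisk c r).
Proof.
have cB : compact (`[complex.Re c - r, complex.Re c + r] `*`
                   `[complex.Im c - r, complex.Im c + r]).
  by apply: compact_setX; exact: segment_compact.
have cI := continuous_compact (continuous_subspaceT continuous_of_xy) cB.
apply: subclosed_compact cI _.
- have -> : cdisk c r = (fun z => cabs (z - c)) @^-1` [set x | x <= r] by [].
  apply: closed_comp; last exact: closed_le.
  by move=> z _; exact: cabsB_continuous.
- move=> z zc; exists (to_xy z); last exact: to_xyK.
  have h1 := le_trans (Re_le_cabs _) zc; have h2 := le_trans (Im_le_cabs _) zc.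
  move: h1 h2; case: z {zc} => a b; case: c cB => a' b' _ /=.
  rewrite !ler_norml => /andP[h1 h2] /andP[h3 h4].
  by split; apply/andP; rewrite /= !bnd_simp; split; lra.
Qed.

(* A Lebesgue-number argument. *)
Lemma cdisk_uniform c r (P : R[i] -> R -> Prop) :
  (forall z0, cabs (z0 - c) <= r -> exists2 d, 0 < d &
     forall z e, cabs (z - z0) < d -> 0 < e -> e < d -> P z e) ->
  exists2 d, 0 < d & forall z e, cabs (z - c) <= r -> 0 < e -> e < d -> P z e.
Proof.
move=> h; have /compact_near_coveringP := @cdisk_compact c r.
move=> /(_ R (0 : R)^'+ (fun e z => P z e) _)[|d /= d0 hd].
  move=> z0 /h[d d0 hd].
  exists ([set z | cabs (z - z0) < d], [set e | 0 < e < d]) => /=.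
    split; first by apply/nbhs_cabsP; exists d.
    near=> e; apply/andP; split; near: e.
      exact: nbhs_right_gt.
    exact: nbhs_right_lt.
  by case=> z e /= [? /andP[]]; exact: hd.
exists d => // z e zc e0 ed; apply: (hd e) => //.
by rewrite /ball /= sub0r normrN gtr0_norm.
Unshelve. all: by end_near. Qed.

End cabs_theory.

(** * Strict differentiability *)

Section strict_diff.
Context {R : realType}.
Implicit Types (u : R * R -> R) (p q v : R * R) (f g : R[i] -> R[i]) (z w : R[i]).

Lemma is_derive_line u p v (t : R) : derivable u (p + t *: v) v ->
  is_derive t 1 (fun t => u (p + t *: v)) ('D_v u (p + t *: v)).
Proof.
set g := fun t => _.
have E : (fun h : R => h^-1 *: ((g \o shift t) (h *: 1) - g t)) =
         (fun h => h^-1 *: ((u \o shift (p + t *: v)) (h *: v) - u (p + t *: v))).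
  apply/funext => h; rewrite /g /=; congr (_ *: (u _ - _)).
  by rewrite scalerDl [h%:A]mulr1 addrCA.
by move=> du; apply: DeriveDef; rewrite ?/derivable ?/derive E.
Qed.

Lemma MVT_line u p v (s t : R) :
  (forall c, c \in `[Num.min s t, Num.max s t] -> derivable u (p + c *: v) v) ->
  exists2 c, c \in `[Num.min s t, Num.max s t] &
    u (p + t *: v) - u (p + s *: v) = 'D_v u (p + c *: v) * (t - s).
Proof.
wlog st : s t / s <= t.
  move=> h; have /orP[st|st] := le_total s t.
    exact: (h s t st).
  move=> du; have [|c cin hc] := h t s st.
    by rewrite minC maxC.
  exists c; first by rewrite minC maxC.
  by rewrite -opprB hc -mulrN opprB.
rewrite (min_idPl st) (max_idPr st) => du.
apply: (@MVT_segment _ (fun t => u (p + t *: v)) (fun t => 'D_v u (p + t *: v)) s t st).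
  move=> c cst; apply: is_derive_line; apply: du.
  exact: subset_itv_oo_cc.
apply: derivable_within_continuous => c cst.
by have [] := is_derive_line (du _ cst).
Qed.

(** Strict differentiability: both [q] and [q'] are free, so one radius [d] serves all base points
    near [p]. The l1 norm of the increment suits a mean value argument made one coordinate at a
    time. *)
Definition sdiffr u p (a b : R) := forall e, 0 < e -> exists2 d, 0 < d &
  forall q q', cabs (of_xy q - of_xy p) < d -> cabs (of_xy q' - of_xy p) < d ->
    `|u q' - u q - (a * (q'.1 - q.1) + b * (q'.2 - q.2))|
      <= e * (`|q'.1 - q.1| + `|q'.2 - q.2|).

(** The increment is split at the corner [(x, y')] into a horizontal and a vertical move. The mean
    value theorem treats each, and continuity of the partial derivatives replaces intermediate
    values by values at [p]. *)
Lemma C1_sdiffr u p :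
  (\forall q \near p, derivable u q ex /\ derivable u q ey) ->
  {for p, continuous ('D_ex u)} -> {for p, continuous ('D_ey u)} ->
  sdiffr u p ('D_ex u p) ('D_ey u p).
Proof.
move=> /nbhs_xyP[d0 d00 hd0] cx cy e e0.
have /nbhs_xyP[d1 d10 hd1] : \forall q \near p, `|'D_ex u p - 'D_ex u q| < e.
  by move/cvgrPdist_lt : cx; exact.
have /nbhs_xyP[d2 d20 hd2] : \forall q \near p, `|'D_ey u p - 'D_ey u q| < e.
  by move/cvgrPdist_lt : cy; exact.
pose d := Num.min d0 (Num.min d1 d2).
exists (d / 2) => [|[x y] [x' y'] qp q'p /=].
  by rewrite divr_gt0// !lt_min d00 d10 d20.
have near_p c s : `|c - p.1| < d / 2 -> `|s - p.2| < d / 2 ->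
    cabs (of_xy (c, s) - of_xy p) < d.
  move=> h1 h2; apply: le_lt_trans (cabs_le_ReIm _) _ => /=.
  by rewrite (splitr d) ltrD.
have hx : `|x - p.1| < d / 2 by exact: le_lt_trans (Re_le_cabs _) qp.
have hy : `|y - p.2| < d / 2 by exact: le_lt_trans (Im_le_cabs _) qp.
have hx' : `|x' - p.1| < d / 2 by exact: le_lt_trans (Re_le_cabs _) q'p.
have hy' : `|y' - p.2| < d / 2 by exact: le_lt_trans (Im_le_cabs _) q'p.
have btw (a b c m : R) : `|a - m| < d / 2 -> `|b - m| < d / 2 ->
    c \in `[Num.min a b, Num.max a b] -> `|c - m| < d / 2.
  rewrite in_itv /= !ltr_norml ge_min le_max.
  by move=> /andP[? ?] /andP[? ?] /andP[/orP[?|?] /orP[?|?]]; apply/andP; split; lra.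
have Ex s c : (s, c) = (0, c) + s *: ex :> R * R.
  by apply/eqP; rewrite xpair_eqE /= [s%:A]mulr1 scaler0 add0r addr0 !eqxx.
have Ey s c : (s, c) = (s, 0) + c *: ey :> R * R.
  by apply/eqP; rewrite xpair_eqE /= [c%:A]mulr1 scaler0 add0r addr0 !eqxx.
have [c1 c1in E1] : exists2 c, c \in `[Num.min x x', Num.max x x'] &
    u (x', y') - u (x, y') = 'D_ex u (c, y') * (x' - x).
  have [|c cin] := @MVT_line u (0, y') ex x x'.
    move=> c cin; rewrite -Ex; apply: (hd0 (c, y') _).1.
    apply: lt_le_trans (near_p c y' (btw _ _ _ _ hx hx' cin) hy') _.
    by rewrite ge_min lexx.
  by rewrite -!Ex; exists c.
have [c2 c2in E2] : exists2 c, c \in `[Num.min y y', Num.max y y'] &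
    u (x, y') - u (x, y) = 'D_ey u (x, c) * (y' - y).
  have [|c cin] := @MVT_line u (x, 0) ey y y'.
    move=> c cin; rewrite -Ey; apply: (hd0 (x, c) _).2.
    apply: lt_le_trans (near_p x c hx (btw _ _ _ _ hy hy' cin)) _.
    by rewrite ge_min lexx.
  by rewrite -!Ey; exists c.
have -> : u (x', y') - u (x, y) - ('D_ex u p * (x' - x) + 'D_ey u p * (y' - y))
   = ('D_ex u (c1, y') - 'D_ex u p) * (x' - x) +
     ('D_ey u (x, c2) - 'D_ey u p) * (y' - y).
  rewrite !mulrBl -E1 -E2; ring.
apply: le_trans (ler_normD _ _) _; rewrite !normrM mulrDr.
apply: lerD; apply: ler_wpM2r => //; rewrite distrC ltW//.
  apply: hd1; apply: lt_le_trans (near_p _ _ (btw _ _ _ _ hx hx' c1in) hy') _.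
  by rewrite !ge_min lexx !orbT.
apply: hd2; apply: lt_le_trans (near_p _ _ hx (btw _ _ _ _ hy hy' c2in)) _.
by rewrite !ge_min lexx !orbT.
Qed.

End strict_diff.

Section mixed_partials.
Context {R : realType}.
Implicit Types (u : R * R -> R) (p q v w : R * R).

(** Mean value theorem for the difference of [u] along two parallel segments. The left-hand side of
    the equation is symmetric in [v] and [w], which is what makes it useful for mixed
    derivatives. *)
Lemma second_difference u p v w (h : R) : 0 < h ->
  (forall c, c \in `[0, h] -> derivable u (p + c *: v) v) ->
  (forall c, c \in `[0, h] -> derivable u (p + h *: w + c *: v) v) ->
  exists2 c, c \in `[0, h] &
    u (p + h *: w + h *: v) - u (p + h *: v) - (u (p + h *: w) - u p) =
    ('D_v u (p + h *: w + c *: v) - 'D_v u (p + c *: v)) * h.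
Proof.
move=> h0 d1 d2.
pose g t := u (p + h *: w + t *: v) - u (p + t *: v).
have dg c : c \in `[0, h] -> is_derive c 1 g
    ('D_v u (p + h *: w + c *: v) - 'D_v u (p + c *: v)).
  by move=> c0h; apply: is_deriveB; apply: is_derive_line; [exact: d2|exact: d1].
have dg' c : c \in `]0, h[ -> is_derive c 1 g
    ('D_v u (p + h *: w + c *: v) - 'D_v u (p + c *: v)).
  by move=> /subset_itv_oo_cc; exact: dg.
have cg : {within `[0, h], continuous g}.
  by apply: derivable_within_continuous => c /dg[].
have [c cin E] := MVT_segment (ltW h0) dg' cg.
exists c => //; rewrite subr0 in E; rewrite -E /g !scale0r !addr0.
by [].
Qed.

(** The second difference over a small square at [p] can be evaluated through either first
    derivative. Strict differentiability of these compares it with [b * h ^+ 2] on one side and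
    [a' * h ^+ 2] on the other, up to [e * h ^+ 2]. *)
Lemma mixed_partialsC u p (a b a' b' : R) :
  (\forall q \near p, derivable u q ex /\ derivable u q ey) ->
  sdiffr ('D_ex u) p a b -> sdiffr ('D_ey u) p a' b' -> b = a'.
Proof.
move=> /nbhs_xyP[d0 d00 hd0] sx sy.
apply/eqP; rewrite -subr_eq0 -normr_le0; apply/ler_addgt0Pl => e e0.
rewrite addr0 (splitr e).
have e20 : 0 < e / 2 by rewrite divr_gt0.
have [d1 d10 hd1] := sx _ e20; have [d2 d20 hd2] := sy _ e20.
pose d := Num.min d0 (Num.min d1 d2).
have d_gt0 : 0 < d by rewrite !lt_min d00 d10 d20.
have [dd0 dd1 dd2] : [/\ d <= d0, d <= d1 & d <= d2].
  by rewrite /d !ge_min !lexx !orbT.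
pose h := d / 4; have h0 : 0 < h by rewrite divr_gt0.
have near_p c s : c \in `[0, h] -> s \in `[0, h] ->
    cabs (of_xy (p + (c, s)) - of_xy p) < d.
  move=> /itvP cin /itvP sin.
  have [c0 c1 s0 s1] : [/\ 0 <= c, c <= h, 0 <= s & s <= h] by rewrite !cin !sin.
  apply: le_lt_trans (cabs_le_ReIm _) _ => /=.
  have -> : p.1 + c - p.1 = c by ring.
  have -> : p.2 + s - p.2 = s by ring.
  by rewrite !ger0_norm//; move: h0 c1 s1; rewrite /h; lra.
have z0h : 0 \in `[0, h] by rewrite in_itv /= lexx ltW.
have hh : h \in `[0, h] by rewrite in_itv /= lexx ltW.
have Ex c : c *: ex = (c, 0) :> R * R.
  by apply/eqP; rewrite xpair_eqE /= [c%:A]mulr1 scaler0 !eqxx.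
have Ey c : c *: ey = (0, c) :> R * R.
  by apply/eqP; rewrite xpair_eqE /= [c%:A]mulr1 scaler0 !eqxx.
have Exy c s : p + (c, 0) + (0, s) = p + (c, s) :> R * R.
  by apply/eqP; rewrite xpair_eqE /= !addr0 !eqxx.
have Eyx c s : p + (0, s) + (c, 0) = p + (c, s) :> R * R.
  by apply/eqP; rewrite xpair_eqE /= !addr0 !eqxx.
have [||c c0h E1] := @second_difference u p ex ey h h0.
- by move=> c c0h; rewrite Ex; apply: (hd0 _ (lt_le_trans (near_p _ _ _ _) _)).1.
- move=> c c0h; rewrite Ex Ey Eyx.
  by apply: (hd0 _ (lt_le_trans (near_p _ _ _ _) _)).1.
have [||s s0h E2] := @second_difference u p ey ex h h0.
- by move=> c' c0h'; rewrite Ey; apply: (hd0 _ (lt_le_trans (near_p _ _ _ _) _)).2.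
- move=> c' c0h'; rewrite Ex Ey Exy.
  by apply: (hd0 _ (lt_le_trans (near_p _ _ _ _) _)).2.
move: E1 E2; rewrite !Ex !Ey !Exy !Eyx => E1 E2.
have := hd1 (p + (c, 0)) (p + (c, h)) (lt_le_trans (near_p _ _ c0h z0h) dd1)
  (lt_le_trans (near_p _ _ c0h hh) dd1).
have := hd2 (p + (0, s)) (p + (h, s)) (lt_le_trans (near_p _ _ z0h s0h) dd2)
  (lt_le_trans (near_p _ _ hh s0h) dd2).
rewrite /=.
have -> : p.1 + h - (p.1 + 0) = h by ring.
have -> : p.2 + h - (p.2 + 0) = h by ring.
have -> : p.1 + c - (p.1 + c) = 0 by ring.
have -> : p.2 + s - (p.2 + s) = 0 by ring.
rewrite !mulr0 add0r addr0 normr0 add0r addr0 !(gtr0_norm h0) => I2 I1.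
have E : ('D_ex u (p + (c, h)) - 'D_ex u (p + (c, 0))) =
         ('D_ey u (p + (h, s)) - 'D_ey u (p + (0, s))).
  by apply: (mulIf (lt0r_neq0 h0)); rewrite -E1 -E2; ring.
rewrite -(ler_pM2r h0) -{1}(gtr0_norm h0) -normrM [leRHS]mulrDl.
rewrite E in I1.
set X := 'D_ey u _ - 'D_ey u _ in I1 I2.
have -> : (b - a') * h = (X - a' * h) - (X - b * h) by ring.
by apply: le_trans (ler_normB _ _) _; rewrite lerD.
Qed.

End mixed_partials.

Section sdiff.
Context {R : realType}.
Implicit Types (u : R * R -> R) (f g : R[i] -> R[i]) (z w a b c : R[i]).

(* Strict real differentiability, with (a, b) the pair of values of
   (d/dz, d/dzbar) at z0; b = 0 is strict complex differentiability. *)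
Definition sdiff f z0 a b := forall e : R, 0 < e -> exists2 d : R, 0 < d &
  forall z w, cabs (z - z0) < d -> cabs (w - z0) < d ->
    cabs (f w - f z - (a * (w - z) + b * (w - z)^*%C)) <= e * cabs (w - z).

Lemma sdiffD f g z0 a b a' b' : sdiff f z0 a b -> sdiff g z0 a' b' ->
  sdiff (fun z => f z + g z) z0 (a + a') (b + b').
Proof.
move=> sf sg e e0.
have e20 : 0 < e / 2 by rewrite divr_gt0.
have [d1 d10 h1] := sf _ e20; have [d2 d20 h2] := sg _ e20.
exists (Num.min d1 d2) => [|z w]; first by rewrite lt_min d10.
rewrite !lt_min => /andP[z1 z2] /andP[w1 w2].
rewrite [leRHS](_ : _ = e / 2 * cabs (w - z) + e / 2 * cabs (w - z)); last by field.
  apply: le_trans _ (lerD (h1 _ _ z1 w1) (h2 _ _ z2 w2)).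
rewrite (_ : f w + g w - _ - _ = (f w - f z - (a * (w - z) + b * (w - z)^*%C)) +
  (g w - g z - (a' * (w - z) + b' * (w - z)^*%C))); first exact: le_cabsD.
by ring.
Qed.

Lemma sdiffZ f z0 a b c : sdiff f z0 a b ->
  sdiff (fun z => c * f z) z0 (c * a) (c * b).
Proof.
move=> sf e e0.
have e20 : 0 < e / (cabs c + 1).
  by rewrite divr_gt0// ltr_wpDl// cabs_ge0.
have [d d0 h] := sf _ e20; exists d => // z w zd wd.
rewrite (_ : c * f w - _ - _ = c * (f w - f z - (a * (w - z) + b * (w - z)^*%C)));
  last by ring.
rewrite cabsM; apply: le_trans (ler_wpM2l (cabs_ge0 _) (h _ _ zd wd)) _.
rewrite mulrA; apply: ler_wpM2r; first exact: cabs_ge0.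
rewrite mulrCA ler_piMr ?(ltW e0)// ler_pdivrMr ?ltr_wpDl ?cabs_ge0//.
by rewrite mul1r lerDl.
Qed.

Lemma sdiffJ f z0 a b : sdiff f z0 a b -> sdiff (fun z => (f z)^*%C) z0 b^*%C a^*%C.
Proof.
move=> sf e e0; have [d d0 h] := sf _ e0; exists d => // z w zd wd.
apply: le_trans _ (h _ _ zd wd); rewrite -cabsJ.
rewrite le_eqVlt; apply/orP; left; apply/eqP; congr cabs; rewrite !(rmorphB, rmorphD, rmorphM) /= !conjcK; ring.
Qed.

Lemma sdiff_continuous f z0 a b : sdiff f z0 a b -> forall e : R, 0 < e ->
  exists2 d : R, 0 < d & forall z, cabs (z - z0) < d -> cabs (f z - f z0) < e.
Proof.
move=> sf e e0; have [d d0 h] := sf _ ltr01.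
pose K := 1 + cabs a + cabs b.
have K0 : 0 < K by rewrite /K -addrA ltr_pwDl// addr_ge0// cabs_ge0.
exists (Num.min d (e / K)) => [|z]; first by rewrite lt_min d0 divr_gt0.
rewrite lt_min ltr_pdivlMr// => /andP[zd ze].
have zz : cabs (z0 - z0) < d by rewrite subrr cabs0.
have := h _ _ zz zd; rewrite mul1r => /le_cabs_add /le_lt_trans; apply.
apply: le_lt_trans ze; set x := cabs (z - z0).
rewrite (_ : _ * K = (cabs a * x + cabs b * x) + x); last by rewrite /K; ring.
by rewrite lerD2r; apply: le_trans (le_cabsD _ _) _; rewrite !cabsM cabsJ.
Qed.

(** The Wirtinger derivatives of a real function. Halving [e] pays for the passage from the l1 norm
    of the increment to its modulus. *)
Lemma sdiff_real u z0 (ux uy : R) : sdiffr u (to_xy z0) ux uy ->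
  sdiff (fun z => (u (to_xy z))%:C) z0 ((ux%:C - 'i%C * uy%:C) / 2)
                                      ((ux%:C + 'i%C * uy%:C) / 2).
Proof.
move=> su e e0; have e20 : 0 < e / 2 by rewrite divr_gt0.
have [d d0 h] := su _ e20; exists d => // z w zd wd.
have := h (to_xy z) (to_xy w); rewrite !to_xyK => /(_ zd wd) H.
set t := (ux%:C - _) / 2 * _ + _.
have -> : t = (ux * (complex.Re w - complex.Re z) +
               uy * (complex.Im w - complex.Im z))%:C.
  have -> : t = ux%:C * ((w - z) + (w - z)^*%C) / 2 -
                'i%C * uy%:C * ((w - z) - (w - z)^*%C) / 2 by rewrite /t; ring.
  case: z w {zd wd H t} => x y [x' y'].
  have -> : ((x' +i* y') - (x +i* y) + ((x' +i* y') - (x +i* y))^*%C : R[i])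
     = (x' - x)%:C * 2 by apply/eqP; rewrite eq_complex /=; apply/andP; split; apply/eqP; ring.
  have -> : ((x' +i* y') - (x +i* y) - ((x' +i* y') - (x +i* y))^*%C : R[i])
     = 'i%C * (y' - y)%:C * 2 by apply/eqP; rewrite eq_complex /=; apply/andP; split; apply/eqP; ring.
  rewrite -!mulrA divff ?pnatr_eq0// mulr1.
  rewrite [X in _ - X](_ : _ = 'i%C ^+ 2 * (uy * (y' - y))%:C); last first.
    by rewrite rmorphM /= expr2; ring.
  rewrite sqr_i mulN1r opprK [RHS](rmorphD (real_complex R)) /=.
  by rewrite !(rmorphM (real_complex R)).
rewrite -!(rmorphB (real_complex R)) cabs_real; apply: le_trans H _ => /=.
rewrite [leRHS](_ : _ = e / 2 * (cabs (w - z) + cabs (w - z))); last by field.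
apply: ler_wpM2l (ltW e20) _ _ _; apply: lerD.
  by have := Re_le_cabs (w - z); rewrite ReB.
by have := Im_le_cabs (w - z); rewrite ImB.
Qed.

End sdiff.

(** * Wirtinger derivatives of a harmonic mapping and their holomorphy *)

Section harmonic_sdiff.
Context {R : realType}.
Implicit Types (u : R * R -> R) (f : R[i] -> R[i]) (z w : R[i]).

Lemma disk_near z : disk 1 z -> \forall q \near to_xy z, (of_xy @^-1` (disk 1)) q.
Proof.
rewrite /disk /= => z1; apply/nbhs_xyP; exists (1 - cabs z); first by rewrite subr_gt0.
move=> q; rewrite to_xyK => qz; change (cabs (of_xy q) < 1).
by rewrite -(subrK z (of_xy q)); apply: le_lt_trans (le_cabsD _ _) _; rewrite -ltrBrDr.
Qed.

Lemma C2_sdiffr u z : C2_on (of_xy @^-1` (disk 1)) u -> disk 1 z ->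
  let p := to_xy z in
  [/\ sdiffr u p ('D_ex u p) ('D_ey u p),
      sdiffr ('D_ex u) p ('D_ex ('D_ex u) p) ('D_ey ('D_ex u) p),
      sdiffr ('D_ey u) p ('D_ex ('D_ey u) p) ('D_ey ('D_ey u) p) &
      'D_ey ('D_ex u) p = 'D_ex ('D_ey u) p].
Proof.
move=> cu z1 p.
have Up : (of_xy @^-1` (disk 1)) p by rewrite /= to_xyK.
have nU := disk_near z1.
have exin : (ex : R * R) \in [:: ex; ey] by rewrite !inE eqxx.
have eyin : (ey : R * R) \in [:: ex; ey] by rewrite !inE eqxx orbT.
have [_ hp] := cu _ Up.
have [_ cx hx] := hp _ exin; have [_ cy hy] := hp _ eyin.
have [_ cxx] := hx _ exin; have [_ cxy] := hx _ eyin.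
have [_ cyx] := hy _ exin; have [_ cyy] := hy _ eyin.
have n1 : \forall q \near p, derivable u q ex /\ derivable u q ey.
  near=> q; have Uq : (of_xy @^-1` (disk 1)) q by near: q.
  have [_ hq] := cu q Uq.
  by have [? _ _] := hq _ exin; have [? _ _] := hq _ eyin.
have nx : \forall q \near p, derivable ('D_ex u) q ex /\ derivable ('D_ex u) q ey.
  near=> q; have Uq : (of_xy @^-1` (disk 1)) q by near: q.
  have [_ hq] := cu q Uq.
  by have [_ _ h] := hq _ exin; have [? _] := h _ exin; have [? _] := h _ eyin.
have ny : \forall q \near p, derivable ('D_ey u) q ex /\ derivable ('D_ey u) q ey.
  near=> q; have Uq : (of_xy @^-1` (disk 1)) q by near: q.
  have [_ hq] := cu q Uq.
  by have [_ _ h] := hq _ eyin; have [? _] := h _ exin; have [? _] := h _ eyin.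
have s1 := C1_sdiffr n1 cx cy.
have sx := C1_sdiffr nx cxx cxy.
have sy := C1_sdiffr ny cyx cyy.
by split; [exact: s1|exact: sx|exact: sy|exact: (mixed_partialsC n1 sx sy)].
Unshelve. all: by end_near. Qed.

Lemma sdiff_eq f g z0 (a b a' b' : R[i]) : f =1 g -> a = a' -> b = b' ->
  sdiff f z0 a b -> sdiff g z0 a' b'.
Proof. by move=> /funext -> -> ->. Qed.

Lemma partialE v f z : partial v f z =
  ('D_v (re_part f) (to_xy z))%:C + 'i%C * ('D_v (im_part f) (to_xy z))%:C.
Proof. exact: complexRI. Qed.

Lemma harmonic_sdiff f z : harmonic_mapping (disk 1) f -> disk 1 z ->
  sdiff f z (dz f z) (dzbar f z).
Proof.
move=> [_ [cu _] [cv _]] z1.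
have [su _ _ _] := C2_sdiffr cu z1; have [sv _ _ _] := C2_sdiffr cv z1.
apply: sdiff_eq (sdiffD (sdiff_real su) (sdiffZ 'i%C (sdiff_real sv))).
- by move=> w; rewrite /re_part /im_part to_xyK -complexRI.
- rewrite /dz !partialE.
  move: ('D_ex (re_part f) (to_xy z))%:C ('D_ey (re_part f) (to_xy z))%:C.
  move: ('D_ex (im_part f) (to_xy z))%:C ('D_ey (im_part f) (to_xy z))%:C => a b c d.
  by ring.
- rewrite /dzbar !partialE.
  move: ('D_ex (re_part f) (to_xy z))%:C ('D_ey (re_part f) (to_xy z))%:C.
  move: ('D_ex (im_part f) (to_xy z))%:C ('D_ey (im_part f) (to_xy z))%:C => a b c d.
  by ring.
Qed.

(** Symmetry of mixed derivatives and the Laplace equation: the pairs [(a, b)] and [(b, - a)] are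
    the Cauchy-Riemann equations for u_x - i u_y. *)
Lemma real_harmonic_sdiffr u z :
  real_harmonic_on (of_xy @^-1` (disk 1)) u -> disk 1 z ->
  exists a b : R, sdiffr ('D_ex u) (to_xy z) a b /\
                  sdiffr ('D_ey u) (to_xy z) b (- a).
Proof.
move=> [cu hu] z1; have [_ sx sy E] := C2_sdiffr cu z1.
exists ('D_ex ('D_ex u) (to_xy z)), ('D_ey ('D_ex u) (to_xy z)).
split; first exact: sx.
have Up : (of_xy @^-1` (disk 1)) (to_xy z) by rewrite /= to_xyK.
have /eqP := hu _ Up; rewrite addrC addr_eq0 => /eqP <-.
by rewrite E.
Qed.

(** For f = h + conj g this function is h'. Its antiholomorphic derivative is a quarter of the
    Laplacian of f. *)
Lemma dz_sdiff f z : harmonic_mapping (disk 1) f -> disk 1 z ->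
  exists a, sdiff (dz f) z a 0.
Proof.
move=> [_ hu hv] z1; have ii := sqr_i R.
have [A [B [sux suy]]] := real_harmonic_sdiffr hu z1.
have [A' [B' [svx svy]]] := real_harmonic_sdiffr hv z1.
have s := sdiffZ (1 / 2) (sdiffD (sdiffD (sdiff_real sux) (sdiffZ 'i%C (sdiff_real svx)))
  (sdiffZ (- 'i%C) (sdiffD (sdiff_real suy) (sdiffZ 'i%C (sdiff_real svy))))).
eexists; apply: (sdiff_eq _ erefl _ s).
  move=> w; rewrite /dz !partialE; clear s sux suy svx svy.
  by ring.
clear s sux suy svx svy hu hv; rewrite !(rmorphN (real_complex R)) /=.
move: A%:C B%:C A'%:C B'%:C => {}A {}B {}A' {}B'.
(* The relations between second derivatives leave a multiple of 1 + i^2. *)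
transitivity ((1 + 'i%C ^+ 2) * (A + 'i%C * A') / 4); last first.
  by rewrite ii subrr !mul0r.
by field.
Qed.

(** For f = h + conj g this function is g'; the conjugation turns the antiholomorphic f_zbar into a
    holomorphic function. *)
Lemma conj_dzbar_sdiff f z : harmonic_mapping (disk 1) f -> disk 1 z ->
  exists a, sdiff (fun z => (dzbar f z)^*%C) z a 0.
Proof.
move=> [_ hu hv] z1; have ii := sqr_i R.
have [A [B [sux suy]]] := real_harmonic_sdiffr hu z1.
have [A' [B' [svx svy]]] := real_harmonic_sdiffr hv z1.
have s := sdiffJ (sdiffZ (1 / 2) (sdiffD (sdiffD (sdiff_real sux) (sdiffZ 'i%C (sdiff_real svx)))
  (sdiffZ 'i%C (sdiffD (sdiff_real suy) (sdiffZ 'i%C (sdiff_real svy)))))).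
eexists; apply: (sdiff_eq _ erefl _ s).
  move=> w; congr (_ ^*%C); rewrite /dzbar !partialE; clear s sux suy svx svy.
  by ring.
apply/eqP; rewrite conjc_eq0; apply/eqP.
clear s sux suy svx svy hu hv; rewrite !(rmorphN (real_complex R)) /=.
move: A%:C B%:C A'%:C B'%:C => {}A {}B {}A' {}B'.
transitivity ((1 + 'i%C ^+ 2) * (A + 'i%C * A') / 4); last first.
  by rewrite ii subrr !mul0r.
by field.
Qed.

End harmonic_sdiff.

(** * Mean values and the maximum principle *)

Section cis.
Context {R : realType}.
Implicit Types (x y : R).

Lemma sin_le x : 0 <= x -> sin x <= x.
Proof.
move=> x0; have [|c _] := @MVT_segment R sin cos 0 x x0.
  by apply: continuous_subspaceT; exact: continuous_sin.
by rewrite sin0 !subr0 => ->; rewrite ler_piMl// cos_le1.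
Qed.

Lemma norm_sin_le x : `|sin x| <= `|x|.
Proof.
wlog x0 : x / 0 <= x.
  move=> h; have [|/ltW x0] := leP 0 x; first exact: h.
  by rewrite -normrN -sinN -[leRHS]normrN; apply: h; rewrite oppr_ge0.
rewrite (ger0_norm x0); have [x2|x2] := leP x 2.
  rewrite ger0_norm ?sin_le// sin_ge0_pi// x0/=.
  exact: le_trans x2 (pi_ge2 R).
by apply: le_trans (sin_max x) _; lra.
Qed.

Lemma cos_ge x : 1 - x ^+ 2 / 2 <= cos x.
Proof.
have -> : cos x = 1 - 2 * sin (x / 2) ^+ 2.
  rewrite {1}(_ : x = (x / 2) *+ 2); last by rewrite mulr2n -splitr.
  by rewrite cos_mulr2n cos2sin2; ring.
have := norm_sin_le (x / 2); rewrite -(@ler_pXn2r _ 2)// ?nnegrE//.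
rewrite !real_normK ?num_real// => h; lra.
Qed.

Lemma sin_ge x : 0 <= x <= 1 -> x / 2 <= sin x.
Proof.
move=> /andP[x0 x1]; have [|c cin] := @MVT_segment R sin cos 0 x x0.
  by apply: continuous_subspaceT; exact: continuous_sin.
rewrite sin0 !subr0 => ->; rewrite mulrC ler_wpM2r//.
apply: le_trans _ (cos_ge c).
move: cin; rewrite in_itv /= => /andP[c0 cx].
have : c ^+ 2 <= 1 by rewrite exprn_ile1// (le_trans cx).
lra.
Qed.

Definition cis x : R[i] := cos x +i* sin x.

Lemma cis0 : cis 0 = 1.
Proof. by rewrite /cis cos0 sin0. Qed.

Lemma cisD x y : cis (x + y) = cis x * cis y.
Proof.
by rewrite /cis cosD sinD; apply/eqP; rewrite eq_complex /= eqxx /= addrC.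
Qed.

Lemma cis_pi2 : cis (pi *+ 2) = 1.
Proof. by rewrite /cis cos2pi sin2pi. Qed.

Lemma cisMn x n : cis (x *+ n) = cis x ^+ n.
Proof. by elim: n => [|n IH]; rewrite ?mulr0n ?cis0 ?expr0// mulrS exprS cisD IH. Qed.

Lemma cabs_cis x : cabs (cis x) = 1.
Proof. by rewrite /cabs /ComplexField.Normc.normc /= cos2Dsin2 sqrtr1. Qed.

Lemma cis_chord x y : cabs (cis x - cis y) = 2 * `|sin ((x - y) / 2)|.
Proof.
have -> : cis x - cis y = cis y * (cis (x - y) - 1).
  by rewrite mulrBr -cisD mulr1; congr (cis _ - _); ring.
rewrite cabsM cabs_cis mul1r; set t := x - y.
apply/eqP; rewrite -(@eqrXn2 _ 2)// ?cabs_ge0 ?mulr_ge0//; apply/eqP.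
rewrite cabsE ReB ImB /= exprMn real_normK ?num_real//.
have E : cos t = 1 - 2 * sin (t / 2) ^+ 2.
  rewrite {1}(_ : t = (t / 2) *+ 2); last by rewrite mulr2n -splitr.
  by rewrite cos_mulr2n cos2sin2; ring.
rewrite subr0 sin2cos2 E; ring.
Qed.

Lemma cis_lip x y : cabs (cis x - cis y) <= `|x - y|.
Proof.
rewrite cis_chord; apply: le_trans (ler_wpM2l _ (norm_sin_le _)) _ => //.
by rewrite normrM normfV (ger0_norm (ler0n _ 2)) mulrCA divff ?mulr1// pnatr_eq0.
Qed.

Lemma near_root_of_unity (d : R) : 0 < d -> exists n (zeta : R[i]),
  [/\ (0 < n)%N, zeta ^+ n = 1, zeta != 1, cabs zeta = 1 & cabs (zeta - 1) < d].
Proof.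
move=> d0.
have pi2 : 0 < (pi : R) *+ 2 by rewrite mulrn_wgt0// pi_gt0.
(* One successor makes 2 pi / n smaller than [d]; the other guarantees n >= 2, hence a root
   different from 1. *)
pose n := (Num.truncn (pi *+ 2 / d)).+2.
have n0 : 0 < n%:R :> R by rewrite ltr0n.
exists n, (cis (pi *+ 2 / n%:R)); split => //.
- by rewrite -cisMn -[_ *+ n]mulr_natr mulfVK ?cis_pi2// gt_eqF.
- rewrite -subr_eq0 -cabs_eq0 -cis0 cis_chord subr0 mulf_eq0 pnatr_eq0 /=.
  rewrite normr_eq0 gt_eqF// sin_gt0_pi//.
  rewrite -[pi *+ 2]mulr_natr -!mulrA [2 * _]mulrCA divff ?mulr1 ?pnatr_eq0//.
  by rewrite divr_gt0 ?pi_gt0//= ltr_pdivrMr// ltr_pMr ?pi_gt0// ltr1n.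
- exact: cabs_cis.
- rewrite -cis0; apply: le_lt_trans (cis_lip _ _) _.
  rewrite subr0 gtr0_norm ?divr_gt0// ltr_pdivrMr// mulrC -ltr_pdivrMr//.
  apply: lt_trans (truncnS_gt _) _; by rewrite ltr_nat.
Qed.

End cis.

Section approx_mean.
Context {R : realType}.
Implicit Types (H : R[i] -> R[i]) (z w zeta : R[i]).

Lemma sum_unity_root n zeta : zeta ^+ n = 1 -> zeta != 1 ->
  \sum_(j < n) zeta ^+ j = 0.
Proof.
move=> zn z1; apply: (mulfI (_ : zeta - 1 != 0)); first by rewrite subr_eq0.
by rewrite mulr0 -subrX1 zn subrr.
Qed.

Definition holomorphic_at H z := exists a, sdiff H z a 0.

(* Discrete mean value property: moving the radius of the n-gon changes the sum
   by the sum of H' zeta^j, which a telescoping sum around the n-gon kills. *)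
Lemma approx_mean H z0 (t e : R) : 0 < t -> 0 < e ->
  (forall z, cabs (z - z0) <= t -> holomorphic_at H z) ->
  exists2 d : R, 0 < d & forall n zeta, zeta ^+ n = 1 -> zeta != 1 ->
    cabs zeta = 1 -> cabs (zeta - 1) < d ->
    cabs (\sum_(j < n) H (z0 + t%:C * zeta ^+ j) - n%:R * H z0) <= n%:R * e.
Proof.
move=> t0 e0 hH.
pose e' := e / (2 * t); have e'0 : 0 < e' by rewrite divr_gt0// mulr_gt0.
have [|r' r'0 hr] := @cdisk_uniform R z0 t (fun z r => exists a, forall w,
    cabs (w - z) < r -> cabs (H w - H z - a * (w - z)) <= e' * cabs (w - z)).
  move=> z1 /hH[a /(_ _ e'0)[d d0 hd]]; exists (d / 2); first by rewrite divr_gt0.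
  move=> z r zz1 r0 rd; exists a => w wz.
  have := hd z w; rewrite mul0r addr0; apply.
    by apply: lt_trans zz1 _; lra.
  by rewrite (splitr d); apply: le_lt_trans (cabs_triangle _ _ z) _; rewrite ltrD// (lt_trans wz).
pose r := r' / 2; have r0 : 0 < r by rewrite divr_gt0.
have [A hA] : exists A, forall z, cabs (z - z0) <= t -> forall w,
    cabs (w - z) < r -> cabs (H w - H z - A z * (w - z)) <= e' * cabs (w - z).
  have /choice[A hA] : forall z, exists a, cabs (z - z0) <= t -> forall w,
    cabs (w - z) < r -> cabs (H w - H z - a * (w - z)) <= e' * cabs (w - z).
    move=> z; have [zt|zt] := leP (cabs (z - z0)) t; last by exists 0.
    have rr' : r < r' by rewrite /r ltr_pdivrMr// ltr_pMr// ltr1n.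
    by have [a ha] := hr z r zt r0 rr'; exists a.
  by exists A.
(* With this bound on |zeta - 1|, every side of a polygon of radius at most [t] is shorter than [r],
   so consecutive vertices can be compared by the linear estimate [hA]. *)
exists (r / (t + 1)) => [|n zeta zn z1 az zd]; first by rewrite divr_gt0// addr_gt0.
have azn j : cabs (zeta ^+ j) = 1 by rewrite cabsX az expr1n.
pose S (s : R) := \sum_(j < n) H (z0 + s%:C * zeta ^+ j).
pose Z (s : R) j := z0 + s%:C * zeta ^+ j.
have ZE s j : 0 <= s -> cabs (Z s j - z0) = s.
  by move=> s0; rewrite /Z addrC addKr cabsM azn mulr1 cabs_real ger0_norm.
(* Around the closed polygon the increments of [H] sum to 0, and each is [A (Z s j) * zeta ^+ j]
   times the common factor s (zeta - 1), up to [e'] times the length of a side. Dividing by that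
   factor gives the bound; at s = 0 the roots of unity sum to 0. *)
have sumA s : 0 <= s <= t -> cabs (\sum_(j < n) A (Z s j) * zeta ^+ j) <= n%:R * e'.
  move=> /andP[]; rewrite le_eqVlt => /predU1P[<-|s0] st.
    under eq_bigr do rewrite /Z mul0r addr0.
    by rewrite -mulr_sumr sum_unity_root// mulr0 cabs0 mulr_ge0// ltW.
  have T : \sum_(j < n) (H (Z s j.+1) - H (Z s j)) = 0.
    rewrite -(big_mkord xpredT (fun j => H (Z s j.+1) - H (Z s j))).
    by rewrite telescope_sumr// /Z zn expr0 subrr.
  have dz j : Z s j.+1 - Z s j = s%:C * (zeta - 1) * zeta ^+ j.
    by rewrite /Z exprS; ring.
  have c0 : 0 < cabs (s%:C * (zeta - 1)).
    by rewrite cabs_gt0 mulf_neq0 ?subr_eq0// -cabs_eq0 cabs_real normr_eq0 gt_eqF.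
  rewrite -(ler_pM2l c0) -cabsM.
  have -> : s%:C * (zeta - 1) * (\sum_(j < n) A (Z s j) * zeta ^+ j) =
      - \sum_(j < n) (H (Z s j.+1) - H (Z s j) - A (Z s j) * (Z s j.+1 - Z s j)).
    rewrite sumrB T sub0r opprK mulr_sumr; apply: eq_bigr => j _.
    by rewrite dz; ring.
  rewrite cabsN; apply: le_trans (le_cabs_sum _) _.
  rewrite mulrCA mulr_natl -[n in leRHS]card_ord -sumr_const; apply: ler_sum => j _.
  have dE : cabs (Z s j.+1 - Z s j) = cabs (s%:C * (zeta - 1)).
    by rewrite dz cabsM azn mulr1.
  rewrite [leRHS]mulrC -dE; apply: hA; first by rewrite ZE// ltW.
  rewrite dE cabsM cabs_real gtr0_norm//; apply: le_lt_trans (_ : t * cabs (zeta - 1) < r).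
    by rewrite ler_wpM2r// cabs_ge0.
  move: zd; rewrite ltr_pdivlMr ?addr_gt0// mulrC; apply: le_lt_trans.
  by rewrite ler_wpM2r ?cabs_ge0// lerDl.
have step s s' : 0 <= s <= t -> 0 <= s' <= t -> `|s' - s| < r ->
    cabs (S s' - S s) <= 2 * (n%:R * e') * `|s' - s|.
  move=> st st' ss; have /andP[s0 s_t] := st.
  have dz j : Z s' j - Z s j = (s' - s)%:C * zeta ^+ j.
    by rewrite /Z (rmorphB (real_complex R)); ring.
  have dE j : cabs (Z s' j - Z s j) = `|s' - s|.
    by rewrite dz cabsM azn mulr1 cabs_real.
  have -> : S s' - S s =
     \sum_(j < n) (H (Z s' j) - H (Z s j) - A (Z s j) * (Z s' j - Z s j)) +
     (s' - s)%:C * \sum_(j < n) A (Z s j) * zeta ^+ j.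
    rewrite /S -sumrB mulr_sumr -big_split /=; apply: eq_bigr => j _.
    by rewrite dz /Z; ring.
  apply: le_trans (le_cabsD _ _) _.
  rewrite [leRHS](_ : _ = n%:R * e' * `|s' - s| + n%:R * e' * `|s' - s|); last by ring.
  apply: lerD; last first.
    by rewrite cabsM cabs_real mulrC ler_wpM2r// sumA.
  apply: le_trans (le_cabs_sum _) _.
  rewrite -mulrA mulr_natl -[n in leRHS]card_ord -sumr_const; apply: ler_sum => j _.
  by rewrite -(dE j); apply: hA; rewrite ?ZE// dE.
(* The radius grows from 0 to [t] in [m] steps shorter than [r]. The errors add up to 2 n e' t,
   which is n e by the choice of [e']. *)
pose m := (Num.truncn (t / r)).+1.
have m0 : 0 < m%:R :> R by rewrite ltr0n.
have tm : t / m%:R < r.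
  by rewrite ltr_pdivrMr// mulrC -ltr_pdivrMr// truncnS_gt.
have chain k : (k <= m)%N ->
    cabs (S (t * k%:R / m%:R) - S 0) <= 2 * (n%:R * e') * (t * k%:R / m%:R).
  elim: k => [|k IH] km; first by rewrite mulr0 mul0r subrr cabs0 mulr0.
  apply: le_trans (cabs_triangle _ _ (S (t * k%:R / m%:R))) _.
  have dk : t * k.+1%:R / m%:R - t * k%:R / m%:R = t / m%:R.
    by rewrite -natr1; field; rewrite gt_eqF.
  have tk i : (i <= m)%N -> 0 <= t * i%:R / m%:R <= t.
    move=> im; apply/andP; split.
      by apply: divr_ge0; rewrite ?ler0n// mulr_ge0 ?ler0n// ltW.
    by rewrite ler_pdivrMr// ler_pM2l// ler_nat.
  have dkr : `|t * k.+1%:R / m%:R - t * k%:R / m%:R| = t / m%:R.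
    by rewrite dk gtr0_norm// divr_gt0.
  have := step _ _ (tk _ (ltnW km)) (tk _ km); rewrite dkr => /(_ tm).
  move/lerD => /(_ _ _ (IH (ltnW km))) /le_trans; apply.
  by rewrite -dk -mulrDr subrK.
have := chain m (leqnn m); rewrite mulfK ?gt_eqF//.
have -> : S 0 = n%:R * H z0.
  rewrite /S; under eq_bigr do rewrite mul0r addr0.
  by rewrite sumr_const card_ord mulr_natl.
move/le_trans; apply.
have -> : 2 * (n%:R * e') * t = n%:R * e * (2 * t / (2 * t)) by rewrite /e'; ring.
by rewrite divff ?mulr1// gt_eqF// mulr_gt0.
Qed.

End approx_mean.

Section holomorphic.
Context {R : realType}.
Implicit Types (f g H : R[i] -> R[i]) (z w a b c : R[i]).

Lemma sdiff_cst c z : sdiff (fun=> c) z 0 0.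
Proof.
move=> e e0; exists 1 => // w v _ _.
by rewrite subrr !mul0r addr0 subr0 cabs0 mulr_ge0 ?cabs_ge0 ?ltW.
Qed.

Lemma sdiff_id z : sdiff id z 1 0.
Proof.
move=> e e0; exists 1 => // w v _ _.
by rewrite mul1r mul0r addr0 subrr cabs0 mulr_ge0 ?cabs_ge0 ?ltW.
Qed.

Lemma sdiffM f g z0 a b : sdiff f z0 a 0 -> sdiff g z0 b 0 ->
  sdiff (fun z => f z * g z) z0 (a * g z0 + f z0 * b) 0.
Proof.
move=> sf sg e e0.
pose K := (cabs (g z0) + 1) + cabs a + (cabs (f z0) + 1) + cabs b.
have K0 : 0 < K.
  have := cabs_ge0 (g z0); have := cabs_ge0 a; have := cabs_ge0 (f z0).
  by have := cabs_ge0 b; rewrite /K; lra.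
pose e' := Num.min 1 (e / K).
have e'0 : 0 < e' by rewrite lt_min ltr01 divr_gt0.
have [e'1 e'e] : e' <= 1 /\ e' <= e / K by rewrite !ge_min !lexx orbT.
have [d1 d10 h1] := sf _ e'0; have [d2 d20 h2] := sg _ e'0.
have [d3 d30 h3] := sdiff_continuous sf e'0.
have [d4 d40 h4] := sdiff_continuous sg e'0.
exists (Num.min (Num.min d1 d2) (Num.min d3 d4)) => [|z w].
  by rewrite !lt_min d10 d20 d30 d40.
rewrite !lt_min => /andP[/andP[z1 z2] /andP[z3 z4]] /andP[/andP[w1 w2] /andP[w3 w4]].
have {h1} := h1 _ _ z1 w1; have {h2} := h2 _ _ z2 w2; rewrite !mul0r !addr0.
have {}h3 := ltW (h3 _ z3); have h4' := ltW (h4 _ w4); have {h4} gw := le_cabs_add h4'.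
have fz := le_cabs_add h3; set h := w - z => hg hf.
have -> : f w * g w - f z * g z - (a * g z0 + f z0 * b) * h =
  (f w - f z - a * h) * g w + a * h * (g w - g z0) +
  f z * (g w - g z - b * h) + (f z - f z0) * b * h by ring.
have x0 := cabs_ge0 h.
apply: le_trans (_ : e' * cabs h * (cabs (g z0) + 1) + cabs a * cabs h * e' +
   (cabs (f z0) + 1) * (e' * cabs h) + e' * cabs b * cabs h <= _).
  have add4 (p q r s : R[i]) (P Q U V : R) : cabs p <= P -> cabs q <= Q ->
      cabs r <= U -> cabs s <= V -> cabs (p + q + r + s) <= P + Q + U + V.
    move=> *; apply: le_trans (le_cabsD _ _) _; apply: lerD => //.
    apply: le_trans (le_cabsD _ _) _; apply: lerD => //.
    by apply: le_trans (le_cabsD _ _) _; apply: lerD.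
  apply: add4; rewrite !cabsM.
  - by apply: ler_pM; rewrite ?cabs_ge0//; lra.
  - by apply: ler_wpM2l => //; rewrite mulr_ge0// cabs_ge0.
  - by apply: ler_pM; rewrite ?cabs_ge0//; lra.
  - by apply: ler_wpM2r => //; apply: ler_wpM2r => //; exact: cabs_ge0.
rewrite [leLHS](_ : _ = e' * K * cabs h); last by rewrite /K; ring.
by apply: ler_wpM2r => //; rewrite -ler_pdivlMr.
Qed.

Lemma sdiffV f z0 a : sdiff f z0 a 0 -> f z0 != 0 ->
  sdiff (fun z => (f z)^-1) z0 (- a / f z0 ^+ 2) 0.
Proof.
move=> sf fz0 e e0; set c := f z0 in fz0 *.
have c0 : 0 < cabs c by rewrite cabs_gt0.
pose m := cabs c / 2; have m0 : 0 < m by rewrite divr_gt0.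
pose K := m ^- 2 + cabs a * (3 * cabs c) / m ^+ 4.
have K0 : 0 < K.
  rewrite ltr_pwDl ?invr_gt0 ?exprn_gt0// divr_ge0 ?exprn_ge0 ?(ltW m0)//.
  by rewrite mulr_ge0 ?cabs_ge0// mulr_ge0 ?(ltW c0).
pose e' := Num.min m (e / K).
have e'0 : 0 < e' by rewrite lt_min m0 divr_gt0.
have [e'1 e'e] : e' <= m /\ e' <= e / K by rewrite !ge_min !lexx orbT.
have [d1 d10 h1] := sf _ e'0.
have [d3 d30 h3] := sdiff_continuous sf e'0.
exists (Num.min d1 d3) => [|z w]; first by rewrite !lt_min d10 d30.
rewrite !lt_min => /andP[z1 z3] /andP[w1 w3].
have {h1} := h1 _ _ z1 w1; rewrite !mul0r !addr0; set h := w - z.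
have := ltW (h3 _ z3); have := ltW (h3 _ w3).
move: (f z) (f w) => v u; rewrite -/c => uc vc hf.
have lb x : cabs (x - c) <= e' -> m <= cabs x /\ cabs x <= 2 * cabs c.
  rewrite cabsBC => /[dup] /le_cabs_add h1; rewrite cabsBC => /le_cabs_add h2.
  by move: e'1 h1 h2; rewrite /m => *; split; lra.
have [um u2] := lb _ uc; have [vm v2] := lb _ vc.
have u0 : u != 0 by rewrite -cabs_gt0; lra.
have v0 : v != 0 by rewrite -cabs_gt0; lra.
have -> : u^-1 - v^-1 - - a / c ^+ 2 * h =
  - (u - v - a * h) / (u * v) - a * h * ((c * (c - v) + v * (c - u)) / (u * v * c ^+ 2)).
  by field; rewrite u0 v0 fz0.
have x0 := cabs_ge0 h.
apply: le_trans (_ : e' * cabs h / m ^+ 2 +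
   cabs a * cabs h * ((cabs c * e' + 2 * cabs c * e') / (m ^+ 4)) <= _).
  apply: le_trans (le_cabsB _ _) _; apply: lerD; rewrite cabsM.
    rewrite cabsN; apply: ler_pM; rewrite ?cabs_ge0//.
    rewrite cabsV cabsM lef_pV2 ?posrE ?mulr_gt0 ?exprn_gt0 ?cabs_gt0//.
    by rewrite expr2 ler_pM// ltW.
  rewrite cabsM; apply: ler_wpM2l; first by rewrite mulr_ge0 ?cabs_ge0.
  rewrite cabsM cabsV; apply: ler_pM; rewrite ?invr_ge0 ?cabs_ge0//.
    apply: le_trans (le_cabsD _ _) _; rewrite !cabsM; apply: lerD.
      by apply: ler_wpM2l; [exact: cabs_ge0|rewrite cabsBC].
    by apply: ler_pM; rewrite ?cabs_ge0// cabsBC.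
  rewrite [cabs (u * v * _)]cabsM [cabs (u * v)]cabsM cabsX lef_pV2 ?posrE ?mulr_gt0 ?exprn_gt0 ?cabs_gt0//.
  rewrite (_ : m ^+ 4 = m * m * m ^+ 2); last by ring.
  have uv : m * m <= cabs u * cabs v by apply: ler_pM => //; exact: ltW.
  have mc : m ^+ 2 <= cabs c ^+ 2.
    by apply: lerXn2r; rewrite ?nnegrE ?(ltW m0) ?(ltW c0)// /m; lra.
  by apply: ler_pM => //; [apply: mulr_ge0|apply: exprn_ge0]; exact: ltW.
rewrite [leLHS](_ : _ = e' * K * cabs h); last first.
  by rewrite /K; field; rewrite gt_eqF.
by apply: ler_wpM2r => //; rewrite -ler_pdivlMr.
Qed.

Lemma holomorphic_cst c z : holomorphic_at (fun=> c) z.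
Proof. by exists 0; exact: sdiff_cst. Qed.

Lemma holomorphicM f g z : holomorphic_at f z -> holomorphic_at g z ->
  holomorphic_at (fun z => f z * g z) z.
Proof. by move=> [a sf] [b sg]; eexists; exact: sdiffM sf sg. Qed.

Lemma holomorphicV f z : holomorphic_at f z -> f z != 0 ->
  holomorphic_at (fun z => (f z)^-1) z.
Proof. by move=> [a sf] fz; eexists; exact: sdiffV sf fz. Qed.

Lemma holomorphicX f z n : holomorphic_at f z -> holomorphic_at (fun z => f z ^+ n) z.
Proof.
move=> hf; elim: n => [|n IH]; first exact: holomorphic_cst.
have -> : (fun z => f z ^+ n.+1) = (fun z => f z * f z ^+ n).
  by apply/funext => w; rewrite exprS.
exact: holomorphicM.
Qed.

Lemma ReD z w : complex.Re (z + w) = complex.Re z + complex.Re w.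
Proof. by case: z; case: w. Qed.

Lemma ImD z w : complex.Im (z + w) = complex.Im z + complex.Im w.
Proof. by case: z; case: w. Qed.

(** The cross terms are linear in [zeta ^+ j] and sum to 0. This is the exact gain t^2 of the
    strictly subharmonic function |z|^2 over a polygon. *)
Lemma sum_cabs_sqr n zeta z (t : R) : zeta ^+ n = 1 -> zeta != 1 -> cabs zeta = 1 ->
  \sum_(j < n) cabs (z + t%:C * zeta ^+ j) ^+ 2 = n%:R * (cabs z ^+ 2 + t ^+ 2).
Proof.
move=> zn z1 az; have S0 := sum_unity_root zn z1.
have SR : \sum_(j < n) complex.Re (zeta ^+ j) = 0.
  by rewrite -(big_morph _ ReD (erefl : complex.Re (0 : R[i]) = 0)) S0.
have SI : \sum_(j < n) complex.Im (zeta ^+ j) = 0.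
  by rewrite -(big_morph _ ImD (erefl : complex.Im (0 : R[i]) = 0)) S0.
transitivity (\sum_(j < n) ((cabs z ^+ 2 + t ^+ 2) + (2 * t * complex.Re z * complex.Re (zeta ^+ j) +
    2 * t * complex.Im z * complex.Im (zeta ^+ j)))).
  apply: eq_bigr => j _; rewrite !cabsE.
  have := cabsE (zeta ^+ j); rewrite cabsX az !expr1n.
  case: (zeta ^+ j) z => a b [x y] /= E.
  by have -> : t ^+ 2 = t ^+ 2 * (a ^+ 2 + b ^+ 2); [rewrite -E mulr1|ring].
rewrite big_split /= [X in _ + X]big_split /= -!mulr_sumr SR SI !mulr0 !addr0.
by rewrite sumr_const card_ord mulr_natl.
Qed.

(** If the bound failed at [z1], then |H| + e |z|^2 with small [e] would have an interior maximum.
    The polygon average there gains e t^2 from the second term and loses at most half of that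
    through the approximate mean value property of [H]. *)
Lemma annulus_max H (B rho r : R) : 0 < rho -> rho < r ->
  (forall z, rho <= cabs z <= r -> holomorphic_at H z) ->
  (forall z, cabs z = rho \/ cabs z = r -> cabs (H z) <= B) ->
  forall z, rho <= cabs z <= r -> cabs (H z) <= B.
Proof.
move=> rho0 rr hH hB z1 z1A; rewrite leNgt; apply/negP => Bz1.
have r0 : 0 < r by exact: lt_trans rr.
(* The perturbation e |z|^2 is then at most half the excess of |H| over [B], so no boundary point
   can carry the maximum of [Phi]. *)
pose e := (cabs (H z1) - B) / (2 * r ^+ 2).
have e0 : 0 < e by rewrite divr_gt0 ?subr_gt0// mulr_gt0// exprn_gt0.
pose A := [set z : R[i] | rho <= cabs z <= r].
pose Phi z := cabs (H z) + e * cabs z ^+ 2.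
have cA : compact A.
  apply: subclosed_compact (@cdisk_compact R 0 r) _; last first.
    by move=> z /andP[_]; rewrite /cdisk /= subr0.
  have -> : A = (fun z => cabs (z - 0)) @^-1` [set` `[rho, r]].
    by apply/funext => z; rewrite /A /= in_itv /= subr0.
  apply: closed_comp; last exact: itv_closed.
  by move=> z _; exact: cabsB_continuous.
have cP : {within A, continuous Phi}.
  apply: continuous_in_subspaceT => z /[!inE] /hH[a sH].
  have cc : (@cabs R) w @[w --> z] --> cabs z.
    by apply: cabs_lipschitz_continuous => ? ?; exact: cabs_dist.
  have cH : cabs (H w) @[w --> z] --> cabs (H z).
    move=> V /nbhs_ballP[d d0 hd].
    have [d1 d10 hd1] := sdiff_continuous sH d0.
    apply/nbhs_cabsP; exists d1 => // w wz; apply: hd.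
    by rewrite -ball_normE /= distrC; apply: le_lt_trans (cabs_dist _ _) (hd1 _ wz).
  have -> : Phi = (fun w => cabs (H w) + e * (cabs w * cabs w)).
    by apply/funext => w; rewrite /Phi expr2.
  by apply: cvgD cH _; apply: cvgM; [exact: cvg_cst|exact: cvgM].
have [|z0 z0A hmax] := compact_EVT_max _ cA cP; first by exists z1.
have {}z0A : rho <= cabs z0 <= r by move: z0A; rewrite inE.
have {}hmax z : rho <= cabs z <= r -> Phi z <= Phi z0 by move=> zA; apply: hmax; rewrite inE.
have big : B + e * r ^+ 2 < Phi z0.
  apply: lt_le_trans (hmax _ z1A); rewrite /Phi.
  apply: (@lt_le_trans _ _ (cabs (H z1))).
    have -> : e * r ^+ 2 = (cabs (H z1) - B) / 2.
      by rewrite /e; field; rewrite gt_eqF.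
    lra.
  by rewrite lerDl mulr_ge0 ?exprn_ge0 ?cabs_ge0 ?ltW.
have nb : ~ (cabs z0 = rho \/ cabs z0 = r).
  move=> /hB h; move: big; apply/negP; rewrite -leNgt /Phi lerD//.
  rewrite ler_pM2l//; case/andP: z0A => _ z0r.
  by apply: lerXn2r; rewrite ?nnegrE ?cabs_ge0 ?(ltW r0).
have [l1 l2] : rho < cabs z0 /\ cabs z0 < r.
  move: z0A; rewrite !le_eqVlt => /andP[/orP[/eqP h|?] /orP[/eqP h'|?]]//;
    by exfalso; apply: nb; rewrite ?h ?h'; tauto.
pose t := Num.min (cabs z0 - rho) (r - cabs z0).
have t0 : 0 < t by rewrite lt_min !subr_gt0 l1.
have tA z : cabs (z - z0) <= t -> rho <= cabs z <= r.
  move=> /[dup] /le_cabs_add h1; rewrite cabsBC => /le_cabs_add h2.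
  have [h3 h4] : t <= cabs z0 - rho /\ t <= r - cabs z0 by rewrite !ge_min !lexx orbT.
  by apply/andP; split; lra.
have [||d d0 hd] := @approx_mean R H z0 t (e * t ^+ 2 / 2) t0.
- by rewrite divr_gt0// mulr_gt0// exprn_gt0.
- by move=> z /tA; exact: hH.
have [n [zeta [n0 zn z1' az zd]]] := near_root_of_unity d0.
have := hd _ _ zn z1' az zd.
rewrite cabsBC => /le_cabs_add; rewrite cabsM cabs_nat => I1.
have I2 : cabs (\sum_(j < n) H (z0 + t%:C * zeta ^+ j)) <=
    n%:R * Phi z0 - e * (n%:R * (cabs z0 ^+ 2 + t ^+ 2)).
  rewrite -(sum_cabs_sqr z0 t zn z1' az) mulr_sumr mulr_natl.
  rewrite -[n in _ *+ n]card_ord -sumr_const -sumrB.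
  apply: le_trans (le_cabs_sum _) _; apply: ler_sum => j _.
  rewrite lerBrDr; apply: hmax; apply: tA.
  by rewrite addrC addKr cabsM cabs_real cabsX az expr1n mulr1 ger0_norm// ltW.
have {I1 I2} := le_trans I1 (lerD I2 (lexx _)).
have -> : n%:R * Phi z0 - e * (n%:R * (cabs z0 ^+ 2 + t ^+ 2)) +
    n%:R * (e * t ^+ 2 / 2) = n%:R * (cabs (H z0) - e * t ^+ 2 / 2).
  by rewrite /Phi; field.
rewrite ler_pM2l ?ltr0n// lerBrDr gerDl leNgt => /negP; apply.
by rewrite divr_gt0// mulr_gt0// exprn_gt0.
Qed.

End holomorphic.

(** * The dilatation of a harmonic mapping *)

Section dilatation.
Context {R : realType}.
Implicit Types (f : R[i] -> R[i]) (z w : R[i]).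

Lemma bernoulli (k : R) n : 0 <= k <= 1 -> 1 - k ^+ n <= n%:R * (1 - k).
Proof.
move=> /andP[k0 k1]; elim: n => [|n IH]; first by rewrite expr0 subrr mul0r.
have kn : k ^+ n * (1 - k) <= 1 - k by rewrite ler_piMl ?subr_ge0// exprn_ile1.
rewrite exprSr -natr1; nra.
Qed.

Lemma expr_small (k : R) : 0 <= k < 1 -> exists2 n, (0 < n)%N & k ^+ n <= 1 / 2.
Proof.
move=> /andP[k0 k1].
have [N _ hN] : \forall n \near \oo, `|k ^+ n| < 1 / 2.
  have : k ^+ n @[n --> \oo] --> (0 : R) by apply: cvg_expr; rewrite ger0_norm.
  by move/cvgr0Pnorm_lt; apply; lra.
exists N.+1 => //; apply: le_trans (ler_norm _) _; apply: ltW; exact: hN (leqnSn N).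
Qed.

Context (f : R[i] -> R[i]) (hf : harmonic_mapping (disk 1) f)
  (sf : sense_preserving (disk 1) f).

(** Compactness turns the pointwise strict inequality into a proportion; here the second parameter
    of [cdisk_uniform] is the proportion lost rather than a radius. *)
Lemma dilatation_inner : exists2 e : R, 0 < e &
  forall z, cabs z <= 1 / 2 -> cabs (dzbar f z) <= (1 - e) * cabs (dz f z).
Proof.
have [|d d0 hd] := @cdisk_uniform R 0 (1 / 2)
    (fun z e => cabs (dzbar f z) <= (1 - e) * cabs (dz f z)).
  move=> z0; rewrite subr0 => z0h.
  have z01 : disk 1 z0 by rewrite /disk /=; lra.
  have h0 := sf z01; have b0 := cabs_ge0 (dzbar f z0).
  have [a sa] := dz_sdiff hf z01; have [b sb] := conj_dzbar_sdiff hf z01.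
  pose e := (cabs (dz f z0) - cabs (dzbar f z0)) / 4.
  have e0 : 0 < e by rewrite divr_gt0// subr_gt0.
  have [d1 d10 h1] := sdiff_continuous sa e0.
  have [d2 d20 h2] := sdiff_continuous sb e0.
  exists (Num.min (Num.min d1 d2) (Num.min 1 (e / cabs (dz f z0)))) => [|z r].
    by rewrite !lt_min d10 d20 ltr01 divr_gt0//; lra.
  rewrite !lt_min => /andP[/andP[z1 z2] _] r0 /andP[_ /andP[r1]].
  have := ltW (h1 _ z1); rewrite cabsBC => /le_cabs_add k1.
  have := ltW (h2 _ z2) => /le_cabs_add; rewrite !cabsJ => k2.
  rewrite ltr_pdivlMr; last lra.
  move=> re; have : (1 - r) * (cabs (dz f z0) - e) <= (1 - r) * cabs (dz f z).
    by apply: ler_wpM2l; lra.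
  have e4 : 4 * e = cabs (dz f z0) - cabs (dzbar f z0) by rewrite /e; field.
  have : 0 <= r * e by rewrite mulr_ge0// ltW.
  lra.
exists (Num.min (d / 2) 1); first by rewrite lt_min divr_gt0//=.
move=> z zh; apply: le_trans (hd z (d / 2) _ _ _) _; rewrite ?subr0//; first by rewrite divr_gt0.
  by lra.
by apply: ler_wpM2r; [exact: cabs_ge0|rewrite lerD2l lerN2 ge_min lexx].
Qed.

(** The exponent makes |omega|^n at most 1/2 on the circle |z| = 1/2, so omega^n / z is bounded by 1
    there and by 1/r on |z| = r. Taking r close to 1 leaves |omega|^n <= |z|. *)
Lemma dilatation_outer : exists2 n, (0 < n)%N & forall z, 1 / 2 <= cabs z < 1 ->
  (cabs (dzbar f z) / cabs (dz f z)) ^+ n <= cabs z.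
Proof.
have [e e0 he] := dilatation_inner.
have dz0 z : disk 1 z -> 0 < cabs (dz f z).
  by move=> /sf; apply: le_lt_trans; exact: cabs_ge0.
have k01 z : disk 1 z -> 0 <= cabs (dzbar f z) / cabs (dz f z) <= 1.
  move=> z1; apply/andP; split; first by apply: divr_ge0; exact: cabs_ge0.
  by rewrite ler_pdivrMr ?mul1r ?dz0//; apply/ltW; exact: sf.
pose k := Num.max 0 (1 - e).
have [n n0 kn] : exists2 n, (0 < n)%N & k ^+ n <= 1 / 2.
  by apply: expr_small; rewrite le_max lexx gt_max ltr01 /= gtrBl.
exists n => // z /andP[z2 z1].
pose H w := ((dzbar f w)^*%C / dz f w) ^+ n * w^-1.
have HE w : cabs (H w) = (cabs (dzbar f w) / cabs (dz f w)) ^+ n / cabs w.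
  by rewrite cabsM cabsX cabsV cabsM cabsV cabsJ.
set x := (_ / _) ^+ n; rewrite leNgt; apply/negP => zx.
have z0 : 0 < cabs z by lra.
have x1 : x <= 1.
  by have /andP[? ?] := k01 z z1; exact: exprn_ile1.
have x0 : 0 < x by exact: lt_trans zx.
(* Any radius strictly between |z| / x and 1 gives a contradiction: at [z] the modulus x / |z| of
   [H] would exceed 1/r. *)
pose r := (1 + cabs z / x) / 2.
have q1 : cabs z / x < 1 by rewrite ltr_pdivrMr// mul1r.
have q2 : cabs z <= cabs z / x by rewrite ler_pdivlMr// ler_piMr// ltW.
have zr : cabs z < r by rewrite /r; lra.
have r1 : r < 1 by rewrite /r; lra.
have r0 : 0 < r by lra.
have rx : cabs z < r * x.
  have -> : r * x = (x + cabs z) / 2 by rewrite /r; field; rewrite gt_eqF.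
  by lra.
have hH w : 1 / 2 <= cabs w <= r -> holomorphic_at H w.
  move=> /andP[w2 wr]; have w1 : disk 1 w by rewrite /disk /=; lra.
  apply: holomorphicM; last first.
    apply: (@holomorphicV _ id); first by exists 1; exact: sdiff_id.
    by rewrite -cabs_gt0; lra.
  apply: (@holomorphicX _ (fun w => (dzbar f w)^*%C / dz f w)).
  apply: holomorphicM; first exact: conj_dzbar_sdiff.
  apply: holomorphicV; first exact: dz_sdiff.
  by rewrite -cabs_gt0 dz0.
have hB w : cabs w = 1 / 2 \/ cabs w = r -> cabs (H w) <= r^-1.
  rewrite HE => -[] wE.
    have w1 : disk 1 w by rewrite /disk /=; lra.
    rewrite wE; apply: (@le_trans _ _ 1); last by rewrite invf_ge1// ltW.
    rewrite ler_pdivrMr// mul1r; apply: le_trans kn; apply: lerXn2r.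
    - by rewrite nnegrE; case/andP: (k01 w w1).
    - by rewrite nnegrE le_max lexx.
    - by rewrite le_max; apply/orP; right; rewrite ler_pdivrMr ?dz0// he// wE.
  rewrite wE ler_piMl ?invr_ge0 ?(ltW r0)//; have w1 : disk 1 w by rewrite /disk /= wE.
  by have /andP[? ?] := k01 w w1; exact: exprn_ile1.
have /(_ ltac:(lra) ltac:(lra)) := @annulus_max R H r^-1 (1 / 2) r.
move=> /(_ hH hB z); rewrite z2 (ltW zr) => /(_ isT).
rewrite HE -/x ler_pdivrMr// mulrC ler_pdivlMr// mulrC => /(lt_le_trans rx).
by rewrite ltxx.
Qed.

(** Near the circle, Bernoulli's inequality gives 1 - |z| <= 1 - |omega|^n <= n (1 - |omega|). This
    linear rate is what later makes the distortion constant of order 1 / (1 - r). *)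
Lemma dilatation_bound : exists2 c : R, 0 < c & forall z, disk 1 z ->
  c * (1 - cabs z) * cabs (dz f z) <= cabs (dz f z) - cabs (dzbar f z).
Proof.
have [e e0 he] := dilatation_inner; have [n n0 hn] := dilatation_outer.
have nn : 0 < n%:R :> R by rewrite ltr0n.
exists (Num.min e n%:R^-1) => [|z z1]; first by rewrite lt_min e0 invr_gt0.
have [ce cn] : Num.min e n%:R^-1 <= e /\ Num.min e n%:R^-1 <= n%:R^-1.
  by rewrite !ge_min !lexx orbT.
set c := Num.min _ _ in ce cn *.
have c0 : 0 < c by rewrite lt_min e0 invr_gt0.
have zz : 0 <= 1 - cabs z by rewrite subr_ge0 ltW.
have zz1 : 1 - cabs z <= 1 by rewrite gerBl cabs_ge0.
have a0 : 0 < cabs (dz f z) by apply: le_lt_trans (sf z1); exact: cabs_ge0.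
have [z2|/ltW z2] := leP (cabs z) (1 / 2).
  have := he _ z2 => hz.
  apply: (@le_trans _ _ (e * cabs (dz f z))); last lra.
  rewrite ler_pM2r//; apply: le_trans ce; rewrite ler_piMr// ltW//.
have := hn z; rewrite z2 z1 => /(_ isT) hz.
set k := _ / _ in hz.
have k01 : 0 <= k <= 1.
  apply/andP; split; first by apply: divr_ge0; exact: cabs_ge0.
  by rewrite ler_pdivrMr// mul1r; apply/ltW; exact: sf.
have bE : cabs (dzbar f z) = k * cabs (dz f z) by rewrite /k divfK// gt_eqF.
rewrite bE -{2}[cabs (dz f z)]mul1r -mulrBl ler_pM2r//.
have := bernoulli n k01 => hb.
apply: (@le_trans _ _ (n%:R^-1 * (1 - cabs z))); first by rewrite ler_wpM2r.
by rewrite mulrC ler_pdivrMr// mulrC; lra.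
Qed.

End dilatation.

(** * Area distortion on small discs *)

Section local_inverse.
Context {R : realType}.
Implicit Types (f g : R[i] -> R[i]) (z w h a b : R[i]).

(** The general real-linear map of the plane, with determinant |a|^2 - |b|^2; when |b| < |a| its
    largest and smallest stretchings are |a| + |b| and |a| - |b|. *)
Definition affine_part a b h : R[i] := a * h + b * h^*%C.

Lemma affine_partD a b : {morph affine_part a b : x y / x + y}.
Proof. by move=> x y; rewrite /affine_part rmorphD; ring. Qed.

Lemma affine_partB a b : {morph affine_part a b : x y / x - y}.
Proof. by move=> x y; rewrite /affine_part rmorphB; ring. Qed.

Lemma affine_part_le a b h : cabs (affine_part a b h) <= (cabs a + cabs b) * cabs h.
Proof.
by rewrite mulrDl; apply: le_trans (le_cabsD _ _) _; rewrite !cabsM cabsJ.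
Qed.


Lemma affine_part_ge a b h : (cabs a - cabs b) * cabs h <= cabs (affine_part a b h).
Proof.
have := le_cabs_add (lexx (cabs (a * h - affine_part a b h))).
have -> : a * h - affine_part a b h = - (b * h^*%C) by rewrite /affine_part; ring.
rewrite cabsN !cabsM cabsJ; lra.
Qed.

(** Cramer's rule for the equation and its conjugate; [J] is the determinant. *)
Lemma affine_part_surj a b w : cabs b < cabs a -> exists h, affine_part a b h = w.
Proof.
move=> ba; pose J : R[i] := a * a^*%C - b * b^*%C.
have sq z : z * z^*%C = (cabs z ^+ 2)%:C.
  rewrite cabsE; case: z => x y; apply/eqP; rewrite eq_complex /=.
  by apply/andP; split; apply/eqP; ring.
have J0 : J != 0.
  rewrite /J !sq -(rmorphB (real_complex R)) -cabs_eq0 cabs_real normr_eq0 subr_eq0.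
  by rewrite eqrXn2// ?cabs_ge0// gt_eqF.
have JJ : J^*%C = J by rewrite /J rmorphB !rmorphM /= !conjcK; ring.
pose h : R[i] := (a^*%C * w - b * w^*%C) / J; exists h.
have E : h^*%C = (a * w^*%C - b^*%C * w) / J.
  rewrite [LHS](rmorphM (@conjc R)) /= conjc_inv JJ; congr (_ / _).
  by rewrite (rmorphB (@conjc R)) !(rmorphM (@conjc R)) /= !conjcK.
rewrite /affine_part E /h.
have -> : a * ((a^*%C * w - b * w^*%C) / J) + b * ((a * w^*%C - b^*%C * w) / J) =
  w * ((a * a^*%C - b * b^*%C) / J) by ring.
by rewrite -/J divff// mulr1.
Qed.

Lemma continuous_cdisk_min (phi : R[i] -> R) z (r : R) : 0 <= r ->
  (forall w, cabs (w - z) <= r -> forall e, 0 < e -> exists2 d : R, 0 < d &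
    forall v, cabs (v - w) < d -> `|phi v - phi w| < e) ->
  exists2 w, cabs (w - z) <= r & forall v, cabs (v - z) <= r -> phi w <= phi v.
Proof.
move=> r0 cphi.
have cP : {within cdisk z r, continuous (fun w => - phi w)}.
  apply: continuous_in_subspaceT => w /[!inE] wr V /nbhs_ballP[d d0 hd].
  have [d1 d10 hd1] := cphi _ wr _ d0.
  apply/nbhs_cabsP; exists d1 => // v vw; apply: hd.
  by rewrite -ball_normE /= opprK addrC; exact: hd1.
have [|w wr hmax] := compact_EVT_max _ (@cdisk_compact R z r) cP.
  by exists z; rewrite /cdisk /= subrr cabs0.
exists w; first by move: wr; rewrite inE.
by move=> v vr; rewrite -lerN2; apply: hmax; rewrite inE.
Qed.

(** A quantitative inverse function theorem by minimisation: at a point of the disc where the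
    distance of [f] to the target is minimal and positive, moving by the linear preimage of the
    residual would at least halve it. *)
Lemma local_surj f z0 a b : sdiff f z0 a b -> cabs b < cabs a ->
  exists2 d : R, 0 < d & forall z (r : R) h, cabs (z - z0) < d -> 0 < r -> r < d ->
    cabs h <= r / 2 ->
    exists2 w, cabs (w - z) <= r & f w = f z + affine_part a b h.
Proof.
move=> sf ba; pose m := cabs a - cabs b.
have m0 : 0 < m by rewrite subr_gt0.
have m20 : 0 < m / 2 by rewrite divr_gt0.
have [d d0 hd] := sf _ m20.
exists (d / 2) => [|z r h zd r0 rd hr]; first by rewrite divr_gt0.
have inD w : cabs (w - z) <= r -> cabs (w - z0) < d.
  by move=> wr; rewrite (splitr d); apply: le_lt_trans (cabs_triangle _ _ z) _; rewrite ltrD// (le_lt_trans wr).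
have zD : cabs (z - z0) < d by apply: inD; rewrite subrr cabs0 ltW.
have est w v : cabs (w - z) <= r -> cabs (v - z) <= r ->
    cabs (f v - f w - affine_part a b (v - w)) <= m / 2 * cabs (v - w).
  by move=> wr vr; apply: hd; exact: inD.
have estd w v : cabs (w - z0) < d -> cabs (v - z0) < d ->
    cabs (f v - f w - affine_part a b (v - w)) <= m / 2 * cabs (v - w).
  exact: hd.
pose phi w := cabs (f w - (f z + affine_part a b h)).
have [|w wr hmin] := @continuous_cdisk_min phi z r (ltW r0).
  move=> w /inD wD e e0.
  pose L := m / 2 + (cabs a + cabs b); have L0 : 0 < L.
    by rewrite ltr_pwDl// addr_ge0// cabs_ge0.
  exists (Num.min (d - cabs (w - z0)) (e / L)) => [|v].
    by rewrite lt_min subr_gt0 wD divr_gt0.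
  rewrite lt_min => /andP[v1 v2].
  have vD : cabs (v - z0) < d.
    by apply: le_lt_trans (cabs_triangle _ _ w) _; lra.
  apply: le_lt_trans (cabs_dist _ _) _.
  have -> : f v - (f z + affine_part a b h) - (f w - (f z + affine_part a b h)) = f v - f w by ring.
  apply: le_lt_trans (le_cabs_add (estd _ _ wD vD)) _.
  apply: (@le_lt_trans _ _ (L * cabs (v - w))).
    by rewrite addrC [leRHS]mulrDl lerD2l affine_part_le.
  by rewrite mulrC -ltr_pdivlMr.
exists w => //; apply/eqP; rewrite -subr_eq0 -cabs_eq0; apply/eqP.
apply/eqP; apply: contraT => y0; exfalso.
pose y := f z + affine_part a b h - f w.
have yphi : cabs y = phi w by rewrite /phi cabsBC.
have {}y0 : 0 < cabs y by rewrite lt_def yphi y0 cabs_ge0.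
have [x xE] := affine_part_surj y ba.
have xle : m * cabs x <= cabs y by rewrite -xE affine_part_ge.
(* The corrected point must stay in the disc: [w + x] differs from [z + h] only by the linearisation
   error, which accounts for r/2, and [h] accounts for the other half. *)
have wxr : cabs (w + x - z) <= r.
  have E : affine_part a b (w + x - z) = affine_part a b h - (f w - f z - affine_part a b (w - z)).
    have -> : w + x - z = (w - z) + x by ring.
    by rewrite affine_partD xE /y; ring.
  have hz : cabs (f w - f z - affine_part a b (w - z)) <= m / 2 * r.
    apply: le_trans (est z w _ wr) _; first by rewrite subrr cabs0 ltW.
    by rewrite ler_wpM2l// ltW.
  have E2 : affine_part a b (w + x - z - h) = - (f w - f z - affine_part a b (w - z)).
    by rewrite affine_partB E; ring.
  have := affine_part_ge a b (w + x - z - h); rewrite E2 cabsN => /le_trans /(_ hz).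
  rewrite -/m -mulrA ler_pM2l// => k.
  have := le_cabs_add k; move: hr; lra.
have := hmin _ wxr; rewrite -yphi leNgt => /negP; apply.
have -> : phi (w + x) = cabs (f (w + x) - f w - affine_part a b (w + x - w)).
  have -> : w + x - w = x by ring.
  by rewrite /phi xE /y; congr cabs; ring.
apply: le_lt_trans (est _ _ wr wxr) _.
have -> : w + x - w = x by ring.
by rewrite mulrAC; lra.
Qed.

End local_inverse.

(** * Areas of sheared rectangles and packing in a square *)

Section planar_measure.
Context {R : realType}.
Implicit Types (k s t : R).

Definition area : set (measurableTypeR R * measurableTypeR R) -> \bar R :=
  (@lebesgue_measure R \x @lebesgue_measure R)%E.

HB.instance Definition _ := Measure.on area.

(** A parallelogram with vertical sides. All its nonempty vertical sections are intervals of length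
    2t, so its area comes from the product measure directly. *)
Definition shear_x (x0 y0 : R) k s t : set (measurableTypeR R * measurableTypeR R) :=
  [set p | `|p.1 - x0| < s /\ `|p.2 - y0 - k * (p.1 - x0)| < t].

Lemma measurable_norm_lt d (T : measurableType d) (g : T -> R) (c : R) :
  measurable_fun setT g -> measurable [set x | `|g x| < c].
Proof.
move=> mg; have -> : [set x | `|g x| < c] = g @^-1` `]- c, c[%classic.
  by apply/funext => x; rewrite /preimage /= in_itv /= ltr_norml.
by rewrite -[X in measurable X]setTI; apply: mg => //; exact: measurable_itv.
Qed.

Let m1 : measurable_fun setT (fst : measurableTypeR R * measurableTypeR R -> R).
Proof. exact: measurable_fst. Qed.

Let m2 : measurable_fun setT (snd : measurableTypeR R * measurableTypeR R -> R).
Proof. exact: measurable_snd. Qed.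

Lemma measurable_shear_x x0 y0 k s t : measurable (shear_x x0 y0 k s t).
Proof.
apply: measurableI; apply: measurable_norm_lt.
  by apply: measurable_funB; [exact: m1|exact: measurable_cst].
apply: measurable_funB.
  by apply: measurable_funB; [exact: m2|exact: measurable_cst].
apply: measurable_funM; first exact: measurable_cst.
by apply: measurable_funB; [exact: m1|exact: measurable_cst].
Qed.

Lemma lebesgue_measure_norm_lt (a c : R) : 0 <= c ->
  @lebesgue_measure R [set x | `|x - a| < c] = (c *+ 2)%:E.
Proof.
move=> c0; rewrite -(lebesgue_measure_ball a c0); congr (lebesgue_measure _).
by apply/funext => x; rewrite -ball_normE /ball_ /= distrC.
Qed.

Let mI (a c : R) : measurable ([set x | `|x - a| < c] : set (measurableTypeR R)).
Proof.
by apply: measurable_norm_lt; apply: measurable_funB; [exact: measurable_id|exact: measurable_cst].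
Qed.

Lemma area_shear_x x0 y0 k s t : 0 <= s -> 0 <= t ->
  area (shear_x x0 y0 k s t) = (4 * s * t)%:E.
Proof.
move=> s0 t0.
pose S : set (measurableTypeR R) := [set x : R | `|x - x0| < s].
transitivity (\int[@lebesgue_measure R]_x ((cst (t *+ 2)%:E \_ S) x))%E.
  apply: eq_integral => x _; rewrite patchE /=; case: ifPn => [|].
    rewrite inE /= => xs; rewrite -(lebesgue_measure_norm_lt (y0 + k * ((x : R) - x0)) t0).
    congr (lebesgue_measure _); apply/funext => y; rewrite /xsection /= /shear_x.
    apply/propext; split; rewrite inE /= -?addrA ?opprD.
      by case=> _; rewrite addrA.
    by move=> h; split => //; rewrite -addrA.
  rewrite notin_setE /= => xs; rewrite (_ : xsection _ _ = set0) ?measure0//.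
  by apply/funext => y; apply/propext; split => //; rewrite /xsection /= inE => -[].
rewrite -integral_mkcond integral_cst; last exact: mI.
transitivity ((t *+ 2)%:E * (s *+ 2)%:E)%E.
  by congr (_ * _)%E; exact: lebesgue_measure_norm_lt.
by rewrite -EFinM; congr EFin; ring.
Qed.

Definition box (c : R) := shear_x 0 0 0 c c.

Lemma boxE (c : R) p : box c p <-> `|p.1| < c /\ `|p.2| < c.
Proof. by rewrite /box /shear_x /= mul0r !subr0. Qed.

Lemma measurable_box c : measurable (box c).
Proof. exact: measurable_shear_x. Qed.

Lemma area_box c : 0 <= c -> area (box c) = (4 * c ^+ 2)%:E.
Proof. by move=> c0; rewrite area_shear_x//; congr EFin; ring. Qed.

Lemma sum_area_le (I : finType) (D : pred I)
    (P : I -> set (measurableTypeR R * measurableTypeR R)) (A : I -> R) (c : R) :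
  0 <= c -> (forall i, D i -> measurable (P i)) ->
  (forall i, D i -> area (P i) = (A i)%:E) ->
  (forall i, D i -> P i `<=` box c) ->
  (forall i j, D i -> D j -> i != j -> P i `&` P j = set0) ->
  \sum_(i | D i) A i <= 4 * c ^+ 2.
Proof.
move=> c0 mP PA Pc dP; rewrite -lee_fin -(area_box c0) -sumEFin.
rewrite (eq_bigr (fun i => area (P i))); last by move=> i /PA ->.
have tP : trivIset [set` D] P.
  apply/trivIsetP => i j Di Dj ij; exact: dP.
have mP' i : [set` D] i -> measurable (P i) by exact: mP.
have fD : finite_set [set` D] by exact: finite_finpred.
have := @measure_fin_bigcup _ _ _ area _ _ _ fD tP mP'.
rewrite -(@bigfs _ _ _ _ (index_enum I)) ?index_enum_uniq//; last by move=> i _; rewrite mem_index_enum.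
move=> <-.
apply: le_measure; rewrite ?inE; last by apply: bigcup_sub => i; exact: Pc.
  by apply: fin_bigcup_measurable.
exact: measurable_box.
Qed.

End planar_measure.

(** * The contribution of one grid cell *)

Section cells.
Context {R : realType}.
Implicit Types (g : R[i] -> R[i]) (z w h a b : R[i]).

(** Inside the parallelogram spanned by [(p1, p2)] and [(q1, q2)] lies one with vertical sides and a
    fixed fraction of its area. Its slope is that of the vector with the larger first coordinate,
    which avoids division by a small number. *)
Lemma shear_in_parallelogram (p1 p2 q1 q2 w1 w2 r : R) :
  0 < r -> p1 * q2 - p2 * q1 != 0 -> `|q1| <= `|p1| ->
  exists P, [/\ measurable P, area P = (`|p1 * q2 - p2 * q1| * r ^+ 2 / 16)%:E &
    forall p, P p -> exists x y, [/\ `|x| <= r / 4, `|y| <= r / 4,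
      p.1 = w1 + (x * p1 + y * q1) & p.2 = w2 + (x * p2 + y * q2)]].
Proof.
move=> r0 D0 qp; set D := _ - _ in D0 *.
have p10 : p1 != 0.
  apply: contraNneq D0 => p0; rewrite p0 normr0 normr_le0 in qp.
  by rewrite /D p0 (eqP qp) mul0r mulr0 subrr.
have np1 : 0 < `|p1| by rewrite normr_gt0.
have nD : 0 < `|D| by rewrite normr_gt0.
(* With these sizes |y| <= r/8, and then |x| <= (|p1| r/8 + |q1| r/8) / |p1| <= r/4; the product 4 s
   t is the claimed area. *)
pose s := `|p1| * r / 8; pose t := `|D| * r / (8 * `|p1|).
have s0 : 0 <= s by rewrite divr_ge0// mulr_ge0// ltW.
have t0 : 0 <= t by rewrite divr_ge0 ?mulr_ge0// ltW.
exists (shear_x w1 w2 (p2 / p1) s t); split.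
- exact: measurable_shear_x.
- rewrite area_shear_x//; congr EFin; rewrite /s /t; field.
  by rewrite gt_eqF.
move=> [X Y] [/= hX hY].
set eta := Y - w2 - _ in hY; pose y := p1 * eta / D.
have ny : `|y| <= r / 8.
  rewrite /y normrM normfV ler_pdivrMr// normrM.
  apply: le_trans (ler_wpM2l (ltW np1) (ltW hY)) _.
  by rewrite le_eqVlt; apply/orP; left; apply/eqP; rewrite /t; field; rewrite gt_eqF.
have nx : `|(X - w1 - y * q1) / p1| <= r / 4.
  rewrite normrM normfV ler_pdivrMr//; apply: le_trans (ler_normB _ _) _.
  rewrite normrM.
  have h1 : `|y| * `|q1| <= r / 8 * `|p1| by apply: ler_pM.
  move: (ltW hX); rewrite /s; lra.
exists ((X - w1 - y * q1) / p1), y; split => //.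
- by apply: le_trans ny _; lra.
- by rewrite divfK//; ring.
- have E : y * D = p1 * eta by rewrite /y divfK.
  have -> : (X - w1 - y * q1) / p1 * p2 + y * q2 = (X - w1) * p2 / p1 + y * D / p1.
    by rewrite /D; field.
  by rewrite E /eta; field.
Qed.

Lemma box_in_affine_image a b w (r : R) : 0 < r -> cabs b < cabs a ->
  exists P, [/\ measurable P,
    area P = ((cabs a ^+ 2 - cabs b ^+ 2) * r ^+ 2 / 16)%:E &
    forall p, P p -> exists2 h, cabs h <= r / 2 & of_xy p = w + affine_part a b h].
Proof.
move=> r0 ba; case: a ba => a1 a2; case: b => b1 b2; case: w => w1 w2 ba.
(* The columns [(p1, p2)] and [(q1, q2)] are the images of 1 and i under the affine part. *)
pose p1 := a1 + b1; pose p2 := a2 + b2; pose q1 := b2 - a2; pose q2 := a1 - b1.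
have J0 : 0 < cabs (a1 +i* a2) ^+ 2 - cabs (b1 +i* b2) ^+ 2.
  by rewrite subr_gt0 ltrXn2r ?nnegrE ?cabs_ge0.
have JE : cabs (a1 +i* a2) ^+ 2 - cabs (b1 +i* b2) ^+ 2 = p1 * q2 - p2 * q1.
  by rewrite !cabsE /= /p1 /p2 /q1 /q2; ring.
rewrite JE in J0 *.
have aff x y : affine_part (a1 +i* a2) (b1 +i* b2) (x +i* y) =
    (x * p1 + y * q1) +i* (x * p2 + y * q2).
  apply/eqP; rewrite eq_complex /= /p1 /p2 /q1 /q2.
  by apply/andP; split; apply/eqP; ring.
have le2 (x y : R) : `|x| <= r / 4 -> `|y| <= r / 4 -> cabs (x +i* y) <= r / 2.
  move=> hx hy; apply: le_trans (cabs_le_ReIm _) _ => /=; lra.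
have [qp|/ltW pq] := leP `|q1| `|p1|.
  have [|P [mP AP hP]] := @shear_in_parallelogram p1 p2 q1 q2 w1 w2 r r0 _ qp.
    by rewrite gt_eqF.
  exists P; split => //; first by rewrite AP gtr0_norm.
  move=> p /hP[x [y [hx hy e1 e2]]]; exists (x +i* y); first exact: le2.
  by rewrite aff /of_xy e1 e2.
have EN : q1 * p2 - q2 * p1 = - (p1 * q2 - p2 * q1) by ring.
have [|P [mP AP hP]] := @shear_in_parallelogram q1 q2 p1 p2 w1 w2 r r0 _ pq.
  by rewrite EN oppr_eq0 gt_eqF.
exists P; split => //; first by rewrite AP EN normrN gtr0_norm.
move=> p /hP[y [x [hy hx e1 e2]]]; exists (x +i* y); first exact: le2.
by rewrite aff /of_xy e1 e2 [x * p1 + _]addrC [x * p2 + _]addrC.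
Qed.

(** The lower clamp keeps the logarithm Lipschitz near a zero of the map; the upper one makes it
    constant far out. *)
Definition clamp (M del : R) w := Num.min del (Num.max M (cabs w)).

Lemma clamp_lip M del w w' : `|clamp M del w - clamp M del w'| <= cabs (w - w').
Proof.
have h := cabs_dist w w'; move: (cabs_ge0 (w - w')) h.
rewrite /clamp; move: (cabs (w - w')) (cabs w) (cabs w') => d x y d0.
rewrite !ler_norml => /andP[h1 h2].
case: (leP M x) => ?; case: (leP M y) => ?;
  [case: (leP del x) => ?; case: (leP del y) => ?|
   case: (leP del x) => ?; case: (leP del M) => ?|
   case: (leP del M) => ?; case: (leP del y) => ?|case: (leP del M) => ?];
  by apply/andP; split; lra.
Qed.

Lemma ln_lip (x y m : R) : 0 < m -> m <= x -> m <= y -> `|ln x - ln y| <= `|x - y| / m.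
Proof.
move=> m0; wlog xy : x y / x <= y.
  move=> h mx my; have /orP[xy|yx] := le_total x y; first exact: h.
  by rewrite distrC [`|x - y|]distrC; exact: h.
move=> mx my; have x0 : 0 < x by exact: lt_le_trans mx.
have y0 : 0 < y by exact: lt_le_trans my.
rewrite distrC [`|x - y|]distrC !ger0_norm ?subr_ge0 ?ler_ln//.
rewrite -ln_div ?posrE//.
have -> : y / x = 1 + (y - x) / x by field; rewrite gt_eqF.
apply: le_trans (le_ln1Dx _) _.
  by rewrite (lt_le_trans (ltrN10 R))// divr_ge0 ?subr_ge0// ltW.
by rewrite ler_wpM2l ?subr_ge0// lef_pV2.
Qed.

(** The exchange of oscillation for image area in one cell: [P] is a measurable piece of the image
    of the disc of radius r/8, and dividing its area by (2^k M)^2 imitates the integral of 1/|w|^2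
    over [P]. Oscillation is controlled on radius [r], which reaches the neighbouring grid points,
    while the discs of radius r/8 stay disjoint. *)
Definition cell g (M del C : R) N z (r : R) := exists P k (A : R),
  [/\ measurable P /\ area P = A%:E, P `<=` box (2 ^+ k * M), (k <= N)%N,
      forall p, P p -> exists2 w, cabs (w - z) <= r / 8 & g w = of_xy p &
      forall w, cabs (w - z) <= r ->
        (ln (clamp M del (g w)) - ln (clamp M del (g z))) ^+ 2
          <= C * A / (2 ^+ k * M) ^+ 2].

Lemma dyadic_index (M x : R) N : 0 < M -> M <= x -> x <= 2 ^+ N * M ->
  exists k, [/\ (k <= N)%N, x <= 2 ^+ k * M & 2 ^+ k * M <= 2 * x].
Proof.
move=> M0 Mx; elim: N => [|N IH] xN.
  by exists 0%N; split; rewrite // expr0 mul1r; lra.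
have [xN'|/ltW xN'] := leP x (2 ^+ N * M).
  by have [k [kN k1 k2]] := IH xN'; exists k; split => //; exact: leqW.
by exists N.+1; split => //; rewrite exprS -mulrA ler_pM2l.
Qed.

Lemma local_cell g z0 a b (K M del : R) N : sdiff g z0 a b ->
  cabs b < cabs a -> cabs a + cabs b <= K * (cabs a - cabs b) ->
  0 < M -> M <= del -> 2 * del <= 2 ^+ N * M ->
  exists2 d : R, 0 < d & forall z r, cabs (z - z0) < d -> 0 < r -> r < d ->
    cell g M del (2 ^+ 18 * K) N z r.
Proof.
move=> sg ba hK M0 Md dN.
have del0 : 0 < del by exact: lt_le_trans Md.
have [far|near] := ltP del (cabs (g z0)).
  have e0 : 0 < cabs (g z0) - del by rewrite subr_gt0.
  have [d d0 hd] := sdiff_continuous sg e0.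
  exists (d / 2) => [|z r zd r0 rd]; first by rewrite divr_gt0.
  have inD w : cabs (w - z) <= r -> clamp M del (g w) = del.
    move=> wr; have wd : cabs (w - z0) < d.
      rewrite (splitr d); apply: le_lt_trans (cabs_triangle _ _ z) _.
      by rewrite ltrD// (le_lt_trans wr).
    have := ltW (hd _ wd); rewrite cabsBC => /le_cabs_add h.
    by rewrite /clamp; apply/min_idPl; rewrite le_max; apply/orP; right; lra.
  exists set0, 0%N, 0; split => //; first by split; rewrite ?measure0.
  move=> w wr; rewrite !inD// ?subrr ?cabs0 ?(ltW r0)//.
  by rewrite expr0n mulr0 mul0r.
pose x0 := Num.max M (cabs (g z0)).
have Mx0 : M <= x0 by rewrite le_max lexx.
have x0d : x0 <= del by rewrite ge_max Md near.
have gx0 : cabs (g z0) <= x0 by rewrite le_max lexx orbT.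
(* One dyadic level is kept in reserve: near [z0] the values of [g] may exceed [x0] by M/4, and they
   still lie in the box of level [k.+1]. *)
have [k [kN k1 k2]] : exists k, [/\ (k.+1 <= N)%N, x0 <= 2 ^+ k * M & 2 ^+ k * M <= 2 * x0].
  case: N dN => [|N] dN; first by move: dN; rewrite expr0 mul1r; lra.
  have [|k [kN k1 k2]] := @dyadic_index M x0 N M0 Mx0; last by exists k.
  move: dN; rewrite exprS -mulrA ler_pM2l// => dN; exact: le_trans x0d dN.
have m0 : 0 < cabs a - cabs b by rewrite subr_gt0.
have S0 : 0 < cabs a + cabs b by have := cabs_ge0 b; lra.
have [d1 d10 hd1] := local_surj sg ba.
have [d2 d20 hd2] := sg _ S0.
have M40 : 0 < M / 4 by rewrite divr_gt0.
have [d3 d30 hd3] := sdiff_continuous sg M40.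
pose d := Num.min d1 (Num.min d2 d3) / 2.
have [dd1 dd2 dd3] : [/\ 2 * d <= d1, 2 * d <= d2 & 2 * d <= d3].
  by rewrite /d mulrC divfK ?pnatr_eq0// !ge_min !lexx !orbT.
have d0 : 0 < d by rewrite divr_gt0// !lt_min d10 d20 d30.
exists d => // z r zd r0 rd.
have inD w : cabs (w - z) <= r -> cabs (w - z0) < 2 * d.
  by move=> wr; apply: le_lt_trans (cabs_triangle _ _ z) _; lra.
have r80 : 0 < r / 8 by rewrite divr_gt0.
have [P [mP AP hP]] := box_in_affine_image (g z) r80 ba.
exists P, k.+1, ((cabs a ^+ 2 - cabs b ^+ 2) * (r / 8) ^+ 2 / 16).
have PD p : P p -> exists2 w, cabs (w - z) <= r / 8 & g w = of_xy p.
  move=> /hP[h hr ->]; apply: hd1 => //; first by lra.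
  by lra.
have gw w : cabs (w - z) <= r -> cabs (g w - g z0) <= M / 4.
  by move=> wr; apply/ltW/hd3; apply: lt_le_trans (inD _ wr) _.
split => //.
- move=> p /PD[w wr gwp]; apply/boxE.
  have {}wr : cabs (w - z) <= r by lra.
  have := le_cabs_add (gw _ wr); rewrite gwp => hc.
  have kM : x0 + M / 4 < 2 ^+ k.+1 * M by rewrite exprS -mulrA; lra.
  split; (apply: le_lt_trans (_ : cabs (of_xy p) < _); last by lra).
    exact: Re_le_cabs (of_xy p).
  exact: Im_le_cabs (of_xy p).
move=> w wr.
have zr : cabs (z - z) <= r by rewrite subrr cabs0 ltW.
have cl0 : clamp M del (g z0) = x0 by apply/min_idPr.
have clb v : cabs (v - z) <= r -> 3 / 4 * x0 <= clamp M del (g v).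
  move=> vr; have := clamp_lip M del (g v) (g z0); rewrite cl0 => h.
  have := le_trans h (gw _ vr); rewrite ler_norml => /andP[h1 _]; lra.
have x00 : 0 < 3 / 4 * x0 by have := lt_le_trans M0 Mx0; lra.
have e1 := ln_lip x00 (clb _ wr) (clb _ zr).
have e2 : cabs (g w - g z) <= 2 * (cabs a + cabs b) * r.
  have wz := lt_le_trans (inD _ wr) dd2; have zz := lt_le_trans (inD _ zr) dd2.
  have := le_cabs_add (hd2 _ _ zz wz) => /le_trans; apply.
  apply: (@le_trans _ _ (2 * ((cabs a + cabs b) * cabs (w - z)))).
    set y := (_ + _) * _; rewrite (_ : 2 * y = y + y); last by ring.
    by rewrite lerD2r; exact: affine_part_le.
  by rewrite -mulrA ler_pM2l// ler_pM2l.
have e3 : `|ln (clamp M del (g w)) - ln (clamp M del (g z))| <=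
    2 * (cabs a + cabs b) * r / (3 / 4 * x0).
  apply: le_trans e1 _; rewrite ler_pM2r ?invr_gt0//.
  by apply: le_trans e2; exact: clamp_lip.
have kM0 : 0 < 2 ^+ k * M by rewrite mulr_gt0// exprn_gt0.
have e4 : 2 * (cabs a + cabs b) * r / (3 / 4 * x0) <=
    6 * (cabs a + cabs b) * r / (2 ^+ k * M).
  rewrite ler_pdivrMr// [leRHS]mulrAC ler_pdivlMr//.
  have -> : 6 * (cabs a + cabs b) * r * (3 / 4 * x0) = (2 * (cabs a + cabs b) * r) * (9 / 4 * x0) by field.
  rewrite ler_pM2l; last by rewrite mulr_gt0// mulr_gt0.
  lra.
have := le_trans e3 e4 => e5.
rewrite -real_normK ?num_real//.
apply: (@le_trans _ _ ((6 * (cabs a + cabs b) * r / (2 ^+ k * M)) ^+ 2)).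
  by rewrite lerXn2r ?nnegrE// (le_trans _ e5).
have eK : (cabs a + cabs b) ^+ 2 <= K * (cabs a ^+ 2 - cabs b ^+ 2).
  have -> : K * (cabs a ^+ 2 - cabs b ^+ 2) = K * (cabs a - cabs b) * (cabs a + cabs b) by ring.
  by rewrite expr2 ler_pM2r.
have -> : (6 * (cabs a + cabs b) * r / (2 ^+ k * M)) ^+ 2 =
  (cabs a + cabs b) ^+ 2 * (36 * r ^+ 2 / (2 ^+ k * M) ^+ 2).
  by field; rewrite !gt_eqF ?exprn_gt0.
(* The power 2^18 compensates 8^2 * 16 from the area and 4 from the spare level, leaving 64, which
   exceeds the 36 of the oscillation estimate. *)
have -> : 2 ^+ 18 * K * ((cabs a ^+ 2 - cabs b ^+ 2) * (r / 8) ^+ 2 / 16) / (2 ^+ k.+1 * M) ^+ 2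
  = K * (cabs a ^+ 2 - cabs b ^+ 2) * (64 * r ^+ 2 / (2 ^+ k * M) ^+ 2).
  by rewrite (exprS 2 k); field; rewrite !gt_eqF ?exprn_gt0.
have q0 : 0 <= r ^+ 2 / (2 ^+ k * M) ^+ 2 by rewrite divr_ge0 ?sqr_ge0.
apply: ler_pM => //; rewrite ?sqr_ge0//.
  by rewrite -mulrA mulr_ge0.
by rewrite -!mulrA; lra.
Qed.

End cells.

(** * Summation over the grid *)

Section packing.
Context {R : realType}.
Implicit Types (g : R[i] -> R[i]) (z w : R[i]).

(** By injectivity of [g] the sets attached to different cells are disjoint. Those of level k lie in
    a square of area 4 (2^k M)^2, so each of the [N.+1] levels contributes at most 4 C. *)
Lemma cells_sum (I : finType) (D : pred I) (z : I -> R[i]) (r : I -> R)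
    g (M del C : R) N (U : set R[i]) : 0 < M -> 0 <= C -> set_inj U g ->
  (forall i, D i -> cell g M del C N (z i) (r i)) ->
  (forall i w, D i -> cabs (w - z i) <= r i / 8 -> U w) ->
  (forall i j w, D i -> D j -> cabs (w - z i) <= r i / 8 ->
     cabs (w - z j) <= r j / 8 -> i = j) ->
  exists2 a : I -> R,
    forall i, D i -> 0 <= a i /\ forall w, cabs (w - z i) <= r i ->
      `|ln (clamp M del (g w)) - ln (clamp M del (g (z i)))| <= a i &
    \sum_(i | D i) a i ^+ 2 <= 4 * C * N.+1%:R.
Proof.
move=> M0 C0 ginj hcell hU hdisj.
have /choice[X hX] : forall i, exists X : set (measurableTypeR R * measurableTypeR R) * nat * R,
  D i -> [/\ measurable X.1.1 /\ area X.1.1 = X.2%:E, X.1.1 `<=` box (2 ^+ X.1.2 * M), (X.1.2 <= N)%N,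
      forall p, X.1.1 p -> exists2 w, cabs (w - z i) <= r i / 8 & g w = of_xy p &
      forall w, cabs (w - z i) <= r i ->
        (ln (clamp M del (g w)) - ln (clamp M del (g (z i)))) ^+ 2
          <= C * X.2 / (2 ^+ X.1.2 * M) ^+ 2].
  move=> i; case: (boolP (D i)) => [Di|nDi]; last by exists (set0, 0%N, 0).
  by have [P [k [A h]]] := hcell i Di; exists (P, k, A).
have A0 i : D i -> 0 <= (X i).2.
  move=> /hX[[_ E] _ _ _ _]; rewrite -lee_fin -E; exact: measure_ge0.
have kM0 k : 0 < 2 ^+ k * M by rewrite mulr_gt0// exprn_gt0.
pose t i := C * (X i).2 / (2 ^+ (X i).1.2 * M) ^+ 2.
have t0 i : D i -> 0 <= t i.
  by move=> Di; rewrite divr_ge0 ?sqr_ge0// mulr_ge0// A0.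
exists (fun i => Num.sqrt (t i)).
  move=> i Di; split; first exact: sqrtr_ge0.
  move=> w wr; rewrite -sqrtr_sqr ler_sqrt ?t0//.
  by have [_ _ _ _] := hX _ Di; apply.
rewrite (eq_bigr t); last by move=> i Di; rewrite sqr_sqrtr ?t0.
rewrite (partition_big (fun i => inord (X i).1.2 : 'I_N.+1) xpredT)//=.
rewrite mulr_natr -[X in _ *+ X]card_ord -sumr_const; apply: ler_sum => k _.
have kE i : D i && (inord (X i).1.2 == k) -> (X i).1.2 = k.
  by move=> /andP[/hX[_ _ kN _ _] /eqP <-]; rewrite inordK.
rewrite (eq_bigr (fun i => C / (2 ^+ k * M) ^+ 2 * (X i).2)); last first.
  by move=> i /kE E; rewrite /t E mulrAC.
rewrite -mulr_sumr.
have -> : 4 * C = C / (2 ^+ k * M) ^+ 2 * (4 * (2 ^+ k * M) ^+ 2).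
  by field; rewrite !gt_eqF ?exprn_gt0.
apply: ler_wpM2l; first by rewrite divr_ge0 ?sqr_ge0.
apply: (@sum_area_le R I _ (fun i => (X i).1.1)).
- exact/ltW.
- by move=> i /andP[/hX[[]]].
- by move=> i /andP[/hX[[]]].
- by move=> i Dk; rewrite -(kE _ Dk); move: Dk => /andP[/hX[]].
move=> i j /andP[Di _] /andP[Dj _] ij; apply/seteqP; split => // p [Pi Pj].
have [_ _ _ hi _] := hX _ Di; have [_ _ _ hj _] := hX _ Dj.
have [w wi gw] := hi _ Pi; have [w' wj gw'] := hj _ Pj.
have ww : w = w'.
  by apply: ginj; rewrite ?inE; [exact: hU wi|exact: hU wj|rewrite gw].
rewrite -ww in wj; by move: ij; rewrite (hdisj i j w)// eqxx.
Qed.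

(** Cauchy-Schwarz, from the double sum of (x_i - x_j)^2. *)
Lemma sqr_sum_le (I : finType) (x : I -> R) :
  (\sum_i x i) ^+ 2 <= #|I|%:R * \sum_i x i ^+ 2.
Proof.
have h : 0 <= \sum_i \sum_j (x i - x j) ^+ 2.
  by apply: sumr_ge0 => i _; apply: sumr_ge0 => j _; exact: sqr_ge0.
have E : \sum_i \sum_j (x i - x j) ^+ 2 =
    2 * (#|I|%:R * \sum_i x i ^+ 2 - (\sum_i x i) ^+ 2).
  pose T := \sum_i x i; pose S := \sum_i x i ^+ 2.
  transitivity (\sum_i (#|I|%:R * x i ^+ 2 + (S - 2 * T * x i))).
    apply: eq_bigr => i _; rewrite /S /T !mulr_sumr mulr_suml -sumrB.
    rewrite mulr_natl -sumr_const -big_split /=.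
    by apply: eq_bigr => j _; ring.
  rewrite big_split /= sumrB -!mulr_sumr sumr_const -[S *+ _]mulr_natl -/S -/T.
  by rewrite (_ : #|xpredT| = #|I|)//; ring.
by move: h; rewrite E pmulr_rge0// subr_ge0.
Qed.

(** First indices are circles, second ones rays; [a] and [b] belong to the two sides of the axis.
    The assumed bound is averaged over [l0] rays and [m] circles, and Cauchy-Schwarz is applied to
    the radial part [X] and to the circular part [Y] separately. *)
Lemma grid_sum (n L l0 m n0 : nat) (a b : nat -> nat -> R) (Lam Q : R) :
  (0 < l0)%N -> (0 < m)%N -> (l0 <= L)%N -> (n0 + m <= n)%N -> 0 <= Lam ->
  (forall k l, (k < n)%N -> (l < L)%N -> 0 <= a k l) ->
  (forall k l, (k < n)%N -> (l < L)%N -> 0 <= b k l) ->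
  (forall k l, (n0 <= k < n0 + m)%N -> (l < l0)%N ->
     Lam <= \sum_(i < n) a i l + 2 * \sum_(j < L) (a k j + b k j)) ->
  \sum_(i : 'I_n * 'I_L) a i.1 i.2 ^+ 2 <= Q ->
  \sum_(i : 'I_n * 'I_L) b i.1 i.2 ^+ 2 <= Q ->
  Lam ^+ 2 <= 2 * Q * (n%:R / l0%:R + 16 * L%:R / m%:R).
Proof.
move=> l00 m0 lL nm Lam0 a0 b0 hLam aQ bQ.
have l0p : 0 < l0%:R :> R by rewrite ltr0n.
have mp : 0 < m%:R :> R by rewrite ltr0n.
have kn (k : 'I_m) : (n0 + k < n)%N by apply: leq_trans nm; rewrite ltn_add2l.
have lL' (l : 'I_l0) : (l < L)%N by exact: leq_trans lL.
pose X := \sum_(l < l0) \sum_(i < n) a i l.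
pose Y := \sum_(k < m) \sum_(j < L) (a (n0 + k)%N j + b (n0 + k)%N j).
have I1 : l0%:R * m%:R * Lam <= m%:R * X + 2 * (l0%:R * Y).
  have -> : l0%:R * m%:R * Lam = \sum_(l < l0) \sum_(k < m) Lam.
    rewrite sumr_const card_ord sumr_const card_ord -[Lam *+ m]mulr_natl.
    by rewrite -[RHS]mulr_natl mulrA.
  have -> : m%:R * X + 2 * (l0%:R * Y) = \sum_(l < l0) \sum_(k < m)
      (\sum_(i < n) a i l + 2 * \sum_(j < L) (a (n0 + k)%N j + b (n0 + k)%N j)).
    transitivity (\sum_(l < l0) (m%:R * \sum_(i < n) a i l + 2 * Y)).
      rewrite big_split /= -mulr_sumr sumr_const card_ord /X.
      by rewrite (_ : (2 * Y) *+ l0 = l0%:R * (2 * Y)); [ring|rewrite [RHS]mulr_natl].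
    apply: eq_bigr => l _; rewrite big_split /= -mulr_sumr sumr_const card_ord.
    by rewrite mulr_natl.
  apply: ler_sum => l _; apply: ler_sum => k _; apply: hLam => //.
  by rewrite leq_addr ltn_add2l ltn_ord.
have X2 : X ^+ 2 <= n%:R * l0%:R * Q.
  rewrite /X pair_big /=; apply: le_trans (sqr_sum_le _) _.
  rewrite card_prod !card_ord natrM [n%:R * _]mulrC ler_wpM2l ?mulr_ge0 ?ler0n//.
  apply: le_trans aQ.
  rewrite -(pair_big xpredT xpredT (fun (l : 'I_l0) (i : 'I_n) => a i l ^+ 2)) /=.
  rewrite -(pair_big xpredT xpredT (fun (i : 'I_n) (l : 'I_L) => a i l ^+ 2)) /=.
  rewrite exchange_big /=; apply: ler_sum => i _.
  rewrite (big_ord_widen L (fun l => a i l ^+ 2) lL) big_mkcond /=.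
  by apply: ler_sum => l _; case: ifP => // _; exact: sqr_ge0.
have row (c : nat -> nat -> R) : \sum_(i : 'I_n * 'I_L) c i.1 i.2 ^+ 2 <= Q ->
    (\sum_(k < m) \sum_(j < L) c (n0 + k)%N j) ^+ 2 <= m%:R * L%:R * Q.
  move=> cQ; rewrite pair_big /=; apply: le_trans (sqr_sum_le _) _.
  rewrite card_prod !card_ord natrM ler_wpM2l ?mulr_ge0 ?ler0n//.
  apply: le_trans cQ.
  rewrite -(pair_big xpredT xpredT (fun (i : 'I_m) (l : 'I_L) => c (n0 + i)%N l ^+ 2)) /=.
  rewrite -(pair_big xpredT xpredT (fun (i : 'I_n) (l : 'I_L) => c i l ^+ 2)) /=.
  pose F k := \sum_(l < L) c k l ^+ 2.
  have F0 k : 0 <= F k by apply: sumr_ge0 => l _; exact: sqr_ge0.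
  have -> : \sum_(k < m) F (n0 + k)%N = \sum_(n0 <= i < n0 + m) F i.
    rewrite -{2}[n0]add0n big_addn addKn big_mkord.
    by apply: eq_bigr => k _; rewrite addnC.
  rewrite -(big_mkord xpredT F).
  rewrite (big_cat_nat (leq0n _) nm) /= (big_cat_nat (leq0n _) (leq_addr m n0)) /=.
  have ? : 0 <= \sum_(0 <= i < n0) F i by apply: sumr_ge0.
  have ? : 0 <= \sum_(n0 + m <= i < n) F i by apply: sumr_ge0.
  lra.
have Ya := row a aQ; have Yb := row b bQ.
set A := \sum_(k < m) _ in Ya; set B := \sum_(k < m) _ in Yb.
have YE : Y = A + B.
  by rewrite /Y /A /B -big_split /=; apply: eq_bigr => k _; rewrite big_split.
have Y2 : Y ^+ 2 <= 4 * (m%:R * L%:R * Q).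
  by rewrite YE; have := sqr_ge0 (A - B); nra.
have X0 : 0 <= X.
  by apply: sumr_ge0 => l _; apply: sumr_ge0 => i _; apply: a0.
have Y0 : 0 <= Y.
  by apply: sumr_ge0 => k _; apply: sumr_ge0 => j _; rewrite addr_ge0 ?a0 ?b0.
have I2 : Lam <= X / l0%:R + 2 * (Y / m%:R).
  rewrite -(ler_pM2l (mulr_gt0 l0p mp)); apply: le_trans I1 _.
  rewrite le_eqVlt; apply/orP; left; apply/eqP; field.
  by rewrite !gt_eqF.
set x := X / _ in I2; set y := Y / _ in I2.
have x2 : x ^+ 2 <= n%:R * Q / l0%:R.
  rewrite /x expr_div_n ler_pdivrMr ?exprn_gt0//.
  by apply: le_trans X2 _; rewrite le_eqVlt; apply/orP; left; apply/eqP; field; rewrite gt_eqF.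
have y2 : y ^+ 2 <= 4 * (L%:R * Q) / m%:R.
  rewrite /y expr_div_n ler_pdivrMr ?exprn_gt0//.
  by apply: le_trans Y2 _; rewrite le_eqVlt; apply/orP; left; apply/eqP; field; rewrite gt_eqF.
have x0 : 0 <= x by rewrite divr_ge0// ltW.
have y0 : 0 <= y by rewrite divr_ge0// ltW.
have h : Lam ^+ 2 <= (x + 2 * y) ^+ 2.
  by rewrite lerXn2r ?nnegrE// addr_ge0// mulr_ge0.
apply: le_trans h _.
(* The square is split by (x + 2y)^2 <= 2 x^2 + 8 y^2. *)
have -> : 2 * Q * (n%:R / l0%:R + 16 * L%:R / m%:R) =
  2 * (n%:R * Q / l0%:R) + 8 * (4 * (L%:R * Q) / m%:R) by field; rewrite !gt_eqF.
have := sqr_ge0 (x - 2 * y); lra.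
Qed.

End packing.

(** * The length-area estimate *)

Section polar_grid.
Context {R : realType}.
Implicit Types (z w u : R[i]) (s x y : R).

Lemma cos_sign (sg x : R) : sg = 1 \/ sg = -1 -> cos (sg * x) = cos x.
Proof. by case=> ->; rewrite ?mul1r// mulN1r cosN. Qed.

(** The angle is given as a sign and a value in [0, pi] because each half-circle carries its own
    grid. *)
Lemma polar_form w : exists sg x : R, [/\ sg = 1 \/ sg = -1, 0 <= x <= pi &
  w = (cabs w)%:C * cis (sg * x)].
Proof.
have [->|w0] := eqVneq w 0.
  exists 1, 0; split; [by left|by rewrite lexx pi_ge0|by rewrite cabs0 mul0r].
have s0 : 0 < cabs w by rewrite cabs_gt0.
set s := cabs w in s0 *.
have c1 : -1 <= complex.Re w / s <= 1.
  by rewrite -ler_norml normrM normfV (gtr0_norm s0) ler_pdivrMr// mul1r Re_le_cabs.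
have x0 := acos_ge0 c1; have xpi := acos_lepi c1.
have cx : cos (acos (complex.Re w / s)) = complex.Re w / s by rewrite acosK// in_itv.
set x := acos _ in x0 xpi cx.
have sx : s * sin x = `|complex.Im w|.
  apply/eqP; rewrite -(@eqrXn2 _ 2)// ?mulr_ge0 ?(ltW s0)//; last first.
    by rewrite sin_ge0_pi// x0.
  rewrite real_normK ?num_real// exprMn sin2cos2 cx.
  have := cabsE w; rewrite -/s => E; apply/eqP.
  have -> : complex.Im w ^+ 2 = s ^+ 2 - complex.Re w ^+ 2 by rewrite E; ring.
  by field; rewrite gt_eqF.
exists (if 0 <= complex.Im w then 1 else -1), x; split.
- by case: ifP; [left|right].
- by rewrite x0.
apply/eqP; rewrite eq_complex; apply/andP; split; apply/eqP.
  case: ifP => _; rewrite ?mul1r ?mulN1r /= ?cosN cx;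
  by rewrite mul0r subr0 mulrC divfK// gt_eqF.
case: ifP => [h|/negbT h]; rewrite /= ?mul1r ?mulN1r ?sinN ?mulrN mul0r addr0 sx.
  by rewrite ger0_norm.
by rewrite ltr0_norm ?opprK// ltNge.
Qed.

(** Radii in geometric progression: radial and angular steps are both at most [eta] times the
    radius, so cells keep their shape at every scale and the number of circles is logarithmic in the
    ratio of radii. *)
Definition radius (S eta : R) (k : nat) : R := S * expR (- (k%:R * eta)).

(** Polar coordinates about [u * P%:C], with the angle measured from the direction of the origin;
    [sg] selects the side of the axis. *)
Definition gridpt u (P S eta sg : R) (k l : nat) : R[i] :=
  u * (P%:C - (radius S eta k)%:C * cis (sg * (l%:R * eta))).

Context (u : R[i]) (P S eta sg : R) (u1 : cabs u = 1) (S0 : 0 < S) (eta01 : 0 < eta <= 1)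
  (sgE : sg = 1 \/ sg = -1).
Local Notation rad := (radius S eta).
Local Notation pt := (gridpt u P S eta sg).

Let eta0 : 0 < eta. Proof. by case/andP: eta01. Qed.

Lemma rad_gt0 k : 0 < rad k.
Proof. by rewrite mulr_gt0// expR_gt0. Qed.

Lemma rad_le k : rad k <= S.
Proof.
rewrite ler_piMr ?(ltW S0)// -expR0 ler_expR oppr_le0.
by rewrite mulr_ge0// ltW.
Qed.

Lemma radS k : rad k.+1 = rad k * expR (- eta).
Proof.
by rewrite /radius -mulrA -expRD; congr (_ * expR _); rewrite -natr1; ring.
Qed.

Lemma rad_step k : 0 <= rad k - rad k.+1 <= eta * rad k.
Proof.
have r0 := rad_gt0 k; have := expR_ge1Dx (- eta).
have e1 : expR (- eta) <= 1 by rewrite -expR0 ler_expR oppr_le0 ltW.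
rewrite radS; set e := expR _ in e1 * => e2; apply/andP; split; nra.
Qed.

Lemma rad_gap k k' : (k < k')%N -> rad k' <= rad k * (1 - eta / 2).
Proof.
move=> kk'; have r0 := rad_gt0 k.
have h1 : rad k' <= rad k.+1.
  rewrite ler_pM2l// ler_expR lerN2 ler_pM2r//.
  by rewrite ler_nat.
apply: le_trans h1 _; rewrite radS ler_pM2l// expRN.
have e1 := expR_ge1Dx eta; have p1 : 0 < 1 + eta by rewrite addr_gt0.
apply: (@le_trans _ _ (1 + eta)^-1); first by rewrite lef_pV2 ?posrE// expR_gt0.
rewrite -div1r ler_pdivrMr//; case/andP: eta01 => _ e3.
have : 0 <= eta * (1 - eta) by rewrite mulr_ge0 ?subr_ge0// ltW.
have -> : (1 - eta / 2) * (1 + eta) = 1 + eta * (1 - eta) / 2 by field.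
lra.
Qed.

Lemma polar_norm s x :
  cabs (u * (P%:C - s%:C * cis (sg * x))) ^+ 2 = P ^+ 2 - 2 * P * s * cos x + s ^+ 2.
Proof.
rewrite cabsM u1 mul1r cabsE -(cos_sign x sgE) /=.
have := cos2Dsin2 (sg * x).
set c := cos _; set d := sin _ => E.
have -> : s ^+ 2 = s ^+ 2 * (c ^+ 2 + d ^+ 2) by rewrite E mulr1.
by ring.
Qed.

Lemma gridpt_center k l : cabs (pt k l - u * P%:C) = rad k.
Proof.
have -> : pt k l - u * P%:C = - (u * (rad k)%:C * cis (sg * (l%:R * eta))).
  by rewrite /gridpt; ring.
by rewrite cabsN !cabsM u1 cabs_cis cabs_real mul1r mulr1 gtr0_norm// rad_gt0.
Qed.

Lemma gridpt_chord k l l' : cabs (pt k l - pt k l') =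
  rad k * (2 * `|sin ((l%:R - l'%:R) * eta / 2)|).
Proof.
have -> : pt k l - pt k l' =
    - u * (rad k)%:C * (cis (sg * (l%:R * eta)) - cis (sg * (l'%:R * eta))).
  by rewrite /gridpt; ring.
rewrite !cabsM cabsN u1 mul1r cabs_real gtr0_norm ?rad_gt0//.
rewrite cis_chord; congr (_ * (_ * _)).
have -> : (sg * (l%:R * eta) - sg * (l'%:R * eta)) / 2 = sg * ((l%:R - l'%:R) * eta / 2) by ring.
by case: sgE => ->; rewrite ?mul1r// mulN1r sinN normrN.
Qed.

Lemma gridpt_stepl k l : cabs (pt k l.+1 - pt k l) <= eta * rad k.
Proof.
rewrite gridpt_chord mulrC ler_pM2r ?rad_gt0//.
have -> : (l.+1%:R - l%:R) * eta / 2 = eta / 2 by rewrite -natr1; ring.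
have := norm_sin_le (eta / 2); rewrite (gtr0_norm (divr_gt0 eta0 _))//; lra.
Qed.

Lemma gridpt_stepk k l : cabs (pt k.+1 l - pt k l) <= eta * rad k.
Proof.
have -> : pt k.+1 l - pt k l = u * (rad k - rad k.+1)%:C * cis (sg * (l%:R * eta)).
  by rewrite /gridpt (rmorphB (real_complex R)); ring.
rewrite !cabsM u1 mul1r cabs_cis mulr1 cabs_real.
by have /andP[h1 h2] := rad_step k; rewrite ger0_norm.
Qed.

Lemma cos_mono x y : 0 <= x -> x <= y -> y <= pi -> cos y <= cos x.
Proof.
move=> x0; rewrite le_eqVlt => /predU1P[->//|xy] ypi.
by apply: ltW; rewrite ltr_cos// in_itv /=; apply/andP; split; lra.
Qed.

Lemma sin_mono x y : 0 <= x -> x <= y -> y <= pi / 2 -> sin x <= sin y.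
Proof.
move=> x0; rewrite le_eqVlt => /predU1P[->//|xy] ypi.
have pi0 := @pi_gt0 R.
by apply: ltW; rewrite ltr_sin// in_itv /=; apply/andP; split; lra.
Qed.

(** Distinct grid points are at least eta/2 times the larger radius apart: on different circles by
    [rad_gap], on one circle by the chord formula, where angles up to pi keep the half-difference in
    the range where sine increases. The two small discs account for at most half of that
    distance. *)
Lemma gridpt_disjoint k l k' l' w :
  l%:R * eta <= pi -> l'%:R * eta <= pi ->
  cabs (w - pt k l) <= eta * rad k / 8 ->
  cabs (w - pt k' l') <= eta * rad k' / 8 -> (k, l) = (k', l').
Proof.
wlog kk' : k l k' l' / (k <= k')%N.
  move=> h l1 l2 h1 h2; have /orP[kk'|kk'] := leq_total k k'.
    exact: h.
  by apply/esym; exact: h.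
move=> lpi l'pi h1 h2.
have h3 : cabs (pt k l - pt k' l') <= eta * rad k / 8 + eta * rad k' / 8.
  apply: le_trans (cabs_triangle _ _ w) _; apply: lerD => //.
  by rewrite cabsBC.
have r0 := rad_gt0 k; have r0' := rad_gt0 k'.
move: kk'; rewrite leq_eqVlt => /predU1P[kk'|kk']; last first.
  exfalso; have gap := rad_gap kk'.
  have := cabs_dist (pt k l - u * P%:C) (pt k' l' - u * P%:C).
  rewrite !gridpt_center.
  have -> : pt k l - u * P%:C - (pt k' l' - u * P%:C) = pt k l - pt k' l' by ring.
  move=> /(le_trans (ler_norm _)) h4; have h5 : 0 < eta * rad k by rewrite mulr_gt0.
  have h6 : eta * rad k' <= eta * rad k.
    rewrite ler_pM2l//; apply: le_trans gap _.
    by rewrite ler_piMr ?(ltW r0)// gerBl divr_ge0// ltW.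
  have h7 : rad k * (1 - eta / 2) = rad k - eta * rad k / 2 by field.
  lra.
subst k'; congr (_, _); apply/eqP; apply: contraT => ll'; exfalso.
wlog {ll'} ll' : l l' lpi l'pi h1 h2 h3 / (l < l')%N.
  move=> h; move: ll'; rewrite neq_ltn => /orP[ll'|ll'].
    exact: (h l l').
  by apply: (h l' l) => //; rewrite cabsBC.
move: h3; rewrite gridpt_chord.
have -> : (l%:R - l'%:R) * eta / 2 = - ((l'%:R - l%:R) * eta / 2) by ring.
rewrite sinN normrN.
have d1 : eta / 2 <= (l'%:R - l%:R) * eta / 2.
  rewrite ler_pM2r// ler_peMl ?(ltW eta0)//.
  by rewrite lerBrDr -[1]/(1%:R) -natrD ler_nat add1n.
have d2 : (l'%:R - l%:R) * eta / 2 <= pi / 2.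
  rewrite ler_pM2r//; apply: le_trans l'pi; rewrite ler_pM2r// gerBl//.
have e2 : 0 <= eta / 2 by rewrite divr_ge0// ltW.
have s1 : eta / 4 <= sin (eta / 2).
  have h4 : eta / 2 / 2 <= sin (eta / 2).
    apply: sin_ge; apply/andP; split => //; case/andP: eta01 => _ h.
    by rewrite ler_pdivrMr//; apply: le_trans h _; rewrite mul1r ler1n.
  lra.
have s2 := sin_mono e2 d1 d2.
rewrite ger0_norm; last lra.
have : 0 < eta * rad k by rewrite mulr_gt0.
have : rad k * (2 * (eta / 4)) <= rad k * (2 * sin ((l'%:R - l%:R) * eta / 2)).
  by rewrite ler_pM2l//; lra.
lra.
Qed.

End polar_grid.

Section length_area.
Context {R : realType}.
Implicit Types (g : R[i] -> R[i]) (z w u : R[i]) (s x y : R).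

(** [cells_sum] on the grid points of the closed disc of radius [r]. The mesh is below [rho] so that
    cells exist, and below [1 - r] so that their small discs stay in the unit disc. *)
Lemma grid_osc g (M del C : R) N (r rho eta P S sg : R) u n L :
  cabs u = 1 -> 0 < S <= 1 -> 0 < eta <= 1 -> eta < rho -> eta < 1 - r ->
  sg = 1 \/ sg = -1 -> 0 < M -> 0 <= C -> set_inj (disk 1) g ->
  (forall z e, cabs z <= r -> 0 < e -> e < rho -> cell g M del C N z e) ->
  (forall l, (l < L)%N -> l%:R * eta <= pi) ->
  let pt := gridpt u P S eta sg in
  exists a : nat -> nat -> R, [/\ forall k l, 0 <= a k l,
    forall k l, (k < n)%N -> (l < L)%N -> cabs (pt k l) <= r ->
      forall w, cabs (w - pt k l) <= eta * radius S eta k ->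
        `|ln (clamp M del (g w)) - ln (clamp M del (g (pt k l)))| <= a k l &
    \sum_(i : 'I_n * 'I_L) a i.1 i.2 ^+ 2 <= 4 * C * N.+1%:R].
Proof.
move=> u1 /andP[S0 S1] eta01 erho er sgE M0 C0 ginj hcell hL pt.
have /andP[eta0 eta1] := eta01.
have re0 k : 0 < eta * radius S eta k by rewrite mulr_gt0// rad_gt0.
have re1 k : eta * radius S eta k <= eta.
  by rewrite ler_piMr ?(ltW eta0)//; apply: le_trans S1; exact: rad_le.
pose D := [pred i : 'I_n * 'I_L | cabs (pt i.1 i.2) <= r].
have [|||a ha asum] := @cells_sum R _ D (fun i => pt i.1 i.2)
    (fun i => eta * radius S eta i.1) g M del C N (disk 1) M0 C0 ginj.
- move=> i Di; apply: hcell => //; exact: le_lt_trans (re1 _) erho.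
- move=> i w /= Di hw; rewrite /disk /=.
  have := le_cabs_add hw; have := re1 i.1; have := re0 i.1; move: Di; lra.
- move=> [k l] [k' l'] w _ _ h1 h2.
  have [] := gridpt_disjoint u1 S0 eta01 sgE (hL l (ltn_ord l)) (hL l' (ltn_ord l')) h1 h2.
  by move=> /ord_inj -> /ord_inj ->.
(* The bounds are extended by 0 to all indices, and to grid points outside the disc, so that later
   sums may range over full rows and columns. *)
- pose b k l : R := if insub k is Some i then if insub l is Some j then
    if D (i, j) then a (i, j) else 0 else 0 else 0.
  have bE (i : 'I_n) (j : 'I_L) : b i j = if D (i, j) then a (i, j) else 0.
    by rewrite /b !valK.
  exists b; split.
  + move=> k l; rewrite /b; case: insub => // i; case: insub => // j.
    by case: ifP => // /ha[].
  + move=> k l kn lL ptr w hw; rewrite -[k]/(val (Ordinal kn)) -[l in b _ l]/(val (Ordinal lL)) bE.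
    by rewrite /D /= ptr; have [_] := ha (Ordinal kn, Ordinal lL) ptr; apply.
  + apply: le_trans asum; rewrite [leRHS]big_mkcond /=; apply: ler_sum => -[i j] _ /=.
    by rewrite bE /D /=; case: ifP => // _; rewrite expr0n.
Qed.

Lemma connected_sphere (C : set R[i]) p q s : connected C -> C p -> C q ->
  0 <= s -> s <= cabs (q - p) -> exists2 w, C w & cabs (w - p) = s.
Proof.
move=> cC Cp Cq s0 sq.
have cI : connected ((fun w => cabs (w - p)) @` C).
  apply: connected_continuous_connected cC _.
  by apply: continuous_subspaceT; exact: cabsB_continuous.
have /connected_intervalP iI := cI.
have h0 : ((fun w => cabs (w - p)) @` C) 0 by exists p; rewrite // subrr cabs0.
have h1 : ((fun w => cabs (w - p)) @` C) (cabs (q - p)) by exists q.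
have [|w Cw <-] := iI _ _ h0 h1 s; first by rewrite s0.
by exists w.
Qed.

Section paths.
Context (g : R[i] -> R[i]) (M del r eta P S sg : R) (u : R[i]) (n L : nat).
Context (a : nat -> nat -> R).
Local Notation pt := (gridpt u P S eta sg).
Local Notation v z := (ln (clamp M del (g z))).
Context (u1 : cabs u = 1) (S0 : 0 < S) (eta01 : 0 < eta <= 1)
  (sgE : sg = 1 \/ sg = -1) (a0 : forall k l, 0 <= a k l)
  (ha : forall k l, (k < n)%N -> (l < L)%N -> cabs (pt k l) <= r ->
      forall w, cabs (w - pt k l) <= eta * radius S eta k ->
        `|v w - v (pt k l)| <= a k l).

Lemma sum_widen_le (f : nat -> R) i j : (i <= j)%N -> (forall k, 0 <= f k) ->
  \sum_(k < i) f k <= \sum_(k < j) f k.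
Proof.
move=> ij f0; rewrite (big_ord_widen j f ij) big_mkcond /=.
by apply: ler_sum => k _; case: ifP.
Qed.

Lemma ray_osc k l : (k < n)%N -> (l < L)%N ->
  (forall k', (k' <= k)%N -> cabs (pt k' l) <= r) ->
  `|v (pt k l) - v (pt 0 l)| <= \sum_(i < k) a i l.
Proof.
elim: k => [|k IH] kn lL hr; first by rewrite subrr normr0 big_ord0.
rewrite big_ord_recr [X in _ <= X]/=.
have -> : v (pt k.+1 l) - v (pt 0 l) = (v (pt k l) - v (pt 0 l)) + (v (pt k.+1 l) - v (pt k l)) by ring.
apply: le_trans (ler_normD _ _) _; apply: lerD.
  by apply: IH => // [|k' k'k]; [exact: ltnW|apply: hr; exact: leqW].
by apply: ha => //; [exact: ltnW|exact: hr|exact: gridpt_stepk].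
Qed.

Lemma row_osc k l : (k < n)%N -> (l < L)%N ->
  (forall l', (l' <= l)%N -> cabs (pt k l') <= r) ->
  `|v (pt k l) - v (pt k 0)| <= \sum_(j < l) a k j.
Proof.
move=> kn; elim: l => [|l IH] lL hr; first by rewrite subrr normr0 big_ord0.
rewrite big_ord_recr [X in _ <= X]/=.
have -> : v (pt k l.+1) - v (pt k 0) = (v (pt k l) - v (pt k 0)) + (v (pt k l.+1) - v (pt k l)) by ring.
apply: le_trans (ler_normD _ _) _; apply: lerD.
  by apply: IH => // [|l' l'l]; [exact: ltnW|apply: hr; exact: leqW].
by apply: ha => //; [exact: ltnW|exact: hr|exact: gridpt_stepl].
Qed.

(* Walking along a row from the axis towards a point of the disk stays in it,
   since |P - s cis x| increases with x on [0, pi]. *)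
Lemma row_to_point k x : 0 <= P -> 0 <= r -> (k < n)%N -> 0 <= x <= pi ->
  (Num.truncn (x / eta) < L)%N ->
  cabs (u * (P%:C - (radius S eta k)%:C * cis (sg * x))) <= r ->
  `|v (u * (P%:C - (radius S eta k)%:C * cis (sg * x))) - v (pt k 0)|
    <= \sum_(j < L) a k j.
Proof.
move=> P0 r0 kn /andP[x0 xpi] lL.
set w := u * _ => wr; set l := Num.truncn _ in lL.
have /andP[eta0 eta1] := eta01; have s0 := rad_gt0 eta S0 k.
have /andP[lx xl] : l%:R <= x / eta < l.+1%:R.
  by apply: truncn_itv; rewrite divr_ge0// ltW.
rewrite ler_pdivlMr// in lx; rewrite ltr_pdivrMr// in xl.
have ptr l' : (l' <= l)%N -> cabs (pt k l') <= r.
  move=> l'l; apply: le_trans wr.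
  rewrite -(@ler_pXn2r _ 2)// ?nnegrE ?cabs_ge0// /w !polar_norm//.
  rewrite lerD2r lerD2l lerN2; apply: ler_wpM2l.
    by rewrite mulr_ge0 ?(ltW s0)// mulr_ge0.
  apply: cos_mono => //; first by rewrite mulr_ge0// ltW.
  by apply: le_trans lx; rewrite ler_pM2r// ler_nat.
have h1 := row_osc kn lL ptr.
have h2 : `|v w - v (pt k l)| <= a k l.
  apply: ha => //; first exact: ptr.
  have -> : w - pt k l = - u * (radius S eta k)%:C * (cis (sg * x) - cis (sg * (l%:R * eta))).
    by rewrite /w /gridpt; ring.
  rewrite !cabsM cabsN u1 mul1r cabs_real gtr0_norm// mulrC ler_pM2r//.
  apply: le_trans (cis_lip _ _) _; rewrite -mulrBr normrM.
  have -> : `|sg| = 1 by case: sgE => ->; rewrite ?normrN normr1.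
  rewrite mul1r ger0_norm ?subr_ge0// lerBlDr.
  by move: xl; rewrite -natr1 mulrDl mul1r addrC => /ltW.
have -> : v w - v (pt k 0) = (v (pt k l) - v (pt k 0)) + (v w - v (pt k l)) by ring.
apply: le_trans (ler_normD _ _) _; apply: le_trans (lerD h1 h2) _.
have := sum_widen_le lL (a0 k); rewrite big_ord_recr /=; exact.
Qed.

End paths.

End length_area.

Section core.
Context {R : realType}.
Implicit Types (g : R[i] -> R[i]) (z w u : R[i]).

(** [S] is the distance from [p] to the circle |z| = rho1, and circles about [p] of radius below
    [t1] meet [C] because [q] lies farther out. The number [th] limits both the opening of the fan
    and the half-width of the annulus where |g| >= del. *)
Lemma length_area g (C : set R[i]) p q (r K M del rho1 th S t1 : R) N :
  set_inj (disk 1) g -> 0 <= K -> 0 < M -> M <= del -> 0 <= r -> r < 1 ->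
  (exists2 rho : R, 0 < rho & forall z e, cabs z <= r -> 0 < e -> e < rho ->
     cell g M del (2 ^+ 18 * K) N z e) ->
  0 < th <= 1 -> 0 < rho1 ->
  (forall z, `|cabs z - rho1| <= th -> del <= cabs (g z)) ->
  connected C -> (forall w, C w -> cabs w <= r) -> (forall w, C w -> cabs (g w) <= M) ->
  C p -> C q -> p != q -> rho1 < cabs p ->
  S = cabs p - rho1 -> t1 = Num.min S (cabs (q - p)) / 2 ->
  (ln del - ln M) ^+ 2 <=
    2 * (4 * (2 ^+ 18 * K) * N.+1%:R) * (2 / th * (ln (S / t1) + 2) + 80).
Proof.
move=> ginj K0 M0 Md r0 r1 [rho rho0 hcell] /andP[th0 th1] rho10 hE cC Cr CM Cp Cq pq rp SE t1E.
have del0 : 0 < del by exact: lt_le_trans Md.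
have S0 : 0 < S by rewrite SE subr_gt0.
have qp0 : 0 < cabs (q - p) by rewrite cabs_gt0 subr_eq0 eq_sym.
have t10 : 0 < t1 by rewrite t1E divr_gt0// lt_min S0.
have P0 : 0 < cabs p by exact: lt_trans rp.
have S1 : S <= 1 by have := Cr _ Cp; rewrite SE; lra.
have t1S : t1 <= S / 2 by rewrite t1E ler_pM2r// ge_min lexx.
have t1q : t1 < cabs (q - p).
  apply: (@le_lt_trans _ _ (cabs (q - p) / 2)); last by lra.
  by rewrite t1E ler_pM2r// ge_min lexx orbT.
pose u : R[i] := p / (cabs p)%:C.
have u1 : cabs u = 1 by rewrite cabsM cabsV cabs_real ger0_norm ?cabs_ge0// divff// gt_eqF.
have uP : u * (cabs p)%:C = p.
  by rewrite divfK// -cabs_eq0 cabs_real normr_eq0 gt_eqF.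
(* The mesh 1/m falls below [rho] and [1 - r], and th m > 2 leaves at least one ray in the fan. *)
pose m := (Num.truncn (rho^-1 + (1 - r)^-1 + 2 / th)).+1.
have mlt : rho^-1 + (1 - r)^-1 + 2 / th < m%:R by exact: truncnS_gt.
have [i1 i2 i3] : [/\ 0 < rho^-1, 0 < (1 - r)^-1 & 0 < 2 / th].
  by rewrite !invr_gt0 subr_gt0 divr_gt0.
have m0 : 0 < m%:R :> R by rewrite ltr0n.
pose eta : R := m%:R^-1.
have eta0 : 0 < eta by rewrite invr_gt0.
have eta1 : 0 < eta <= 1 by rewrite eta0 invf_le1// ler1n.
have erho : eta < rho by rewrite -[rho]invrK ltf_pV2 ?posrE//; lra.
have er : eta < 1 - r by rewrite -[1 - r]invrK ltf_pV2 ?posrE//; lra.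
have Veta x : x / eta = x * m%:R by rewrite /eta invrK.
pose L := (Num.truncn (pi / eta)).+1.
pose l0 := Num.truncn (th * m%:R).
have thm : 2 < th * m%:R by rewrite mulrC -ltr_pdivrMr//; lra.
have pi2 := @pi_ge2 R; have pih := @pihalf_lt2 R.
have /andP[l0le l0gt] : l0%:R <= th * m%:R < l0.+1%:R.
  by apply: truncn_itv; lra.
have l0half : th * m%:R / 2 <= l0%:R by move: l0gt; rewrite -natr1; lra.
have l0pos : (0 < l0)%N by rewrite -(ltr_nat R); lra.
have hL l : (l < L)%N -> l%:R * eta <= pi.
  rewrite ltnS truncn_ge_nat ?divr_ge0 ?pi_ge0 ?(ltW eta0)//.
  by rewrite ler_pdivlMr.
have Lle : L%:R <= 5 * m%:R :> R.
  have /andP[h _] : (Num.truncn (pi / eta))%:R <= (pi : R) / eta < L%:R.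
    by apply: truncn_itv; rewrite divr_ge0 ?pi_ge0 ?(ltW eta0).
  have h2 : (1 : R) <= m%:R by rewrite ler1n.
  have h3 : (pi : R) / eta <= 4 * m%:R by rewrite Veta ler_pM2r//; lra.
  by rewrite /L -natr1; lra.
have l0L : (l0 <= L)%N.
  apply: leqW; rewrite truncn_ge_nat ?divr_ge0 ?pi_ge0 ?(ltW eta0)// Veta.
  by apply: le_trans l0le _; rewrite ler_pM2r//; lra.
have lnS : 0 <= ln (S / t1) by apply: ln_ge0; rewrite ler_pdivlMr// mul1r; lra.
(* Circles of index [n0] and beyond have radius below [t1]. The [m] circles from [n0] on span one
   unit of logarithmic scale, since m eta = 1. *)
pose n0 := (Num.truncn (ln (S / t1) * m%:R)).+1.
pose n := (n0 + m)%N.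
have nle : n%:R <= m%:R * (ln (S / t1) + 2) :> R.
  have /andP[h _] : (Num.truncn (ln (S / t1) * m%:R))%:R <= ln (S / t1) * m%:R < n0%:R.
    by apply: truncn_itv; rewrite mulr_ge0// ltW.
  have h2 : (1 : R) <= m%:R by rewrite ler1n.
  by rewrite /n natrD /n0 -natr1; lra.
have rad_row k : (n0 <= k)%N -> radius S eta k < t1.
  move=> n0k; rewrite /radius mulrC -ltr_pdivlMr// expRN invf_plt ?posrE ?expR_gt0 ?divr_gt0//.
  rewrite invf_div -[X in X < _]lnK ?posrE ?divr_gt0// ltr_expR.
  rewrite ltr_pdivlMr//; apply: (@lt_le_trans _ _ n0%:R); first exact: truncnS_gt.
  by rewrite ler_nat.
have sg1 : (1 : R) = 1 \/ (1 : R) = -1 by left.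
have sgN1 : (-1 : R) = 1 \/ (-1 : R) = -1 by right.
have S01 : 0 < S <= 1 by rewrite S0.
have C0 : 0 <= 2 ^+ 18 * K by rewrite mulr_ge0.
have [a [a0 ha asum]] := grid_osc (cabs p) n u1 S01 eta1 erho er sg1 M0 C0 ginj hcell hL.
have [b [b0 hb bsum]] := grid_osc (cabs p) n u1 S01 eta1 erho er sgN1 M0 C0 ginj hcell hL.
set Q := 4 * (2 ^+ 18 * K) * N.+1%:R in asum bsum *.
have Lam0 : 0 <= ln del - ln M by rewrite subr_ge0 ler_ln.
(* Rays of angle at most 1 have cosine at least 1/2; as s <= |p|, the law of cosines then bounds the
   modulus by |p|, so the fan stays in the disc. *)
have fan k l : (l < l0)%N -> cabs (gridpt u (cabs p) S eta 1 k l) <= r.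
  move=> ll0; apply: le_trans (Cr _ Cp).
  rewrite -(@ler_pXn2r _ 2)// ?nnegrE ?cabs_ge0// polar_norm//.
  have x0 : 0 <= l%:R * eta by rewrite mulr_ge0// ltW.
  have xth : l%:R * eta <= 1.
    apply: le_trans th1; rewrite /eta ler_pdivrMr//; apply: le_trans l0le.
    by rewrite ler_nat ltnW.
  have c2 : 1 / 2 <= cos (l%:R * eta).
    apply: le_trans (cos_ge _).
    have : (l%:R * eta) ^+ 2 <= 1 by rewrite exprn_ile1.
    lra.
  have s0 := rad_gt0 eta S0 k; have sS := rad_le S0 eta1 k.
  set s := radius _ _ _ in s0 sS *.
  have sP : s <= cabs p by apply: le_trans sS _; rewrite SE gerBl ltW.
  have h1 : s ^+ 2 <= cabs p * s by rewrite expr2 ler_pM2r.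
  have h2 : cabs p * s * (1 / 2) <= cabs p * s * cos (l%:R * eta).
    by rewrite ler_pM2l// mulr_gt0.
  have -> : 2 * cabs p * s * cos (l%:R * eta) = 2 * (cabs p * s * cos (l%:R * eta)) by ring.
  lra.
(* Row 0 has radius [S], so its point on the axis lies on the circle |z| = rho1; the points of the
   fan in this row are within [th] of it. *)
have start l : (l < l0)%N -> clamp M del (g (gridpt u (cabs p) S eta 1 0 l)) = del.
  move=> ll0; apply/min_idPl; rewrite le_max; apply/orP; right; apply: hE.
  have -> : rho1 = cabs (u * (cabs p - S)%:C).
    rewrite cabsM u1 mul1r cabs_real SE opprB addrC subrK.
    by rewrite gtr0_norm.
  apply: le_trans (cabs_dist _ _) _.
  have -> : gridpt u (cabs p) S eta 1 0 l - u * (cabs p - S)%:C =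
      - u * S%:C * (cis (l%:R * eta) - cis 0).
    rewrite /gridpt /radius mul0r oppr0 expR0 mulr1 mul1r cis0.
    by rewrite (rmorphB (real_complex R)); ring.
  rewrite !cabsM cabsN u1 mul1r cabs_real (gtr0_norm S0).
  apply: (@le_trans _ _ (1 * (l%:R * eta))).
    apply: ler_pM => //; [exact: ltW|exact: cabs_ge0|].
    apply: le_trans (cis_lip _ _) _.
    by rewrite subr0 ger0_norm// mulr_ge0// ltW.
  rewrite mul1r /eta ler_pdivrMr//; apply: le_trans l0le.
  by rewrite ler_nat ltnW.
have axis k : gridpt u (cabs p) S eta 1 k 0 = gridpt u (cabs p) S eta (-1) k 0.
  by rewrite /gridpt !mul0r !mulr0.
have rowE (c : nat -> nat -> R) k : (forall i j, 0 <= c i j) -> 0 <= \sum_(j < L) c k j.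
  by move=> c0; apply: sumr_ge0.
(* The path descends ray [l] to circle [k], returns along that circle to the axis, and goes on to a
   point of [C] on either side. The circle is traversed at most twice, whence the factor 2. *)
have key k l : (n0 <= k < n0 + m)%N -> (l < l0)%N ->
    ln del - ln M <= \sum_(i < n) a i l + 2 * \sum_(j < L) (a k j + b k j).
  move=> /andP[n0k kn] ll0.
  have lL : (l < L)%N by exact: leq_trans l0L.
  have h1 := ray_osc u1 S0 eta1 ha kn lL (fun k' _ => fan k' l ll0).
  have h1' := sum_widen_le (ltnW kn) (fun i => a0 i l).
  have h2 := row_osc u1 S0 eta1 sg1 ha kn lL
    (fun l' l'l => fan k l' (leq_ltn_trans l'l ll0)).
  have h2' := sum_widen_le (ltnW lL) (a0 k).
  have [w Cw wE] := connected_sphere cC Cp Cq (ltW (rad_gt0 eta S0 k))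
    (ltW (lt_trans (rad_row k n0k) t1q)).
  have [sg [x [sgE x0pi xE]]] := polar_form ((p - w) / u).
  have u0 : u != 0 by rewrite -cabs_gt0 u1.
  have wE2 : w = u * ((cabs p)%:C - (radius S eta k)%:C * cis (sg * x)).
    have E : cabs ((p - w) / u) = radius S eta k.
      by rewrite cabsM cabsV u1 invr1 mulr1 cabsBC wE.
    rewrite E in xE; rewrite -xE mulrBr uP mulrC divfK//; ring.
  have wM : clamp M del (g w) = M.
    by rewrite /clamp (max_idPl (CM _ Cw)) (min_idPr Md).
  have xL : (Num.truncn (x / eta) < L)%N.
    rewrite ltnS le_truncn// ler_pM2r ?invr_gt0//.
    by case/andP: x0pi.
  have wr : cabs (u * ((cabs p)%:C - (radius S eta k)%:C * cis (sg * x))) <= r.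
    by rewrite -wE2; exact: Cr.
  have h3 : `|ln M - ln (clamp M del (g (gridpt u (cabs p) S eta 1 k 0)))|
      <= \sum_(j < L) a k j + \sum_(j < L) b k j.
    have := rowE a k a0; have := rowE b k b0.
    case: sgE wr wE2 => -> wr wE2 B0 A0.
      have := row_to_point u1 S0 eta1 sg1 a0 ha (ltW P0) r0 kn x0pi xL wr.
      by rewrite -wE2 wM => h; apply: le_trans h _; rewrite lerDl.
    have := row_to_point u1 S0 eta1 sgN1 b0 hb (ltW P0) r0 kn x0pi xL wr.
    by rewrite -wE2 wM -axis => h; apply: le_trans h _; rewrite lerDr.
  rewrite start// in h1; rewrite big_split /=.
  have := rowE a k a0; have := rowE b k b0.
  move: h1 h2 h3; rewrite !ler_norml => /andP[? ?] /andP[? ?] /andP[? ?].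
  lra.
have := grid_sum l0pos (ltn0Sn _ : (0 < m)%N) l0L (leqnn n) Lam0
  (fun k l _ _ => a0 k l) (fun k l _ _ => b0 k l) key asum bsum.
move=> h; apply: le_trans h _.
apply: ler_wpM2l; first by rewrite mulr_ge0// mulr_ge0// mulr_ge0.
have l0R : 0 < l0%:R :> R by rewrite ltr0n.
apply: lerD.
  rewrite ler_pdivrMr//; apply: le_trans nle _.
  have -> : m%:R * (ln (S / t1) + 2) = 2 / th * (ln (S / t1) + 2) * (th * m%:R / 2).
    by field; rewrite gt_eqF.
  by rewrite ler_wpM2l// mulr_ge0 ?(ltW i3)// addr_ge0.
(* Here 80 is 16 * 5, from [Lle]. *)
by rewrite ler_pdivrMr//; lra.
Qed.

End core.

(** * The bound for a univalent mapping *)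

Section univalent.
Context {R : realType}.
Implicit Types (f g : R[i] -> R[i]) (z w u : R[i]) (C : set R[i]).

(** By injectivity [g] has at most one zero, so a closed annulus near the unit circle avoids it, and
    compactness gives a positive lower bound there. *)
Lemma annulus_lower_bound g : set_inj (disk 1) g ->
  (forall z, disk 1 z -> exists a b, sdiff g z a b) ->
  exists rho1 th del : R, [/\ 0 < th <= 1, 0 < rho1 < 1, 0 < del &
    forall z, `|cabs z - rho1| <= th -> del <= cabs (g z)].
Proof.
move=> ginj sg.
have [rho0 /andP[rho00 rho01] g0] : exists2 rho0 : R, 0 < rho0 < 1 &
    forall z, rho0 <= cabs z -> disk 1 z -> g z != 0.
  have [[z0 z01 gz0]|no] := pselect (exists2 z0, disk 1 z0 & g z0 = 0).
    exists ((1 + cabs z0) / 2).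
      by move: z01 (cabs_ge0 z0); rewrite /disk /= => ? ?; apply/andP; split; lra.
    move=> z hz z1; apply/eqP => gz.
    have E : z = z0 by apply: ginj; rewrite ?inE// gz gz0.
    by move: z01 hz; rewrite E /disk /=; lra.
  exists (1 / 2); first by apply/andP; split; lra.
  by move=> z _ z1; apply/eqP => gz; apply: no; exists z.
pose th : R := (1 - rho0) / 4.
have [|del del0 hdel] := @cdisk_uniform R 0 (1 - th)
    (fun z e => rho0 < cabs z -> e <= cabs (g z)).
  move=> z0; rewrite subr0 => z0h.
  have z01 : disk 1 z0 by rewrite /disk /=; move: z0h; rewrite /th; lra.
  have [z0r|z0r] := ltP (cabs z0) rho0.
    exists (rho0 - cabs z0) => [|z e zz0 _ _ rz]; first by rewrite subr_gt0.
    by have := le_cabs_add (ltW zz0); lra.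
  have gz0 : 0 < cabs (g z0) / 2 by rewrite divr_gt0// cabs_gt0 g0.
  have [a [b s]] := sg _ z01; have [d d0 hd] := sdiff_continuous s gz0.
  exists (Num.min d (cabs (g z0) / 2)) => [|z e]; first by rewrite lt_min d0.
  rewrite !lt_min => /andP[zd _] _ /andP[_ eg] _.
  have := ltW (hd _ zd); rewrite cabsBC => /le_cabs_add; lra.
have th0 : 0 < th by rewrite divr_gt0// subr_gt0.
exists ((1 + rho0) / 2), th, (del / 2); split.
- by rewrite th0 /=; rewrite /th; lra.
- by apply/andP; split; lra.
- by rewrite divr_gt0.
move=> z; rewrite ler_norml => /andP[h1 h2].
apply: hdel; rewrite ?subr0 ?divr_gt0//; move: h1 h2; rewrite /th; lra.
Qed.

Lemma dyadic_cover (x : R) : 1 <= x ->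
  exists2 N, x <= 2 ^+ N & N%:R <= 2 * ln x + 1.
Proof.
move=> x1; have x0 : 0 < x by exact: lt_le_trans x1.
have l0 : 0 <= 2 * ln x by rewrite mulr_ge0// ln_ge0.
have /andP[h1 h2] := truncn_itv l0.
exists (Num.truncn (2 * ln x)).+1; last by rewrite -natr1; lra.
(* Because exp(-1/2) >= 1 - 1/2. *)
have e2 : expR (1 / 2) <= 2 :> R.
  have e0 := expR_gt0 (1 / 2 : R).
  have := ler_wpM2r (ltW e0) (expR_ge1Dx (- (1 / 2) : R)).
  by rewrite expRN mulVf ?gt_eqF//; lra.
set n := (Num.truncn _).+1 in h2 *.
apply: (@le_trans _ _ (expR (1 / 2) ^+ n)); last first.
  by rewrite lerXn2r ?nnegrE ?expR_ge0.
by rewrite -expRM_natl -{1}[x]lnK ?posrE// ler_expR; lra.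
Qed.

Lemma diam_le_double C (r : R) : C `<=` disk r -> (exists z w, [/\ C z, C w & z <> w]) ->
  0 < diam C <= 2 * r /\ exists p q, [/\ C p, C q, p != q & diam C <= 2 * cabs (q - p)].
Proof.
move=> Cr [z [w [Cz Cw zw]]].
set D := [set cabs (zw.1 - zw.2) | zw in C `*` C].
have Dzw : D (cabs (z - w)) by exists (z, w).
have ubD : ubound D (2 * r).
  move=> _ [[a b] [/= Ca Cb] <-]; apply: le_trans (le_cabsB _ _) _.
  by have := Cr _ Ca; have := Cr _ Cb; rewrite /disk /=; lra.
have hsD : has_sup D by split; [exists (cabs (z - w))|exists (2 * r)].
have zw0 : 0 < cabs (z - w) by rewrite cabs_gt0 subr_eq0; apply/eqP.
have d0 : 0 < diam C.
  by apply: lt_le_trans zw0 _; exact: (ub_le_sup hsD.2).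
split; first by rewrite d0 /=; apply: (ge_sup hsD.1).
have [_ [[a b] [/= Ca Cb] <-] hab] := sup_adherent (divr_gt0 d0 (ltr0n R 2)) hsD.
have hab' : diam C / 2 < cabs (a - b) by move: hab; rewrite -/(diam C); lra.
exists b, a; split => //; last by lra.
rewrite eq_sym -subr_eq0 -cabs_gt0; lra.
Qed.

(** The constants depend on [f] and [alpha] only. This single inequality rules out both infinite
    upper limits, once log(1 + 1/d) is compared with 1/tau2(1/d) or with log(1/d). *)
Lemma univalent_bound f (alpha : R[i]) :
  univalent_sense_preserving_harmonic (disk 1) f ->
  exists kap R0 M0 : R, [/\ 0 < kap, R0 < 1, 0 < M0 &
    forall C (r M : R), 0 < r < 1 -> 0 < M < M0 -> nondegenerate_continuum C ->
      C `<=` disk r -> (forall z, C z -> R0 <= cabs z) ->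
      (forall z, C z -> cabs (f z - alpha) < M) ->
      ln (1 / M) * ((1 - r) / (1 + r)) <= kap * ln (1 + 1 / diam C)].
Proof.
move=> [hf finj sf]; pose g z := f z - alpha.
have ginj : set_inj (disk 1) g.
  by move=> z w z1 w1 /(congr1 (fun x => x + alpha)); rewrite /g !subrK; exact: finj.
have sg z : disk 1 z -> sdiff g z (dz f z) (dzbar f z).
  move=> z1; apply: (sdiff_eq _ _ _ (sdiffD (harmonic_sdiff hf z1) (sdiff_cst (- alpha) z))).
  - by [].
  - by rewrite addr0.
  - by rewrite addr0.
have [c c0 hc] := dilatation_bound hf sf.
have [|rho1 [th [del [th01 /andP[rho10 rho11] del0 hE]]]] := annulus_lower_bound ginj.
  by move=> z /sg; exists (dz f z), (dzbar f z).
have /andP[th0 th1] := th01.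
pose B := (2 / th * 5 + 80) * (ln (3 / 2 : R))^-1 .
have l32 : 0 < ln (3 / 2 : R) by apply: ln_gt0; lra.
(* Additive constants are multiplied by E / ln(3/2), which is at least 1 for diameters up to 2. *)
pose c2 : R := 2 / th * (3 / ln (3 / 2) + 2) + 80 / ln (3 / 2).
have c20 : 0 < c2.
  by rewrite addr_gt0 ?divr_gt0// mulr_gt0 ?divr_gt0// addr_gt0// divr_gt0.
pose kap := 2 ^+ 25 / c * c2.
(* The second witness puts [C] beyond the circle |z| = rho1. The third makes ln(1/M) dominate |ln
   del|, which gives Lam >= 2 and ln(1/M) <= 2 Lam. *)
exists kap, ((1 + rho1) / 2), (expR (- (4 + 2 * `|ln del|))); split.
- by rewrite /kap mulr_gt0// divr_gt0// exprn_gt0.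
- by lra.
- exact: expR_gt0.
move=> C r M /andP[r0 r1] /andP[M0 MM0] [cC cnC Cne] Cr CR0 CM.
have [/andP[d0 d2] [p [q [Cp Cq pq dpq]]]] := diam_le_double Cr Cne.
have hlnM : 4 + 2 * `|ln del| < ln (1 / M).
  have e : ln M < - (4 + 2 * `|ln del|).
    by rewrite -[X in _ < X]expRK ltr_ln ?posrE// expR_gt0.
  by rewrite div1r lnV ?posrE//; lra.
pose Lam := ln del - ln M.
have lnV1 : ln (1 / M) = - ln M by rewrite div1r lnV ?posrE.
have LamM : ln (1 / M) <= 2 * Lam.
  rewrite /Lam; move: hlnM; rewrite lnV1; have := ler_norm (- ln del).
  rewrite normrN; lra.
have Lam2 : 2 <= Lam.
  by move: LamM hlnM; have := normr_ge0 (ln del); lra.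
have Md : M <= del by rewrite -ler_ln ?posrE//; move: Lam2; rewrite /Lam; lra.
(* The dyadic count is at most 2 Lam + 4, and Lam >= 2 absorbs the constant. *)
have [N N1 N2] : exists2 N, 2 * del <= 2 ^+ N * M & N.+1%:R <= 4 * Lam.
  have [|N h1 h2] := @dyadic_cover (2 * del / M).
    by rewrite ler_pdivlMr// mul1r; lra.
  exists N; first by rewrite -ler_pdivrMr.
  rewrite -natr1; apply: le_trans (lerD h2 (lexx _)) _.
  have ln2 : ln 2 <= 1 :> R.
    have -> : (2 : R) = 1 + 1 by ring.
    by apply: le_ln1Dx; lra.
  have -> : ln (2 * del / M) = ln 2 + Lam.
    by rewrite ln_div ?posrE ?mulr_gt0// (@lnM R) ?posrE// /Lam; ring.
  lra.
(* From |a| + |b| <= 2 |a| and [dilatation_bound]. *)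
pose K := 2 / (c * (1 - r)).
have K0 : 0 <= K by rewrite divr_ge0// mulr_ge0 ?(ltW c0)//; lra.
have hcell : exists2 rho : R, 0 < rho & forall z e, cabs z <= r -> 0 < e -> e < rho ->
     cell g M del (2 ^+ 18 * K) N z e.
  have [|rho rho0 h] := @cdisk_uniform R 0 r (cell g M del (2 ^+ 18 * K) N).
    move=> z; rewrite subr0 => zr.
    have z1 : disk 1 z by rewrite /disk /=; exact: le_lt_trans r1.
    apply: (local_cell (sg _ z1) (sf _ z1)) => //.
    have := sf _ z1 => ba.
    rewrite /K -ler_pdivrMl ?divr_gt0 ?mulr_gt0 ?subr_gt0//.
    rewrite invf_div mulrAC ler_pdivrMr//.
    have h1 : c * (1 - r) * cabs (dz f z) <= c * (1 - cabs z) * cabs (dz f z).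
      by rewrite ler_wpM2r ?cabs_ge0// ler_pM2l//; lra.
    have h2 := hc _ z1.
    have h3 : c * (1 - r) * (cabs (dz f z) + cabs (dzbar f z)) <=
        c * (1 - r) * (2 * cabs (dz f z)).
      by rewrite ler_pM2l ?mulr_gt0 ?subr_gt0//; lra.
    lra.
  by exists rho => // z e zr; apply: h; rewrite subr0.
have rp : rho1 < cabs p by apply: lt_le_trans (CR0 _ Cp); lra.
have Cr' w : C w -> cabs w <= r by move=> /Cr /ltW.
have CM' w : C w -> cabs (g w) <= M by move=> /CM /ltW.
have := length_area ginj K0 M0 Md (ltW r0) r1 hcell th01 rho10 hE cnC Cr' CM' Cp Cq pq rp erefl erefl.
set S := cabs p - rho1; set t1 := _ / 2; rewrite -/Lam => main.
have S0 : 0 < S by rewrite subr_gt0.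
have S1 : S <= 1 by have := Cr' _ Cp; rewrite /S; lra.
have qp0 : 0 < cabs (q - p) by rewrite cabs_gt0 subr_eq0 eq_sym.
have mqp0 : 0 < Num.min S (cabs (q - p)) by rewrite lt_min S0.
have t10 : 0 < t1 by rewrite divr_gt0.
set E := ln (1 + 1 / diam C).
have E32 : ln (3 / 2) <= E.
  rewrite ler_ln ?posrE ?addr_gt0 ?divr_gt0//.
  have : 1 / 2 <= 1 / diam C by rewrite ler_pdivlMr//; lra.
  lra.
(* As S <= 1 and diam C <= 2 |q - p|, the ratio S / t1 is at most 2 (1 + 1/d)^2, and 2 <= e. *)
have lnSt : ln (S / t1) <= 1 + 2 * E.
  have -> : 1 + 2 * E = ln (expR 1 * (1 + 1 / diam C) ^+ 2).
    rewrite (@lnM R) ?posrE ?expR_gt0 ?exprn_gt0 ?addr_gt0 ?divr_gt0//.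
    by rewrite expRK lnXn ?addr_gt0 ?divr_gt0// mulr_natl.
  have D0 : 0 < 1 / diam C by rewrite divr_gt0.
  have q0 : 0 < (1 + 1 / diam C) ^+ 2 by rewrite exprn_gt0// addr_gt0.
  rewrite ler_ln ?posrE; [|exact: divr_gt0|by rewrite mulr_gt0// expR_gt0].
  have e1 := expR_ge1Dx (1 : R).
  have h1 : S / Num.min S (cabs (q - p)) <= (1 + 1 / diam C) ^+ 2.
    rewrite ler_pdivrMr//; have [Sq|qS] := leP S (cabs (q - p)).
      rewrite ler_peMl ?(ltW S0)//; rewrite expr2; nra.
    have h2 : 1 <= 2 / diam C * cabs (q - p).
      by rewrite mulrAC ler_pdivlMr// mul1r.
    have -> : (1 + 1 / diam C) ^+ 2 = 1 + 2 / diam C + (1 / diam C) ^+ 2 by ring.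
    have := sqr_ge0 (1 / diam C); nra.
  have -> : S / t1 = 2 * (S / Num.min S (cabs (q - p))).
    by rewrite /t1; field; rewrite gt_eqF.
  by apply: ler_pM => //; rewrite divr_ge0// ltW.
have E0 : 0 < E by exact: lt_le_trans E32.
have bnd : 2 / th * (ln (S / t1) + 2) + 80 <= c2 * E.
  have u1 : 1 <= E / ln (3 / 2) by rewrite ler_pdivlMr// mul1r.
  have -> : c2 * E = 2 / th * (3 * (E / ln (3 / 2)) + 2 * E) + 80 * (E / ln (3 / 2)).
    by rewrite /c2; ring.
  apply: lerD; last by lra.
  rewrite ler_pM2l ?divr_gt0//; move: lnSt u1.
  by move: (ln (S / t1)) (E / ln (3 / 2)) => a b ab b1; lra.
have Lam0 : 0 < Lam by lra.
(* [N.+1 <= 4 * Lam] makes the right side of [main] linear in [Lam], so one factor [Lam] cancels. *)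
have Lamle : Lam <= 2 ^+ 23 * K * (c2 * E).
  rewrite -(ler_pM2l Lam0) -expr2; apply: le_trans main _.
  have -> : Lam * (2 ^+ 23 * K * (c2 * E)) = 2 * (4 * (2 ^+ 18 * K) * (4 * Lam)) * (c2 * E).
    by ring.
  apply: ler_pM => //.
  - by rewrite mulr_ge0// mulr_ge0// mulr_ge0// mulr_ge0.
  - rewrite addr_ge0// mulr_ge0 ?divr_ge0 ?(ltW th0)// addr_ge0// ln_ge0//.
    rewrite ler_pdivlMr ?divr_gt0// mul1r.
    apply: (@le_trans _ _ (S / 2)); last by lra.
    by rewrite ler_pM2r// ge_min lexx.
  - by rewrite ler_pM2l// ler_wpM2l// mulr_ge0// mulr_ge0.
apply: (@le_trans _ _ (2 * Lam * (1 - r))).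
  apply: ler_pM.
  - by rewrite lnV1; move: hlnM; rewrite lnV1; have := normr_ge0 (ln del); lra.
  - by rewrite divr_ge0//; lra.
  - exact: LamM.
  - by rewrite ler_pdivrMr; [rewrite ler_peMr; lra|lra].
apply: (@le_trans _ _ (2 * (2 ^+ 23 * K * (c2 * E)) * (1 - r))).
  by rewrite ler_pM2r ?subr_gt0// ler_pM2l.
rewrite le_eqVlt; apply/orP; left; apply/eqP; rewrite /K /kap -/E; field.
by rewrite gt_eqF//= subr_eq0 gt_eqF.
Qed.

End univalent.

(** * The Teichmuller capacity *)

Section arc_length_theory.
Context {R : realType}.
Implicit Types (g : R -> R[i]) (a b s t u : R).
Local Open Scope ereal_scope.

Let psum g b a (l : seq R) : R :=
  (\sum_(0 <= k < size l) cabs (g (nth b (a :: l) k.+1) - g (nth b (a :: l) k)))%R.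

Lemma psum_rcons g a t u l :
  psum g u a (rcons l u) = (psum g t a l + cabs (g u - g (last a l)))%R.
Proof.
(* The default of [nth] is the right end point and differs between the two sums; no index in range
   reaches it. *)
have E i : (i <= size l)%N -> nth u (a :: rcons l u) i = nth t (a :: l) i.
  move=> il; rewrite -rcons_cons nth_rcons [size (a :: l)]/= ltnS il.
  by apply: set_nth_default; rewrite /= ltnS.
rewrite /psum size_rcons big_nat_recr // (E (size l))// -(last_nth t).
have -> : nth u (a :: rcons l u) (size l).+1 = u by rewrite /= nth_rcons ltnn eqxx.
congr (_ + _)%R; apply: eq_big_nat => k /andP[_ kl].
by rewrite !E// ltnW.
Qed.

Lemma arc_length_ge0 g a t : (a <= t)%R -> 0 <= arc_length g a t.
Proof.
rewrite le_eqVlt => /predU1P[<-|at_].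
  apply: (@le_trans _ _ (psum g a a [::])%:E).
    by rewrite /psum big_nil.
  by apply: ereal_sup_ubound; exists [::].
apply: (@le_trans _ _ (psum g t a [:: t])%:E).
  by rewrite lee_fin sumr_ge0// => i _; exact: cabs_ge0.
apply: ereal_sup_ubound; exists [:: t] => //.
exact: itv_partition1.
Qed.

(** Every partition of [a, t] extends by the point [u], which adds one chord. *)
Lemma arc_length_add g a t u : (a <= t)%R -> (t <= u)%R ->
  arc_length g a t + (cabs (g u - g t))%:E <= arc_length g a u.
Proof.
move=> at_; rewrite le_eqVlt => /predU1P[<-|tu].
  by rewrite subrr cabs0 adde0.
rewrite -leeBrDr//; apply: ge_ereal_sup => _ [l [pl /eqP ll] <-].
rewrite leeBrDr// -EFinD -/(psum g t a l).
rewrite -[in X in (_ + X)%R]ll -(psum_rcons g a t u l).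
apply: ereal_sup_ubound; exists (rcons l u) => //; split.
  by rewrite rcons_path pl ll.
by rewrite last_rcons.
Qed.

Lemma le_arc_length g a t u : (a <= t)%R -> (t <= u)%R ->
  arc_length g a t <= arc_length g a u.
Proof.
move=> at_ tu; apply: le_trans (arc_length_add g at_ tu).
by rewrite leeDl// lee_fin cabs_ge0.
Qed.

Local Close Scope ereal_scope.

Context (g : R -> R[i]) (a b : R).
Context (ab : a <= b) (cg : {within `[a, b], continuous g})
  (fin : (arc_length g a b < +oo)%E).
Local Notation L := (fine (arc_length g a b)).
Local Notation gam := (arc_length_param g a b).

Let level (s : R) := [set t | a <= t <= b /\ (s%:E <= arc_length g a t)%E].

Let LE : arc_length g a b = L%:E.
Proof. by rewrite fineK// ge0_fin_numE// arc_length_ge0. Qed.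

Lemma arc_length_fine_ge0 : 0 <= L.
Proof. by rewrite -lee_fin -LE arc_length_ge0. Qed.

Let level_b s : s <= L -> level s b.
Proof. by move=> sL; split; rewrite ?ab ?lexx// LE lee_fin. Qed.

Let level_inf s : s <= L -> has_inf (level s).
Proof.
by move=> sL; split; [exists b; exact: level_b|exists a => t [/andP[]]].
Qed.

Let time s := inf (level s).

Let time_itv s : s <= L -> a <= time s <= b.
Proof.
move=> sL; have hi := level_inf sL; apply/andP; split.
  by apply: lb_le_inf hi.1 _ => t [/andP[]].
by apply: ge_inf hi.2 _ _; exact: level_b.
Qed.

Let after_time s t : s <= L -> time s < t -> t <= b -> (s%:E <= arc_length g a t)%E.
Proof.
move=> sL st tb; have hi := level_inf sL.
have [t0 [/andP[at0 _] h0] t0t] : exists2 t0, level s t0 & t0 < t.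
  have ts0 : 0 < t - time s by rewrite subr_gt0.
  have [t0 h0 h1] := inf_adherent ts0 hi.
  by exists t0 => //; apply: lt_le_trans h1 _; rewrite addrC subrK.
by apply: le_trans h0 _; apply: le_arc_length => //; exact: ltW.
Qed.

Let before_time s t : s <= L -> a <= t -> t < time s -> (arc_length g a t < s%:E)%E.
Proof.
move=> sL at_ ts; rewrite ltNge; apply/negP => h.
have tb : t <= b by case/andP: (time_itv sL) => _; apply: le_trans; exact: ltW.
have : time s <= t by apply: ge_inf (level_inf sL).2 _ _; rewrite /level /= at_ tb.
by rewrite leNgt ts.
Qed.

Let increment t u s s' : a <= t -> t <= u -> (s%:E <= arc_length g a t)%E ->
  (arc_length g a u <= s'%:E)%E -> cabs (g u - g t) <= s' - s.
Proof.
move=> at_ tu st us'; rewrite lerBrDl -lee_fin EFinD.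
by apply: le_trans (le_trans (arc_length_add g at_ tu) us'); rewrite leeD2r.
Qed.

Let g_near t (e : R) : a <= t <= b -> 0 < e -> exists2 d : R, 0 < d &
  forall u, a <= u <= b -> `|u - t| < d -> cabs (g u - g t) < e.
Proof.
move=> tab e0; have /subspace_continuousP/(_ t) := cg.
rewrite /= in_itv /= => /(_ tab) cgt.
have nV : nbhs (g t) [set w | cabs (w - g t) < e].
  by apply/nbhs_cabsP; exists e.
have /nbhs_ballP[d d0 hd] := cgt _ nV.
exists d => // u uab ut; apply: hd; last by rewrite /= in_itv.
by rewrite -ball_normE /= distrC.
Qed.

(** The infimum defining the time of arrival is not shown to be attained. The length is therefore
    compared slightly after the first time and slightly before the second, and continuity of [g]
    removes the gap. *)
Lemma arc_length_param_lip s s' : 0 <= s -> s <= s' -> s' <= L ->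
  cabs (gam s' - gam s) <= s' - s.
Proof.
move=> s0 ss' s'L; have sL := le_trans ss' s'L.
have /andP[at1 t1b] := time_itv sL; have /andP[at2 t2b] := time_itv s'L.
have : time s <= time s'.
  apply: lb_le_inf (level_inf s'L).1 _ => t [tab ht].
  apply: ge_inf (level_inf sL).2 _ _; split => //.
  by apply: le_trans ht; rewrite lee_fin.
rewrite /arc_length_param -/(level s) -/(level s') -/(time s) -/(time s').
rewrite le_eqVlt => /predU1P[->|t12]; first by rewrite subrr cabs0 subr_ge0.
apply/ler_addgt0Pl => e e0.
have e20 : 0 < e / 2 by rewrite divr_gt0.
have [|d1 d10 hd1] := @g_near (time s) _ _ e20; first by rewrite at1.
have [|d2 d20 hd2] := @g_near (time s') _ _ e20; first by rewrite at2.
pose h := Num.min (Num.min (d1 / 2) (d2 / 2)) ((time s' - time s) / 3).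
have h0 : 0 < h by rewrite !lt_min !divr_gt0// subr_gt0.
have [hd1' hd2' h3] : [/\ h <= d1 / 2, h <= d2 / 2 & h <= (time s' - time s) / 3].
  by rewrite !ge_min !lexx !orbT.
pose t := time s + h; pose u := time s' - h.
have k1 : cabs (g t - g (time s)) < e / 2.
  by apply: hd1; [apply/andP; rewrite /t; split; lra|rewrite /t addrC addKr gtr0_norm; lra].
have k2 : cabs (g u - g (time s')) < e / 2.
  apply: hd2; first by apply/andP; rewrite /u; split; lra.
  by rewrite /u addrC addKr normrN gtr0_norm; lra.
have k3 : cabs (g u - g t) <= s' - s.
  apply: increment; [rewrite /t; lra|rewrite /t /u; lra| |].
    by apply: after_time => //; rewrite /t; lra.
  by apply/ltW/before_time => //; rewrite /u; lra.
apply: le_trans (cabs_triangle _ _ (g u)) _; rewrite cabsBC.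
have := cabs_triangle (g u) (g (time s)) (g t); lra.
Qed.

Lemma arc_length_param0 : gam 0 = g a.
Proof.
rewrite /arc_length_param; congr g; apply/eqP; rewrite eq_le.
have L0 := arc_length_fine_ge0.
have /andP[h _] := time_itv L0; rewrite h andbT.
apply: ge_inf (level_inf L0).2 _ _; split; first by rewrite lexx ab.
exact: arc_length_ge0.
Qed.

(** Right after the time of arrival the whole length is already used up, so [g] stays at [g b] from
    there on; continuity carries this back to the arrival time. *)
Lemma arc_length_paramL : gam L = g b.
Proof.
have /andP[at1 t1b] := time_itv (lexx L).
rewrite /arc_length_param -/(level L) -/(time L).
move: t1b; rewrite le_eqVlt => /predU1P[->//|tb].
apply/eqP; rewrite -subr_eq0 -cabs_eq0 -normr_le0 ger0_norm ?cabs_ge0//.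
apply/ler_addgt0Pl => e e0; rewrite addr0.
have [|d d0 hd] := @g_near (time L) _ _ e0; first by rewrite at1 ltW.
pose t := time L + Num.min (d / 2) ((b - time L) / 2).
have [m1 m2] : Num.min (d / 2) ((b - time L) / 2) <= d / 2 /\
   Num.min (d / 2) ((b - time L) / 2) <= (b - time L) / 2.
  by rewrite !ge_min !lexx orbT.
have m0 : 0 < Num.min (d / 2) ((b - time L) / 2) by rewrite lt_min !divr_gt0// subr_gt0.
have tb' : t <= b by rewrite /t; lra.
have k1 : cabs (g t - g (time L)) < e.
  apply: hd; first by rewrite tb' andbT /t; lra.
  by rewrite /t addrC addKr gtr0_norm; lra.
have : cabs (g b - g t) <= L - L.
  apply: increment => //; [rewrite /t; lra| |by rewrite LE].
  by apply: after_time => //; rewrite /t; lra.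
rewrite subrr => k2; rewrite cabsBC.
have := cabs_triangle (g b) (g (time L)) (g t); lra.
Qed.

End arc_length_theory.

(** * A test density on concentric annuli *)

Section teichmuller.
Context {R : realType}.

(** [x2] is the first parameter where [phi] reaches [r2], and [x1] the last one before it where
    [phi] is at most [r1]. *)
Lemma crossing (phi : R -> R) (L r1 r2 : R) : 0 <= L ->
  (forall s s', 0 <= s -> s <= s' -> s' <= L -> `|phi s' - phi s| <= s' - s) ->
  phi 0 <= r1 -> r1 < r2 -> r2 <= phi L ->
  exists x1 x2, [/\ 0 <= x1, x2 <= L, r2 - r1 <= x2 - x1 &
    forall x, x1 < x < x2 -> r1 < phi x < r2].
Proof.
move=> L0 lip p0 r12 pL.
pose A2 := [set x | 0 <= x <= L /\ r2 <= phi x]; pose x2 := inf A2.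
have A2L : A2 L by split; rewrite ?L0 ?lexx.
have hA2 : has_inf A2 by split; [exists L|exists 0 => x [/andP[]]].
have x20 : 0 <= x2 by apply: lb_le_inf hA2.1 _ => x [/andP[]].
have x2L : x2 <= L by exact: ge_inf hA2.2 _ A2L.
have px2 : r2 <= phi x2.
  apply/ler_addgt0Pl => e e0.
  have [x [/andP[x0 xL] hx] xe] := inf_adherent e0 hA2.
  have x2x : x2 <= x by apply: ge_inf hA2.2 _ _; split; rewrite ?x0.
  have := lip _ _ x20 x2x xL; rewrite ler_norml => /andP[_ h].
  move: xe; rewrite -/x2; lra.
pose A1 := [set x | 0 <= x <= x2 /\ phi x <= r1]; pose x1 := sup A1.
have A10 : A1 0 by split; rewrite ?x20 ?lexx.
have hA1 : has_sup A1 by split; [exists 0|exists x2 => x [/andP[]]].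
have x10 : 0 <= x1 by exact: ub_le_sup hA1.2 _ A10.
have x12 : x1 <= x2 by apply: ge_sup hA1.1 _ => x [/andP[]].
have px1 : phi x1 <= r1.
  apply/ler_addgt0Pl => e e0.
  have [x [/andP[x0 xx2] hx] xe] := sup_adherent e0 hA1.
  have xx1 : x <= x1 by apply: ub_le_sup hA1.2 _ _; split; rewrite ?x0.
  have := lip _ _ x0 xx1 (le_trans x12 x2L); rewrite ler_norml => /andP[_ h].
  move: xe; rewrite -/x1; lra.
exists x1, x2; split => //.
  have := lip _ _ x10 x12 x2L; rewrite ler_norml => /andP[_ h]; lra.
move=> x /andP[x1x xx2]; have x0 : 0 <= x by lra.
apply/andP; split; rewrite ltNge; apply/negP => h.
  have : x <= x1 by apply: ub_le_sup hA1.2 _ _; split => //; rewrite x0 ltW.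
  by rewrite leNgt x1x.
have : x2 <= x.
  by apply: ge_inf hA2.2 _ _; split => //; rewrite x0 (le_trans (ltW xx2)).
by rewrite leNgt xx2.
Qed.

Lemma lipschitz_measurable (phi : R -> R) (L : R) :
  (forall s s', 0 <= s -> s <= s' -> s' <= L -> `|phi s' - phi s| <= s' - s) ->
  measurable_fun (`[0, L]%classic : set (measurableTypeR R)) phi.
Proof.
move=> lip; apply: subspace_continuous_measurable_fun; first exact: measurable_itv.
apply/subspace_continuousP => x /=; rewrite in_itv /= => /andP[x0 xL] V.
move=> /nbhs_ballP[e e0 he]; apply/nbhs_ballP; exists e => // y.
rewrite -ball_normE /= => xy; rewrite in_itv /= => /andP[y0 yL].
apply: he; rewrite -ball_normE /=; apply: le_lt_trans xy.
have /orP[xy|yx] := le_total x y.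
  by rewrite distrC [leRHS]distrC [leRHS]ger0_norm ?subr_ge0//; exact: lip.
by rewrite [leRHS]ger0_norm ?subr_ge0//; exact: lip.
Qed.

(** Centred at -1, so that [-1, 0] lies in |z + 1| <= 1 and the ray from s in |z + 1| >= 1 + s. The
    ratio 3/2 is small enough for one annulus to fit as soon as s >= 1/2. *)
Definition annulus (k : nat) : set R[i] :=
  [set z | (3 / 2) ^+ k < cabs (z + 1) < (3 / 2) ^+ k.+1].

(** The reciprocal of [N] times the width (3/2)^k / 2: crossing one annulus contributes 1/N. The
    density is a step version of a multiple of 1/|z + 1|. *)
Definition annulus_weight (N k : nat) : R := 2 / (N%:R * (3 / 2) ^+ k).

Definition annular_density (N : nat) (z : R[i]) : \bar R :=
  (\sum_(k < N) (annulus_weight N k * \1_(annulus k) z)%:E)%E.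

Lemma annulus_weight_ge0 N k : 0 <= annulus_weight N k.
Proof. by rewrite divr_ge0// mulr_ge0// exprn_ge0// divr_ge0. Qed.

Lemma annular_density_ge0 N z : (0 <= annular_density N z)%E.
Proof.
by apply: sume_ge0 => k _; rewrite lee_fin mulr_ge0 ?annulus_weight_ge0.
Qed.

Lemma annulus_uniq k k' z : annulus k z -> annulus k' z -> k = k'.
Proof.
wlog kk' : k k' / (k <= k')%N.
  move=> h a a'; have /orP[kk'|kk'] := leq_total k k'; first exact: h.
  by apply/esym; exact: h.
move=> /andP[_ h1] /andP[h2 _]; move: kk'; rewrite leq_eqVlt => /predU1P[//|kk'].
have : (3 / 2) ^+ k.+1 <= (3 / 2 : R) ^+ k'.
  by rewrite ler_weXn2l//; lra.
by move=> /(lt_le_trans h1) /(lt_trans h2); rewrite ltxx.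
Qed.

Lemma annular_density_sqr N z : (annular_density N z ^+ 2)%E =
  (\sum_(k < N) (annulus_weight N k ^+ 2 * \1_(annulus k) z)%:E)%E.
Proof.
rewrite /annular_density !sumEFin -EFin_expe; congr EFin.
have [[k zk]|no] := pselect (exists k : 'I_N, annulus k z).
  rewrite (bigD1 k)//= [RHS](bigD1 k)//= !big1 ?addr0.
  - by rewrite !indicE mem_set// !mulr1.
  - move=> j jk; rewrite indicE memNset ?mulr0// => zj.
    by move/eqP: jk; apply; apply: ord_inj; exact: annulus_uniq zj zk.
  - move=> j jk; rewrite indicE memNset ?mulr0// => zj.
    by move/eqP: jk; apply; apply: ord_inj; exact: annulus_uniq zj zk.
rewrite !big1 ?expr0n//.
- by move=> j _; rewrite indicE memNset ?mulr0// => zj; apply: no; exists j.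
- by move=> j _; rewrite indicE memNset ?mulr0// => zj; apply: no; exists j.
Qed.

Definition annulus_xy k : set (measurableTypeR R * measurableTypeR R) :=
  [set p | annulus k (of_xy p)].

Lemma measurable_annulus_xy k : measurable (annulus_xy k).
Proof.
pose q (p : measurableTypeR R * measurableTypeR R) : R := (p.1 + 1) ^+ 2 + p.2 ^+ 2.
have mq : measurable_fun setT q.
  apply: measurable_funD; apply: measurable_funX; last exact: measurable_snd.
  by apply: measurable_funD; [exact: measurable_fst|exact: measurable_cst].
have -> : annulus_xy k = q @^-1` `](((3 / 2) ^+ k) ^+ 2), (((3 / 2) ^+ k.+1) ^+ 2)[%classic.
  apply/funext => -[x y]; apply/propext; rewrite /annulus_xy /annulus /preimage /= in_itv /=.
  have -> : q (x, y) = cabs (of_xy (x, y) + 1) ^+ 2 by rewrite cabsE /q /= addr0.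
  by rewrite !ltr_pXn2r ?nnegrE ?cabs_ge0 ?exprn_ge0 ?divr_ge0.
by rewrite -[X in measurable X]setTI; apply: mq => //; exact: measurable_itv.
Qed.

Lemma indic_annulus_xy k p : \1_(annulus k) (of_xy p) = \1_(annulus_xy k) p :> R.
Proof. by rewrite !indicE; congr (nat_of_bool _)%:R; apply/idP/idP; rewrite !inE. Qed.

Lemma measurable_annulus_indic k :
  measurable_fun [set: measurableTypeR R * measurableTypeR R]
    (fun p => \1_(annulus k) (of_xy p) : R).
Proof.
under eq_fun do rewrite indic_annulus_xy.
by apply: measurable_indic; exact: measurable_annulus_xy.
Qed.

Lemma area_annulus_xy k : (area (annulus_xy k) <= (4 * ((3 / 2) ^+ k.+1) ^+ 2)%:E)%E.
Proof.
set c : R := (3 / 2) ^+ k.+1.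
have c0 : 0 <= c by rewrite exprn_ge0// divr_ge0.
have -> : 4 * c ^+ 2 = 4 * c * c by ring.
rewrite -(@area_shear_x R (-1) 0 0 c c c0 c0).
apply: le_measure; rewrite ?inE; [exact: measurable_annulus_xy|exact: measurable_shear_x|].
move=> p /andP[_ h]; rewrite /shear_x /= mul0r !subr0 opprK; split.
  apply: le_lt_trans h.
  have := Re_le_cabs (of_xy p + 1); by case: p.
apply: le_lt_trans h.
by have := Im_le_cabs (of_xy p + 1); case: p => x y /=; rewrite addr0.
Qed.

Lemma annular_density_borel N : borel_plane (annular_density N).
Proof.
rewrite /borel_plane; apply: emeasurable_sum => k.
apply/measurable_EFinP; apply: measurable_funM; first exact: measurable_cst.
exact: measurable_annulus_indic.
Qed.

(** The annuli are disjoint, so squaring creates no cross terms. Each has area at most that of a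
    square of side 2 (3/2)^(k + 1), hence energy at most 36 / N^2. *)
Lemma annular_density_energy N : (0 < N)%N ->
  (\int[@area R]_p (annular_density N (of_xy p) ^+ 2) <= (36 / N%:R)%:E)%E.
Proof.
move=> N0; have NR : 0 < N%:R :> R by rewrite ltr0n.
under eq_integral do rewrite annular_density_sqr.
rewrite ge0_integral_sum//=; last 2 first.
- move=> k; apply/measurable_EFinP; apply: measurable_funM; first exact: measurable_cst.
  exact: measurable_annulus_indic.
- by move=> k p _; rewrite lee_fin mulr_ge0 ?sqr_ge0// indicE.
have -> : (36 / N%:R)%:E = (\sum_(k < N) (36 / N%:R ^+ 2)%:E)%E :> \bar R.
  rewrite sumEFin sumr_const card_ord -mulr_natl; congr EFin; field.
  by rewrite gt_eqF.
apply: lee_sum => k _.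
under eq_integral do rewrite EFinM.
rewrite ge0_integralZl_EFin;
  [|exact: measurableT|by move=> p _; rewrite lee_fin indicE
   |by apply/measurable_EFinP; exact: measurable_annulus_indic|exact: sqr_ge0].
under eq_integral do rewrite indic_annulus_xy.
rewrite integral_indic//; last exact: measurable_annulus_xy.
rewrite setIT.
apply: le_trans (lee_wpmul2l _ (area_annulus_xy k)) _; first by rewrite lee_fin sqr_ge0.
rewrite -EFinM lee_fin le_eqVlt; apply/orP; left; apply/eqP.
have c0 : 0 < (3 / 2) ^+ k :> R by rewrite exprn_gt0// divr_gt0.
rewrite /annulus_weight (exprS (3 / 2) k); move: ((3 / 2) ^+ k) c0 => c c0.
by field; rewrite !gt_eqF.
Qed.

(** In the arc length parametrization the distance to -1 is 1-Lipschitz, so each of the [N] annuli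
    is occupied for a parameter length of at least its width. *)
Lemma annular_density_line N g : (0 < N)%N ->
  locally_rectifiable g ->
  (exists a b, [/\ a <= b, path_dom g = `[a, b], cabs (g a + 1) <= 1 &
     (3 / 2) ^+ N <= cabs (g b + 1)]) ->
  (1 <= line_integral (annular_density N) g)%E.
Proof.
move=> N0 rect [a [b [ab dom ga gb]]]; have NR : 0 < N%:R :> R by rewrite ltr0n.
have sub : subarcs g (a, b).
  by rewrite /subarcs /= dom !in_itv /= !lexx ab.
have fin := rect _ sub; rewrite /= in fin.
have cg : {within `[a, b], continuous (Defs.path_map g)}.
  by have := @path_continuous _ g; rewrite dom.
set L := fine (arc_length g a b); have L0 : 0 <= L := arc_length_fine_ge0 ab fin.
pose gam := arc_length_param g a b.
pose phi s := cabs (gam s + 1).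
have lip s s' : 0 <= s -> s <= s' -> s' <= L -> `|phi s' - phi s| <= s' - s.
  move=> s0 ss s'L; apply: le_trans (cabs_dist _ _) _.
  have -> : gam s' + 1 - (gam s + 1) = gam s' - gam s by ring.
  exact: arc_length_param_lip.
have p0 : phi 0 <= 1 by rewrite /phi /gam (arc_length_param0 ab fin).
have pL : (3 / 2) ^+ N <= phi L by rewrite /phi /gam (arc_length_paramL ab cg fin).
apply: (@le_trans _ _ (\int[@lebesgue_measure R]_(s in [set` `[0%R, L]])
    annular_density N (gam s))%E); last by apply: ereal_sup_ubound; exists (a, b).
pose D : set (measurableTypeR R) := [set` `[0, L]].
have mD : measurable D by exact: measurable_itv.
pose B k : set (measurableTypeR R) := D `&` phi @^-1` `](3 / 2) ^+ k, (3 / 2) ^+ k.+1[%classic.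
have mB k : measurable (B k).
  by apply: (lipschitz_measurable lip) => //; exact: measurable_itv.
have BE k (s : R) : D s -> \1_(annulus k) (gam s) = \1_(B k) s :> R.
  move=> Ds; rewrite !indicE; congr (nat_of_bool _)%:R; apply/idP/idP; rewrite !inE.
    by move=> h; split => //; rewrite /= in_itv.
  by move=> [_]; rewrite /= in_itv.
have -> : (\int[@lebesgue_measure R]_(s in D) annular_density N (gam s) =
    \sum_(k < N) (annulus_weight N k)%:E * @lebesgue_measure R (B k))%E.
  transitivity (\int[@lebesgue_measure R]_(s in D)
     \sum_(k < N) ((annulus_weight N k)%:E * (\1_(B k) s)%:E))%E.
    apply: eq_integral => s; rewrite inE => Ds.
    by apply: eq_bigr => k _; rewrite EFinM BE.
  rewrite ge0_integral_sum//.
  - apply: eq_bigr => k _; rewrite ge0_integralZl_EFin//.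
    + by rewrite integral_indic// setIAC setIid.
    + by apply/measurable_EFinP; apply: (@measurable_indic _ _ R D (B k)).
    + exact: annulus_weight_ge0.
  - move=> k; apply: emeasurable_funM; first exact: measurable_cst.
    by apply/measurable_EFinP; apply: (@measurable_indic _ _ R D (B k)).
  - by move=> k s _; rewrite mule_ge0 ?lee_fin ?annulus_weight_ge0.
have -> : 1%E = (\sum_(k < N) (N%:R^-1)%:E)%E :> \bar R.
  by rewrite sumEFin sumr_const card_ord -[_ *+ N]mulr_natl divff// gt_eqF.
apply: lee_sum => k _.
have k0 : 0 < (3 / 2) ^+ k :> R by rewrite exprn_gt0// divr_gt0.
have l1 : phi 0 <= (3 / 2) ^+ k by apply: le_trans p0 _; rewrite exprn_ege1//; lra.
have l2 : (3 / 2) ^+ k < (3 / 2) ^+ k.+1 :> R by rewrite exprS; lra.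
have l3 : (3 / 2) ^+ k.+1 <= phi L.
  by apply: le_trans pL; rewrite ler_weXn2l//; lra.
have [x1 [x2 [x10 x2L x12 hx]]] := crossing L0 lip l1 l2 l3.
have sB : `]x1, x2[%classic `<=` B k.
  move=> x; rewrite /= in_itv /= => x1x; split; last by rewrite /= in_itv /= hx.
  rewrite /D /= in_itv /=; case/andP: x1x => h1 h2.
  by rewrite (le_trans x10 (ltW h1)) (le_trans (ltW h2) x2L).
apply: (@le_trans _ _ ((annulus_weight N k)%:E * @lebesgue_measure R `]x1, x2[%classic)%E).
  have x12' : x1 < x2 by rewrite -subr_gt0; apply: lt_le_trans x12; rewrite subr_gt0.
  rewrite lebesgue_measure_itv /= lte_fin x12' -EFinB -EFinM lee_fin.
  apply: le_trans (ler_wpM2l (annulus_weight_ge0 N k) x12).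
  rewrite le_eqVlt; apply/orP; left; apply/eqP.
  rewrite /annulus_weight exprS; move: ((3 / 2) ^+ k) k0 => c c0.
  by field; rewrite !gt_eqF.
apply: lee_wpmul2l; first by rewrite lee_fin annulus_weight_ge0.
by apply: le_measure => //; rewrite inE//; exact: measurable_itv.
Qed.

Lemma tau2_le N (s : R) : (0 < N)%N -> 0 < s -> (3 / 2) ^+ N <= 1 + s ->
  (tau2 s <= (36 / N%:R)%:E)%E.
Proof.
move=> N0 s0 hN; apply: le_trans (annular_density_energy N0).
apply: ereal_inf_lbound; exists (annular_density N) => //; split.
- exact: annular_density_borel.
- exact: annular_density_ge0.
move=> g [a [b [ab dom [x xI xE] [y yI yE]]]] rect.
apply: annular_density_line => //; exists a, b; split => //.
  rewrite -xE -(rmorphD (real_complex R)) cabs_real.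
  move: xI; rewrite /= in_itv /= => /andP[? ?].
  by rewrite ler_norml; apply/andP; split; lra.
rewrite -yE -(rmorphD (real_complex R)) cabs_real.
move: yI; rewrite /= in_itv /= andbT => sy.
by apply: le_trans hN _; apply: le_trans (ler_norm _); rewrite addrC lerD2r.
Qed.

Lemma tau2_log_le : exists2 c : R, 0 < c & forall s, 1 / 2 <= s ->
  (tau2 s <= (c / ln (1 + s))%:E)%E.
Proof.
have l0 : 0 < ln (3 / 2 : R) by apply: ln_gt0; lra.
(* The number of annuli is the integer part of a quotient that is at least 1, hence at least half of
   it, and 72 = 2 * 36. *)
exists (72 * ln (3 / 2)) => [|s s2]; first by rewrite mulr_gt0.
have e0 : 0 < 3 / 2 :> R by rewrite divr_gt0.
have s0 : 0 < s by lra.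
have s1 : 0 < 1 + s by lra.
have ls : ln (3 / 2) <= ln (1 + s) by rewrite ler_ln ?posrE//; lra.
have ls0 : 0 < ln (1 + s) by exact: lt_le_trans ls.
have q1 : 1 <= ln (1 + s) / ln (3 / 2) by rewrite ler_pdivlMr// mul1r.
have q0 : 0 <= ln (1 + s) / ln (3 / 2) by exact: le_trans q1.
have /andP[h1 h2] := truncn_itv q0.
set N := Num.truncn _ in h1 h2.
have N0 : (0 < N)%N by rewrite /N truncn_gt0.
have NR : 1 <= N%:R :> R by rewrite ler1n.
apply: le_trans (tau2_le N0 s0 _) _.
  rewrite -ler_ln ?posrE ?exprn_gt0// lnXn// -[_ *+ N]mulr_natl -ler_pdivlMr//.
rewrite lee_fin ler_pdivrMr; last lra.
rewrite mulrAC ler_pdivlMr//.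
have : ln (1 + s) <= 2 * N%:R * ln (3 / 2).
  rewrite -ler_pdivrMr//; move: h2; rewrite -natr1; lra.
lra.
Qed.

End teichmuller.

(** * The theorem *)

Lemma limn_esup_lt_pinfty (R : realType) (u : (\bar R)^nat) (B : R) :
  (\forall j \near \oo, (u j <= B%:E)%E) -> limn_esup u != +oo%E.
Proof.
move=> uB; rewrite -ltey; apply: (@le_lt_trans _ _ B%:E); last exact: ltry.
rewrite /limn_esup /limf_esup; apply: ge_ereal_inf.
exists (ereal_sup (u @` [set j | (u j <= B%:E)%E])).
  by exists [set j | (u j <= B%:E)%E].
by apply: ge_ereal_sup => _ [j /= uj <-].
Qed.

(** In the second claim the diameters eventually avoid an interval ending at 1: as d increases to 1,
    1/log(1/d) is unbounded while tau2(1/d) is not, so it could not be controlled by the bound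
    behind the first claim. *)
Theorem theorem1 (R : realType) (f : R[i] -> R[i]) (alpha : R[i])
    (r M : nat -> R) (C : nat -> set R[i])
    (hf : (univalent_sense_preserving_harmonic (disk 1) f /\ dzbar f 0 = 0) \/
          (exists c : R[i], forall z, disk 1 z -> f z = c))
    (hr01 : forall j, 0 < r j < 1)
    (hr : r j @[j --> \oo] --> (1 : R))
    (hM0 : forall j, 0 < M j)
    (hM : M j @[j --> \oo] --> (0 : R))
    (hC : forall j, nondegenerate_continuum (C j))
    (hCr : forall j, C j `<=` disk (r j))
    (hC1 : inf [set cabs z | z in C j] @[j --> \oo] --> (1 : R))
    (hfC : forall j z, C j z -> cabs (f z - alpha) < M j) :
  (limn_esup (fun j => tau2 (1 / diam (C j)) *
     (ln (1 / M j) * ((1 - r j) / (1 + r j)))%:E)%E = +oo%E ->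
   forall z, disk 1 z -> f z = alpha)
  /\
  ((exists2 q : R, q < 1 & \forall j \near \oo, ~~ (q < diam (C j) < 1)) ->
   limn_esup (fun j => ((ln (1 / diam (C j)))^-1 *
     ln (1 / M j) * ((1 - r j) / (1 + r j)))%:E) = +oo%E ->
   forall z, disk 1 z -> f z = alpha).
Proof.
case: hf => [[hf _]|[c hc]]; last first.
  suff cE : c = alpha by split=> *; rewrite hc.
  apply/eqP; rewrite -subr_eq0 -cabs_eq0 -normr_le0 ger0_norm ?cabs_ge0//.
  apply/ler_addgt0Pl => e e0; rewrite addr0.
  have [N _ hN] : \forall j \near \oo, M j < e by exact: cvgr_lt hM _ e0.
  have [_ _ [z [_ [Cz _ _]]]] := hC N.
  have z1 : disk 1 z.
    by have /andP[_ rN1] := hr01 N; exact: lt_trans (hCr _ _ Cz) rN1.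
  have := hfC _ _ Cz; rewrite hc// => h; apply: ltW; apply: lt_trans h _.
  by have := hN N (leqnn N).
have [kap [R0 [M0 [kap0 R01 M00 bound]]]] := univalent_bound alpha hf.
have [c c0 tau] := @tau2_log_le R.
have diamP j : 0 < diam (C j) <= 2.
  have [_ _ Cne] := hC j; have [/andP[d0 d2] _] := diam_le_double (hCr j) Cne.
  by rewrite d0 /=; apply: le_trans d2 _; have /andP[_ ?] := hr01 j; lra.
pose T j := ln (1 / M j) * ((1 - r j) / (1 + r j)).
have hT : \forall j \near \oo, 0 <= T j <= kap * ln (1 + 1 / diam (C j)).
  near=> j.
  have M1 : M j < 1 by near: j; exact: cvgr_lt hM _ ltr01.
  have MM0 : 0 < M j < M0 by rewrite hM0 /=; near: j; exact: cvgr_lt hM _ M00.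
  have R0j : R0 < inf [set cabs z | z in C j] by near: j; exact: cvgr_gt hC1 _ R01.
  have CR0 z : C j z -> R0 <= cabs z.
    move=> Cz; apply: le_trans (ltW R0j) _; apply: ge_inf; last by exists z.
    by exists 0 => _ [w _ <-]; exact: cabs_ge0.
  have /andP[r0 r1] := hr01 j.
  rewrite bound// ?andbT//; last exact: hfC.
  rewrite /T mulr_ge0 ?divr_ge0//; [|lra|lra].
  by apply: ln_ge0; rewrite ler_pdivlMr// mul1r ltW.
have lnd j : 0 < ln (1 + 1 / diam (C j)).
  have /andP[d0 _] := diamP j; apply: ln_gt0.
  by rewrite ltrDl divr_gt0.
split.
  move=> hlim; exfalso; move: hlim; apply/eqP.
  apply: (@limn_esup_lt_pinfty _ _ (c * kap)); near=> j.
  have /andP[T0 Tle] : 0 <= T j <= kap * ln (1 + 1 / diam (C j)) by near: j.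
  have /andP[d0 d2] := diamP j.
  have d12 : 1 / 2 <= 1 / diam (C j) by rewrite ler_pdivlMr//; lra.
  apply: le_trans (lee_wpmul2r _ (tau _ d12)) _; first by rewrite lee_fin.
  rewrite -EFinM lee_fin mulrAC ler_pdivrMr// -mulrA.
  by rewrite ler_pM2l.
move=> [q q1 hq] hlim; exfalso; move: hlim; apply/eqP.
(* The absolute value keeps the constant nonnegative for every [q], as the case of diameter at least
   1 requires; there the term is nonpositive, with value 0 at diameter 1 because the inverse of 0 is
   0. *)
apply: (@limn_esup_lt_pinfty _ _ (kap * (1 + `|ln 2 / ln (1 / q)|))); near=> j.
have /andP[T0 Tle] : 0 <= T j <= kap * ln (1 + 1 / diam (C j)) by near: j.
have /andP[d0 d2] := diamP j.
have qd : ~~ (q < diam (C j) < 1) by near: j.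
rewrite lee_fin -mulrA -/(T j).
have [d1|d1] := leP 1 (diam (C j)).
  apply: (@le_trans _ _ 0); last by rewrite mulr_ge0 ?(ltW kap0)// addr_ge0.
  rewrite mulr_le0_ge0// invr_le0 ln_le0//.
  by rewrite ler_pdivrMr// mul1r.
have dq : diam (C j) <= q by move: qd; rewrite d1 andbT -leNgt.
have q0 : 0 < q by exact: lt_le_trans dq.
have lq0 : 0 < ln (1 / q) by apply: ln_gt0; rewrite ltr_pdivlMr// mul1r.
have ld : ln (1 / q) <= ln (1 / diam (C j)).
  by rewrite ler_ln ?posrE ?divr_gt0// !div1r lef_pV2.
have ld0 : 0 < ln (1 / diam (C j)) by exact: lt_le_trans ld.
have l20 : 0 <= ln 2 :> R by apply: ln_ge0; lra.
rewrite mulrC ler_pdivrMr//; apply: le_trans Tle _.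
rewrite -mulrA ler_pM2l// ger0_norm; last by rewrite divr_ge0// ltW.
(* For d < 1 one has 1 + 1/d <= 2/d; then ln 2 is absorbed using ln(1/d) >= ln(1/q) > 0. *)
apply: (@le_trans _ _ (ln 2 + ln (1 / diam (C j)))).
  have D0 : 0 < 1 / diam (C j) by rewrite divr_gt0.
  have D1 : 1 <= 1 / diam (C j) by rewrite ler_pdivlMr// mul1r ltW.
  rewrite -lnM ?posrE// ler_ln ?posrE; [lra|exact: addr_gt0|exact: mulr_gt0].
rewrite mulrDl [1 * ln _]mul1r [leRHS]addrC lerD2r [leRHS]mulrAC ler_pdivlMr//.
by rewrite ler_wpM2l.
Unshelve. all: by end_near. Qed.
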